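(* Assume that $f=\mathfrak d+b$ and $\sigma$ satisfy Hypothesis (A) and that $\psi$ satisfies Hypothesis (P) (both stated in the context). Let $x\in\mathbb R^d$ and let $(Y,Z,\lambda)$ and $(Y',Z',\lambda')$ be two solutions of the ergodic BSDE $$Y_t=Y_T+\int_t^T[\psi(V_s^x,Z_s)-\lambda]\,ds-\int_t^T Z_s\,dW_s,\qquad \forall\,0\le t\le T<+\infty ,$$ where $Y,Y'$ are progressively measurable continuous processes, $Z,Z'\in\mathscr M^2(\mathbb R_+,\mathbb R^{1\times d})$ and $\lambda,\lambda'\in\mathbb R$. Assume that there are constants $C,C'$ such that, $\mathbb P$-a.s. for all $t\ge0$, $$|Y_t|\le C(1+|V_t^x|^2),\qquad |Y'_t|\le C'(1+|V_t^x|^2).$$ Then $\lambda=\lambda'$.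
   Context: $d\ge 1$ is an integer; $(\cdot,\cdot)$ and $|\cdot|$ are the Euclidean scalar product and norm ($|\cdot|$ also denotes a norm on matrices), and $|||\cdot|||$ is the operator norm on $\mathbb R^{d\times d}$; for the matrix field $\sigma^{-1}$, $|||\sigma^{-1}|||$ means $\sup_x|||\sigma^{-1}(x)|||$. $(\Omega,\mathcal F,\mathbb P)$ is a complete probability space carrying a standard $\mathbb R^d$-valued Brownian motion $W$, and $(\mathcal F_t)_{t\ge0}$ is its natural filtration augmented by the null sets. $\mathscr M^2(\mathbb R_+,\mathbb R^{1\times d})$ is the space of progressively measurable $\mathbb R^{1\times d}$-valued processes $Z$ with $\mathbb E\int_0^T|Z_s|^2ds<\infty$ for all $T>0$. Hypothesis (A), on $f=\mathfrak d+b:\mathbb R^d\to\mathbb R^d$ and $\sigma:\mathbb R^d\to\mathbb R^{d\times d}$: (i) $\mathfrak d:\mathbb R^d\to\mathbb R^d$ is $\eta$-dissipative for some $\eta>0$, i.e. $(\mathfrak d(x)-\mathfrak d(x'),x-x')\le-\eta|x-x'|^2$ for all $x,x'$; it is locally Lipschitz and has polynomial growth: there are $C,\nu>0$ with $|\mathfrak d(x)|\le C(1+|x|^\nu)$ for all $x$; (ii) $b:\mathbb R^d\to\mathbb R^d$ is Lipschitz and $|b|$ is bounded by $B$; (iii) $\sigma$ is Lipschitz, $\sigma(x)$ is invertible for every $x$, and $|\sigma|$ and $|\sigma^{-1}|$ are bounded by $\sigma_\infty$; (iv) there exists $\Lambda\ge0$ such that $|(y,\sigma(x+y)-\sigma(x))|\le\Lambda|y|$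 for all $x,y\in\mathbb R^d$, where $(y,M)$ denotes the row vector ${}^t y\,M$, and there exists $\lambda_0>0$ such that $2(\lambda_0-\lambda_0^2\Lambda^2)>|||\sigma^{-1}|||^2$. Hypothesis (P), on $\psi:\mathbb R^d\times\mathbb R^{1\times d}\to\mathbb R$: $\psi$ is measurable and there exists $M_\psi\in\mathbb R$ such that for all $x\in\mathbb R^d$ and $z,z'\in\mathbb R^{1\times d}$: $\psi(\cdot,z)$ is continuous, $|\psi(x,0)|\le M_\psi$, and $|\psi(x,z)-\psi(x,z')|\le M_\psi|z-z'|$. $(V_t^x)_{t\ge0}$ is the unique strong solution of $V_t^x=x+\int_0^t f(V_s^x)\,ds+\int_0^t\sigma(V_s^x)\,dW_s$. *)

(* Defs.v *)
From HB Require Import structures.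
From mathcomp Require Import all_boot all_order all_algebra.
From mathcomp Require Import all_classical all_reals all_analysis.

Set Implicit Arguments.
Unset Strict Implicit.
Unset Printing Implicit Defensive.
Import Order.TTheory GRing.Theory Num.Theory.
Import numFieldNormedType.Exports.
Local Open Scope classical_set_scope.
Local Open Scope ring_scope.

Section euclidean.
Context {R : realType}.

(* The norm [`|A|] of the library on matrices is the sup norm, hence these
   definitions.  On square matrices [enorm] is the Frobenius norm. *)
Definition inner m n (A B : 'M[R]_(m, n)) : R :=
  \sum_i \sum_j A i j * B i j.

Definition enorm m n (A : 'M[R]_(m, n)) : R := Num.sqrt (inner A A).

Definition opnorm n (A : 'M[R]_n) : R :=
  sup [set enorm (A *m y) | y in [set y : 'cV[R]_n | enorm y <= 1]].

Definition lipschitz_map m n m' n' (g : 'M[R]_(m, n) -> 'M[R]_(m', n')) : Prop :=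
  exists K : R, forall x x', enorm (g x - g x') <= K * enorm (x - x').

Definition locally_lipschitz_map m n m' n'
    (g : 'M[R]_(m, n) -> 'M[R]_(m', n')) : Prop :=
  forall x0, exists r K : R, 0 < r /\
    forall x x', enorm (x - x0) < r -> enorm (x' - x0) < r ->
      enorm (g x - g x') <= K * enorm (x - x').

Definition dissipative n (eta : R) (g : 'cV[R]_n -> 'cV[R]_n) : Prop :=
  forall x x', inner (g x - g x') (x - x') <= - eta * enorm (x - x') ^+ 2.

Definition polynomial_growth n (g : 'cV[R]_n -> 'cV[R]_n) : Prop :=
  exists C nu : R, [/\ 0 < C, 0 < nu &
    forall x, enorm (g x) <= C * (1 + enorm x `^ nu)].

End euclidean.

Section hypotheses.
Context {R : realType} {n : nat}.

Record hypothesis_A (dis b : 'cV[R]_n -> 'cV[R]_n)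
    (sigma : 'cV[R]_n -> 'M[R]_n) : Prop := {
  A_dissipative : exists2 eta : R, 0 < eta & dissipative eta dis;
  A_locally_lipschitz : locally_lipschitz_map dis;
  A_polynomial_growth : polynomial_growth dis;
  A_drift_lipschitz : lipschitz_map b;
  A_drift_bounded : exists B : R, forall x, enorm (b x) <= B;
  A_sigma_lipschitz : lipschitz_map sigma;
  A_sigma_invertible : forall x, sigma x \in unitmx;
  A_sigma_bounded : exists sigma_infty : R, forall x,
    enorm (sigma x) <= sigma_infty /\ enorm (invmx (sigma x)) <= sigma_infty;
  A_Lambda : exists Lambda : R, [/\ 0 <= Lambda,
    forall x y : 'cV[R]_n,
      enorm (y^T *m (sigma (x + y) - sigma x)) <= Lambda * enorm y &
    exists2 lambda0 : R, 0 < lambda0 &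
      2 * (lambda0 - lambda0 ^+ 2 * Lambda ^+ 2) >
        sup (range (fun x => opnorm (invmx (sigma x)))) ^+ 2] }.

Record hypothesis_P (psi : 'cV[R]_n -> 'rV[R]_n -> R) : Prop := {
  P_measurable : measurable_fun setT
    (fun p : g_sigma_algebraType (@open ('cV[R]_n * 'rV[R]_n)%type) =>
      psi p.1 p.2);
  P_continuous : forall z, continuous (psi ^~ z);
  P_bounds : exists M : R, forall x z z',
    `|psi x 0| <= M /\ `|psi x z - psi x z'| <= M * enorm (z - z') }.

End hypotheses.

(* Processes are indexed by all of [R]; only their values at times [t >= 0]
   are ever used. *)
Section processes.
Context {R : realType} {dO : measure_display} {Omega : measurableType dO}.
Variable P : probability Omega R.
Local Notation mu := (@lebesgue_measure R).

Definition continuous_paths {E : topologicalType} (X : R -> Omega -> E) : Prop :=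
  {ae P, forall w, {within `[0, +oo[, continuous (X ^~ w)}}.

Section brownian.
Variables (n : nat) (W : R -> Omega -> 'cV[R]_n).

(* [<<s past W t >>] is sigma(W_u, 0 <= u <= t). *)
Definition past (t : R) : set (set Omega) :=
  [set A | exists (u : R) i (B : set R), [/\ 0 <= u <= t, measurable B &
    A = (fun w => W u w i 0) @^-1` B]].

Definition increment_in (s t : R) (B : 'I_n -> set R) : set Omega :=
  [set w | forall i, B i ((W t w - W s w) i 0)].

(* The boxes [\prod_i B i] form a pi-system generating the Borel sets of R^n,
   so the last two fields say that W_t - W_s has law N(0, (t - s) Id) and is
   independent of sigma(W_u, u <= s).  The second parameter of [normal_prob]
   is the standard deviation. *)
Record brownian_motion : Prop := {
  bm_measurable : forall (t : R) i, 0 <= t ->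
    measurable_fun setT (fun w => W t w i 0);
  bm_start : {ae P, forall w, W 0 w = 0};
  bm_continuous : continuous_paths W;
  bm_gaussian : forall (s t : R) (B : 'I_n -> set R), 0 <= s < t ->
    (forall i, measurable (B i)) ->
    P (increment_in s t B) =
      (\prod_(i < n) normal_prob 0 (Num.sqrt (t - s)) (B i))%E;
  bm_independent : forall (s t : R) (B : 'I_n -> set R) (A : set Omega),
    0 <= s < t -> (forall i, measurable (B i)) -> <<s past s >> A ->
    P (A `&` increment_in s t B) = (P A * P (increment_in s t B))%E }.

(* The natural filtration augmented by the null sets is [<<s augmented_past t >>]. *)
Definition augmented_past (t : R) : set (set Omega) :=
  past t `|` P.-negligible.

(* The trace on [0, t] x Omega of B(R) (x) F_t is B([0, t]) (x) F_t. *)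
Definition progressive (X : R -> Omega -> R) : Prop :=
  forall t : R, 0 <= t -> measurable_fun
    [set p : R * g_sigma_algebraType (augmented_past t) | 0 <= p.1 <= t]
    (fun p => X p.1 p.2).

Definition progressive_mx k l (X : R -> Omega -> 'M[R]_(k, l)) : Prop :=
  forall i j, progressive (fun t w => X t w i j).

Definition M2 k l (Z : R -> Omega -> 'M[R]_(k, l)) : Prop :=
  progressive_mx Z /\ forall T : R, 0 < T ->
    (\int[P]_w \int[mu]_(s in `[0%R, T]) (enorm (Z s w) ^+ 2)%:E < +oo)%E.

Record simple_process (k : nat) := SimpleProcess {
  sp_size : nat;
  sp_time : nat -> R;
  sp_val : nat -> Omega -> 'M[R]_(k, n);
  sp_time_ge0 : 0 <= sp_time 0;
  sp_time_nondecreasing : {homo sp_time : i j / (i <= j)%N >-> i <= j};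
  sp_val_adapted : forall q i j, measurable_fun setT
    (fun w : g_sigma_algebraType (augmented_past (sp_time q)) =>
      sp_val q w i j);
  sp_val_bounded : exists C : R, forall q w, enorm (sp_val q w) <= C }.

Definition simple_eval k (S : simple_process k) (s : R) (w : Omega)
    : 'M[R]_(k, n) :=
  \sum_(q < sp_size S)
    (\1_(`]sp_time S q, sp_time S q.+1]) s : R) *: sp_val S q w.

Definition simple_integral k (S : simple_process k) (t : R) (w : Omega)
    : 'cV[R]_k :=
  \sum_(q < sp_size S) sp_val S q w *m
    (W (Num.min (sp_time S q.+1) t) w - W (Num.min (sp_time S q) t) w).

(* [J] is the process (\int_0^t H_s dW_s)_(t >= 0): the continuous version of
   the L^2 limit of the integrals of simple processes approximating [H]. *)
Definition ito_integral k (H : R -> Omega -> 'M[R]_(k, n))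
    (J : R -> Omega -> 'cV[R]_k) : Prop :=
  [/\ M2 H, progressive_mx J, continuous_paths J &
    exists S : nat -> simple_process k, forall T : R, 0 <= T ->
      ((fun m => \int[P]_w \int[mu]_(s in `[0%R, T])
          (enorm (simple_eval (S m) s w - H s w) ^+ 2)%:E)%E @ \oo --> 0%E) /\
      ((fun m => \int[P]_w
          (enorm (simple_integral (S m) T w - J T w) ^+ 2)%:E)%E
        @ \oo --> 0%E)].

Definition sde_solution (f : 'cV[R]_n -> 'cV[R]_n)
    (sigma : 'cV[R]_n -> 'M[R]_n) (x : 'cV[R]_n)
    (V : R -> Omega -> 'cV[R]_n) : Prop :=
  [/\ progressive_mx V, continuous_paths V &
    exists2 J, ito_integral (fun s w => sigma (V s w)) J &
      {ae P, forall w, forall t : R, 0 <= t ->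
        V t w = x + \col_i (\int[mu]_(s in `[0, t]) f (V s w) i 0) + J t w}].

Definition ebsde_solution (psi : 'cV[R]_n -> 'rV[R]_n -> R)
    (V : R -> Omega -> 'cV[R]_n) (Y : R -> Omega -> R)
    (Z : R -> Omega -> 'rV[R]_n) (lambda : R) : Prop :=
  [/\ progressive Y, continuous_paths Y, M2 Z &
    exists2 J, ito_integral Z J &
      {ae P, forall w, forall t T : R, 0 <= t <= T ->
        Y t w = Y T w
          + \int[mu]_(s in `[t, T]) (psi (V s w) (Z s w) - lambda)
          - (J T w 0 0 - J t w 0 0)}].

End brownian.
End processes.

(* Main.v *)
(* If lambda > lambda', put U = (Y - Y') - theta |V|^4 with theta > 0 small, and G = exp(a U)
   with a large.  The quadratic growth of Y - Y' makes G bounded, together with G |V|^8.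
   The difference Y - Y' drifts upwards at rate lambda - lambda' up to a driver term at most
   M |Z - Z'|, which the second order term a^2 |dU|^2 / 2 of the exponential absorbs; by
   dissipativity the penalty -theta |V|^4 only costs a small multiple of lambda - lambda'.
   Hence E G_T >= E G_0 + kappa int_0^T E G_s ds with kappa > 0: first E G_s >= E G_0 > 0 for
   all s, and then E G_T grows at least linearly in T, against boundedness.  No change of
   measure is used.  In place of Ito's formula, the growth inequality is obtained along
   partitions: G_T - G_0 is bounded below, path by path, by a martingale sum plus
   kappa sum_i G_(t_i) (t_(i+1) - t_i) minus an error that tends to 0 almost surely when the
   integrands are replaced by simple processes and the mesh tends to 0. *)

(* The obstacle is the driver: its contribution M |Z - Z'| is neither small nor signed, so the drift
   of Y - Y' alone has no sign. Only a term quadratic in |Z - Z'| can pay for it, whence the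
   exponential. The penalty must beat quadratic growth however small theta is, which rules out |V|^2
   and leads to |V|^4. Its gradient is kept in one square with Z - Z', through u = (Z - Z') - 4
   theta |V|^2 V^T sigma, so that the a^2 term stays favourable. Going back from u to Z - Z' costs a
   multiple of theta |V|^3, which the gain 4 eta theta |V|^4 from dissipativity dominates; the
   bounded part [b] of the drift also costs only theta |V|^3. The total cost of the penalty is
   therefore a theta C0 with C0 independent of a and theta, so theta is fixed first. The driver then
   leaves 4 M^2, free of a, against the gain a (lambda - lambda'). The bound on G |V|^8 replaces
   moment estimates on V: it controls the martingale coefficients G |V|^3 and the quadratic
   variation weights G |V|^6. *)
Require Import Defs.
From mathcomp Require Import all_boot all_order all_algebra.
From mathcomp Require Import all_classical all_reals all_analysis.
From mathcomp Require Import measurable_realfun ring lra.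
Import Order.TTheory GRing.Theory Num.Theory.
Import numFieldNormedType.Exports.
Local Open Scope classical_set_scope.
Local Open Scope ring_scope.

Set Implicit Arguments.
Unset Strict Implicit.
Unset Printing Implicit Defensive.

(** * Integrable and square-integrable random variables *)

Section expectation.
Context {R : realType} {d : measure_display} {T : measurableType d}.
Variable P : probability T R.
Implicit Types X Y : T -> R.

Definition L1 X : Prop := P.-integrable setT (EFin \o X).

Definition Ex X : R := \int[P]_w X w.

Definition L2 X : Prop := measurable_fun setT X /\ L1 (fun w => X w ^+ 2).

Lemma L1_measurable X : L1 X -> measurable_fun setT X.
Proof. by move=> /measurable_int /measurable_EFinP. Qed.

Lemma L1_le X Y : measurable_fun setT X -> (forall w, `|X w| <= Y w) ->
  L1 Y -> L1 X.
Proof.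
move=> mX XY; apply: le_integrable => //; first exact/measurable_EFinP.
by move=> w _ /=; rewrite lee_fin (le_trans (XY w))// ler_norm.
Qed.

Lemma L1_cst c : L1 (cst c).
Proof. exact: finite_measure_integrable_cst. Qed.

Lemma L1_bounded X (C : R) : measurable_fun setT X -> (forall w, `|X w| <= C) -> L1 X.
Proof. by move=> mX XC; apply: (L1_le mX XC); exact: L1_cst. Qed.

Lemma L1D X Y : L1 X -> L1 Y -> L1 (fun w => X w + Y w).
Proof. by move=> lX lY; exact: (integrableD measurableT lX lY). Qed.

Lemma L1Z c X : L1 X -> L1 (fun w => c * X w).
Proof. by move=> lX; exact: (integrableZl measurableT c lX). Qed.

Lemma L1B X Y : L1 X -> L1 Y -> L1 (fun w => X w - Y w).
Proof. by move=> lX lY; exact: (integrableB measurableT lX lY). Qed.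

Lemma L1_norm X : L1 X -> L1 (fun w => `|X w|).
Proof. exact: integrable_norm. Qed.

Lemma L1_sum I (s : seq I) (F : I -> T -> R) :
  (forall i, L1 (F i)) -> L1 (fun w => \sum_(i <- s) F i w).
Proof.
move=> lF; elim: s => [|i s IH].
  by under eq_fun do rewrite big_nil; exact: L1_cst.
by under eq_fun do rewrite big_cons; exact: L1D.
Qed.

Lemma ExD X Y : L1 X -> L1 Y -> Ex (fun w => X w + Y w) = Ex X + Ex Y.
Proof. by move=> lX lY; rewrite /Ex RintegralD. Qed.

Lemma ExB X Y : L1 X -> L1 Y -> Ex (fun w => X w - Y w) = Ex X - Ex Y.
Proof. by move=> lX lY; rewrite /Ex RintegralB. Qed.

Lemma ExZ c X : L1 X -> Ex (fun w => c * X w) = c * Ex X.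
Proof. by move=> lX; rewrite /Ex RintegralZl. Qed.

Lemma Ex_cst c : Ex (cst c) = c.
Proof.
rewrite /Ex Rintegral_cst// (_ : fine _ = 1) ?mulr1//.
exact: (congr1 fine (probability_setT P)).
Qed.

Lemma Ex_sum I (s : seq I) (F : I -> T -> R) : (forall i, L1 (F i)) ->
  Ex (fun w => \sum_(i <- s) F i w) = \sum_(i <- s) Ex (F i).
Proof.
move=> lF; elim: s => [|i s IH].
  by under eq_fun do rewrite big_nil; rewrite big_nil Ex_cst.
under eq_fun do rewrite big_cons.
by rewrite ExD// ?IH ?big_cons//; exact: L1_sum.
Qed.

Lemma Ex_le X Y : L1 X -> L1 Y -> (forall w, X w <= Y w) -> Ex X <= Ex Y.
Proof. by move=> lX lY XY; apply: le_Rintegral. Qed.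

Lemma Ex_ge0 X : (forall w, 0 <= X w) -> 0 <= Ex X.
Proof. by move=> X0; apply: Rintegral_ge0. Qed.

Lemma Ex_norm X : L1 X -> `|Ex X| <= Ex (fun w => `|X w|).
Proof. by move=> lX; apply: le_normr_Rintegral. Qed.

Lemma ExE X : L1 X -> (\int[P]_w (X w)%:E = (Ex X)%:E)%E.
Proof. by move=> lX; rewrite /Ex fineK//; exact: integrable_fin_num. Qed.

Lemma L1_lty X : measurable_fun setT X -> (forall w, 0 <= X w) ->
  (\int[P]_w (X w)%:E < +oo)%E -> L1 X.
Proof.
move=> mX X0 Xoo; apply/integrableP; split; first exact/measurable_EFinP.
by under eq_integral do rewrite /= ger0_norm//.
Qed.

Lemma Ex_gt0 X : L1 X -> (forall w, 0 < X w) -> 0 < Ex X.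
Proof.
move=> lX X0; rewrite lt_neqAle Ex_ge0 ?andbT; last by move=> w; exact: ltW.
apply/eqP => E0.
have /(ae_eq_integral_abs P measurableT (measurable_int _ lX)) :
    (\int[P]_w `|(EFin \o X) w| = 0)%E.
  under eq_integral do rewrite /= gtr0_norm//.
  by rewrite ExE// -E0.
rewrite /ae_eq => -[N [mN PN0 sub]].
have : P setT = 0%E.
  apply/eqP; rewrite eq_le measure_ge0 andbT -PN0 le_measure ?inE//.
  move=> w _; apply: sub => /= /(_ I) [] /eqP; rewrite gt_eqF//; exact: X0.
by rewrite probability_setT => /eqP; rewrite onee_eq0.
Qed.

Lemma L2_measurable X : L2 X -> measurable_fun setT X.
Proof. by case. Qed.

Lemma L2_sqr X : L2 X -> L1 (fun w => X w ^+ 2).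
Proof. by case. Qed.

Lemma L2_le X Y : measurable_fun setT X -> (forall w, `|X w| <= `|Y w|) ->
  L2 Y -> L2 X.
Proof.
move=> mX XY [mY lY]; split=> //; apply: L1_le lY.
  exact: measurable_funX.
by move=> w; rewrite normrX -[leRHS]real_normK ?num_real// lerXn2r// nnegrE.
Qed.

Lemma L2_cst c : L2 (cst c).
Proof. by split; [exact: measurable_cst|exact: (L1_cst (c ^+ 2))]. Qed.

Lemma L2D X Y : L2 X -> L2 Y -> L2 (fun w => X w + Y w).
Proof.
move=> [mX lX] [mY lY]; split; first exact: measurable_funD.
apply: (@L1_le _ (fun w => 2 * (X w ^+ 2) + 2 * (Y w ^+ 2))).
- by apply: measurable_funX; exact: measurable_funD.
- by move=> w; rewrite ger0_norm ?sqr_ge0//; have := sqr_ge0 (X w - Y w); lra.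
- by apply: L1D; exact: L1Z.
Qed.

Lemma L2Z c X : L2 X -> L2 (fun w => c * X w).
Proof.
move=> [mX lX]; split; first exact: measurable_funM.
under eq_fun do rewrite exprMn; exact: L1Z.
Qed.

Lemma L2B X Y : L2 X -> L2 Y -> L2 (fun w => X w - Y w).
Proof.
move=> lX lY; apply: L2D => //.
by under eq_fun do rewrite -mulN1r; exact: L2Z.
Qed.

Lemma L2_sum I (s : seq I) (F : I -> T -> R) :
  (forall i, L2 (F i)) -> L2 (fun w => \sum_(i <- s) F i w).
Proof.
move=> lF; elim: s => [|i s IH].
  by under eq_fun do rewrite big_nil; exact: L2_cst.
by under eq_fun do rewrite big_cons; exact: L2D.
Qed.

Lemma L2M X Y : L2 X -> L2 Y -> L1 (fun w => X w * Y w).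
Proof.
move=> [mX lX] [mY lY].
apply: (@L1_le _ (fun w => X w ^+ 2 + Y w ^+ 2)).
- exact: measurable_funM.
- move=> w; rewrite normrM -(real_normK (num_real (X w))).
  rewrite -(real_normK (num_real (Y w))).
  have := sqr_ge0 (`|X w| - `|Y w|); have := sqr_ge0 (`|X w| + `|Y w|); nra.
- exact: L1D.
Qed.

Lemma L2_L1 X : L2 X -> L1 X.
Proof.
move=> lX; rewrite (_ : X = fun w => X w * 1).
  by apply: L2M => //; exact: L2_cst.
by apply/funext => w; rewrite mulr1.
Qed.

Lemma L2_Mbounded (C : R) X Y : measurable_fun setT X -> (forall w, `|X w| <= C) ->
  L2 Y -> L2 (fun w => X w * Y w).
Proof.
move=> mX XC lY; apply: (@L2_le _ (fun w => C * Y w)).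
- by apply: measurable_funM => //; exact: L2_measurable lY.
- by move=> w; rewrite !normrM ler_wpM2r// (le_trans (XC w))// ler_norm.
- exact: L2Z.
Qed.

Lemma Ex_young X Y (e : R) : 0 < e -> L2 X -> L2 Y ->
  `|Ex (fun w => X w * Y w)| <=
  e * Ex (fun w => X w ^+ 2) + e^-1 * Ex (fun w => Y w ^+ 2).
Proof.
move=> e0 lX lY; apply: le_trans (Ex_norm (L2M lX lY)) _.
rewrite -!ExZ; [|exact: L2_sqr..].
rewrite -ExD; [|by apply: L1Z; exact: L2_sqr..].
apply: Ex_le; [exact/L1_norm/L2M| |].
  by apply: L1D; apply: L1Z; exact: L2_sqr.
move=> w; rewrite normrM -(real_normK (num_real (X w))).
rewrite -(real_normK (num_real (Y w))).
set x := `|X w|; set y := `|Y w|.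
have -> : e * x ^+ 2 + e^-1 * y ^+ 2 =
    x * y + e * ((x - e^-1 * y / 2) ^+ 2 + 3 / 4 * (e^-1 * y) ^+ 2).
  by field; rewrite gt_eqF.
rewrite lerDl; apply: mulr_ge0; first exact: ltW.
by apply: addr_ge0; [exact: sqr_ge0|apply: mulr_ge0; [lra|exact: sqr_ge0]].
Qed.

Lemma eq_Ex X Y : X =1 Y -> Ex X = Ex Y.
Proof. by move=> /funext ->. Qed.

Lemma Ex_sqr_sum_orthogonal (K : nat) (D : nat -> T -> R) :
  (forall i, L2 (D i)) ->
  (forall i j, (i < j < K)%N -> Ex (fun w => D i w * D j w) = 0) ->
  Ex (fun w => (\sum_(i < K) D i w) ^+ 2) = \sum_(i < K) Ex (fun w => D i w ^+ 2).
Proof.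
move=> lD; elim: K => [|K IH] oD.
  rewrite big_ord0 (@eq_Ex _ (cst 0)) ?Ex_cst// => w.
  by rewrite big_ord0 expr0n.
have lS : L2 (fun w => \sum_(i < K) D i w) by exact: L2_sum.
rewrite big_ord_recr/= -IH; last first.
  by move=> i j /andP[ij jK]; apply: oD; rewrite ij ltnW.
have -> : (fun w => (\sum_(i < K.+1) D i w) ^+ 2) =
    (fun w => ((\sum_(i < K) D i w) ^+ 2 + D K w ^+ 2) +
      2 * \sum_(i < K) D i w * D K w).
  by apply/funext => w; rewrite big_ord_recr/= -mulr_suml; ring.
have lP : L1 (fun w => \sum_(i < K) D i w * D K w).
  by apply: L1_sum => i; exact: L2M.
rewrite ExD; [|by apply: L1D; exact: L2_sqr|exact: L1Z].
rewrite ExD; [|exact: L2_sqr..].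
rewrite ExZ// Ex_sum; last by move=> i; exact: L2M.
rewrite big1 ?mulr0 ?addr0// => i _; apply: oD.
by rewrite ltn_ord ltnSn.
Qed.

End expectation.

(** * Gaussian moments *)

Section density.
Context {R : realType} {d : measure_display} {T : measurableType d}.
Variables (mu nu : {measure set T -> \bar R}) (g : T -> R).
Hypotheses (g0 : forall x, 0 <= g x) (mg : measurable_fun setT g).
Hypothesis nuE : forall A, measurable A -> nu A = (\int[mu]_(x in A) (g x)%:E)%E.

Import HBNNSimple.

(** Linearity over the level sets of a simple function reduces the claim to [nuE]. *)
Let density_nnsfun (f : {nnsfun T >-> R}) :
  (\int[nu]_x (f x)%:E = \int[mu]_x ((f x)%:E * (g x)%:E))%E.
Proof.
rewrite integralT_nnsfun sintegralE.
have -> : (fun x => (f x)%:E * (g x)%:E)%E = (fun x =>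
    \sum_(k \in range f) (k%:E * (\1_(f @^-1` [set k]) x)%:E * (g x)%:E))%E.
  apply/funext => x; rewrite [in LHS]fimfunE -fsumEFin//.
  by rewrite ge0_mule_fsuml//= => k; exact: nnfun_muleindic_ge0.
rewrite ge0_integral_fsum//=; last 2 first.
- move=> k; apply/measurable_EFinP; apply: measurable_funM => //.
  exact: measurable_funM.
- move=> k x _; apply: mule_ge0; last by rewrite lee_fin.
  exact: nnfun_muleindic_ge0.
apply: eq_fsbigr => k; rewrite inE => -[y _ <-{k}].
rewrite nuE// integral_mkcond.
rewrite -ge0_integralZl//; last 3 first.
- exact/(measurable_restrictT _ _).1/measurable_EFinP/measurable_funTS.
- by move=> x _; rewrite patchE; case: ifP => // _; rewrite lee_fin.
- by rewrite lee_fin.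
apply: eq_integral => x _; rewrite patchE indicE.
by case: ifP => _; rewrite ?mule0 ?mule1 ?mul0e.
Qed.

(** Increasing limits of simple functions: both integrals pass to the limit by monotone convergence
    because the density is nonnegative. *)
Lemma ge0_integral_density (f : T -> \bar R) :
  measurable_fun setT f -> (forall x, 0 <= f x)%E ->
  (\int[nu]_x f x = \int[mu]_x (f x * (g x)%:E))%E.
Proof.
move=> mf f0.
pose h := nnsfun_approx measurableT mf.
have hf x : (h n x)%:E @[n --> \oo] --> f x by exact: cvg_nnsfun_approx.
have ndh x : {homo (fun n => (h n x)%:E) : n m / (n <= m)%N >-> (n <= m)%E}.
  by move=> n m nm; rewrite lee_fin; exact/lefP/nd_nnsfun_approx.
have -> : (\int[nu]_x f x = \int[nu]_x limn (fun n => (h n x)%:E))%E.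
  by apply: eq_integral => x _; apply/esym/cvg_lim => //; exact: hf.
have -> : (\int[mu]_x (f x * (g x)%:E) =
    \int[mu]_x limn (fun n => (h n x)%:E * (g x)%:E))%E.
  apply: eq_integral => x _; apply/esym/cvg_lim => //.
  by apply: cvgeZr => //; exact: hf.
rewrite !monotone_convergence//.
- by congr (lim (_ @ \oo)); apply/funext => n; exact: density_nnsfun.
- by move=> n; apply/measurable_EFinP/measurable_funM.
- by move=> n x _; rewrite mule_ge0 ?lee_fin.
- by move=> x _ n m nm; rewrite lee_wpmul2r ?lee_fin//; exact: ndh.
- by move=> n; apply/measurable_EFinP.
- by move=> n x _; rewrite lee_fin.
Qed.

End density.

Section gaussian_moments.
Context {R : realType}.
Variable s : R.
Hypothesis s0 : 0 < s.
Let nu : probability (measurableTypeR R) R := normal_prob 0 s.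

Let normal_peakE (t : R) : 0 < t -> normal_peak t = t^-1 * normal_peak 1.
Proof.
move=> t0; rewrite /normal_peak expr1n mul1r -mulrnAr sqrtrM ?sqr_ge0//.
by rewrite sqrtr_sqr gtr0_norm// invfM.
Qed.

Let integral_normal (f : R -> R) : measurable_fun setT f -> (forall x, 0 <= f x) ->
  (\int[nu]_x (f x)%:E =
   \int[lebesgue_measure]_x (f x * normal_pdf 0 s x)%:E)%E.
Proof.
move=> mf f0.
rewrite (@ge0_integral_density _ _ _ lebesgue_measure nu (normal_pdf 0 s))//.
- by move=> x; exact: normal_pdf_ge0.
- exact: measurable_normal_pdf.
- exact/measurable_EFinP.
Qed.

Let L1_integral (f : R -> R) (c : R) : measurable_fun setT f ->
  (forall x, 0 <= f x) -> (\int[nu]_x (f x)%:E)%E = c%:E ->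
  L1 nu f /\ Ex nu f = c.
Proof.
move=> mf f0 fc; have lf : L1 nu f by apply: L1_lty => //; rewrite fc ltry.
by split => //; apply: EFin_inj; rewrite -ExE.
Qed.

(** Up to the factor t / s, [f] is the likelihood ratio of N(0, t^2) with respect to N(0, s^2), so
    its mean is the total mass of a density. The moments below are deduced from such ratios and from
    1 + x <= exp x, with no integration by parts. *)
Lemma normal_exp_sqr (t : R) : 0 < t ->
  let f x := expR (x ^+ 2 * ((s ^+ 2 *+ 2)^-1 - (t ^+ 2 *+ 2)^-1)) in
  L1 nu f /\ Ex nu f = t / s.
Proof.
move=> t0 f; have mf : measurable_fun setT f.
  by apply: measurableT_comp => //; apply: measurable_funM.
apply: L1_integral => //; first by move=> x; exact: expR_ge0.
rewrite integral_normal//; last by move=> x; exact: expR_ge0.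
transitivity (\int[lebesgue_measure]_x ((t / s)%:E * (normal_pdf 0 t x)%:E))%E.
  apply: eq_integral => x _; rewrite -EFinM; congr EFin.
  rewrite !normal_pdfE ?gt_eqF//= (normal_peakE s0) (normal_peakE t0).
  have fE : f x * normal_fun 0 s x = normal_fun 0 t x.
    by rewrite /f /normal_fun subr0 -expRD; congr expR; ring.
  by rewrite mulrCA fE; field; rewrite !gt_eqF.
rewrite ge0_integralZl//=.
- by rewrite integral_normal_pdf mule1.
- by apply/measurable_EFinP; exact: measurable_normal_pdf.
- by move=> x _; rewrite lee_fin normal_pdf_ge0.
- by rewrite lee_fin divr_ge0// ltW.
Qed.

(** Here [f] is the likelihood ratio of N(m, s^2) with respect to N(0, s^2). *)
Lemma normal_exp_shift (m : R) :
  let f x := expR ((2 * x * m - m ^+ 2) / (s ^+ 2 *+ 2)) in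
  L1 nu f /\ Ex nu f = 1.
Proof.
move=> f; have mf : measurable_fun setT f.
  apply: measurableT_comp => //; apply: measurable_funM => //.
  apply: measurable_funB => //; apply: measurable_funM => //.
apply: L1_integral => //; first by move=> x; exact: expR_ge0.
rewrite integral_normal//; last by move=> x; exact: expR_ge0.
transitivity (\int[lebesgue_measure]_x (normal_pdf m s x)%:E)%E.
  apply: eq_integral => x _; congr EFin.
  rewrite !normal_pdfE ?gt_eqF//= mulrCA /f /normal_fun -expRD.
  by congr (_ * expR _); field; rewrite gt_eqF.
exact: integral_normal_pdf.
Qed.

Lemma normal_moment4 : L1 nu (fun x => x ^+ 4) /\
  Ex nu (fun x => x ^+ 4) <= 57 * s ^+ 4.
Proof.
have t0 : 0 < 2 * s by rewrite mulr_gt0.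
have [lf Ef] := normal_exp_sqr t0.
set f := fun x => _ in lf Ef.
(* With t = 2 s the exponent is y = 3 x^2 / (8 s^2), and y^2 / 4 <= exp y gives x^4 = (64 / 9) s^4
   y^2 <= (256 / 9) s^4 f x. The mean of f being 2, the bound is 512 / 9 < 57. *)
have key x : x ^+ 4 <= 256 / 9 * s ^+ 4 * f x.
  rewrite /f; set y := (X in expR X).
  have ys : x ^+ 2 = y * (8 / 3 * s ^+ 2).
    by rewrite /y; field; rewrite gt_eqF.
  have y0 : 0 <= y.
    have : 0 <= y * (8 / 3 * s ^+ 2) by rewrite -ys sqr_ge0.
    by rewrite pmulr_lge0// mulr_gt0// exprn_gt0.
  have ey : y ^+ 2 / 4 <= expR y.
    rewrite [y in expR y](_ : _ = y / 2 + y / 2) ?expRD; last by lra.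
    have := expR_ge1Dx (y / 2); set e := expR _ => he; nra.
  have -> : x ^+ 4 = 256 / 9 * s ^+ 4 * (y ^+ 2 / 4).
    have -> : x ^+ 4 = (x ^+ 2) ^+ 2 by rewrite -exprM.
    by rewrite ys; field.
  by apply: ler_wpM2l ey; apply: mulr_ge0 => //; apply: exprn_ge0; exact: ltW.
have l4 : L1 nu (fun x => x ^+ 4).
  apply: (@L1_le _ _ _ nu _ (fun x => 256 / 9 * s ^+ 4 * f x)).
  - exact: measurable_funX.
  - by move=> x; rewrite ger0_norm ?key// exprn_even_ge0.
  - exact: L1Z.
split => //; apply: (le_trans (Ex_le l4 (L1Z _ lf) key)).
rewrite ExZ// Ef mulfK ?gt_eqF//.
have : 0 <= s ^+ 4 by rewrite exprn_ge0// ltW.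
lra.
Qed.

Lemma L2_normal : L2 nu id.
Proof.
split; first exact: measurable_id.
apply: (@L1_le _ _ _ nu _ (fun x => 1 + x ^+ 4)).
- exact: measurable_funX.
- move=> x; rewrite ger0_norm ?sqr_ge0//.
  have -> : x ^+ 4 = (x ^+ 2) ^+ 2 by rewrite -exprM.
  have := sqr_ge0 (x ^+ 2 - 1); have := sqr_ge0 (x ^+ 2); nra.
- by apply: L1D; [exact: L1_cst|exact: normal_moment4.1].
Qed.

(** Averaging 1 + x <= exp x in the shifted likelihood ratio gives m E <= m^2 / 2 for every m; m = E
    leaves only E = 0. *)
Lemma normal_mean : Ex nu id = 0.
Proof.
have l1 := L2_L1 L2_normal.
have key m : m * Ex nu id <= m ^+ 2 / 2.
  have [lf Ef] := normal_exp_shift m; set f := fun x => _ in lf Ef.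
  pose c := (s ^+ 2 *+ 2)^-1.
  have c0 : 0 < c by rewrite invr_gt0 mulrn_wgt0// exprn_gt0.
  have lg : L1 nu (fun x => (1 - m ^+ 2 * c) + 2 * m * c * x).
    by apply: L1D; [exact: L1_cst|exact: L1Z].
  have : Ex nu (fun x => (1 - m ^+ 2 * c) + 2 * m * c * x) <= Ex nu f.
    apply: Ex_le => // x; apply: le_trans (expR_ge1Dx _).
    by rewrite -/c le_eqVlt; apply/orP; left; apply/eqP; ring.
  rewrite Ef ExD ?ExZ//; [|exact: L1_cst|exact: L1Z].
  rewrite (_ : Ex _ _ = 1 - m ^+ 2 * c); last exact: Ex_cst.
  have -> : 2 * m * c * Ex nu id = c * (2 * (m * Ex nu id)) by ring.
  rewrite -subr_le0.
  have -> : 1 - m ^+ 2 * c + c * (2 * (m * Ex nu id)) - 1 =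
    c * (2 * (m * Ex nu id) - m ^+ 2) by ring.
  rewrite pmulr_rle0//; lra.
have := key (Ex nu id); nra.
Qed.

(** The inequality 1 + c E <= t / s is an equality at t = s, where c vanishes. Taking t slightly
    above s bounds E from above, and t slightly below s bounds it from below. *)
Lemma normal_variance : Ex nu (fun x => x ^+ 2) = s ^+ 2.
Proof.
have l2 := L2_sqr L2_normal; set E := Ex _ _.
have E0 : 0 <= E by apply: Ex_ge0 => x; exact: sqr_ge0.
have key t : 0 < t ->
    (E * (t + s) - 2 * s * t ^+ 2) * (t - s) <= 0.
  move=> t0; have [lf Ef] := normal_exp_sqr t0; set f := fun x => _ in lf Ef.
  pose c := (s ^+ 2 *+ 2)^-1 - (t ^+ 2 *+ 2)^-1.
  have : Ex nu (fun x => 1 + c * x ^+ 2) <= Ex nu f.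
    apply: Ex_le => //; first by apply: L1D; [exact: L1_cst|exact: L1Z].
    by move=> x; apply: le_trans (expR_ge1Dx _); rewrite mulrC.
  rewrite Ef ExD ?ExZ//; [|exact: L1_cst|exact: L1Z].
  rewrite (_ : Ex _ (fun=> 1) = 1) -/E; last exact: (Ex_cst nu 1).
  have -> : (E * (t + s) - 2 * s * t ^+ 2) * (t - s) =
    (1 + c * E - t / s) * (2 * s ^+ 2 * t ^+ 2).
    by rewrite /c; field; rewrite !gt_eqF.
  move=> h; rewrite pmulr_lle0 ?subr_le0//.
  by rewrite !mulr_gt0// exprn_gt0.
have up e : 0 < e -> e < s -> E <= (s + e) ^+ 2.
  move=> e0 es; have := key (s + e) (addr_gt0 s0 e0).
  rewrite [s + e - s](_ : _ = e) ?pmulr_lle0//; last by ring.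
  move=> h; have : E * (2 * s) <= (s + e) ^+ 2 * (2 * s) by nra.
  by rewrite ler_pM2r// mulr_gt0.
have lo e : 0 < e -> e < s -> (s - e) ^+ 2 <= E.
  move=> e0 es; have := key (s - e); rewrite subr_gt0 => /(_ es).
  rewrite [s - e - s](_ : _ = - e) ?mulrN ?oppr_le0 ?pmulr_lge0//; last by ring.
  move=> h; have : (s - e) ^+ 2 * (2 * s) <= E * (2 * s) by nra.
  by rewrite ler_pM2r// mulr_gt0.
apply/eqP; rewrite eq_le; apply/andP; split; apply/ler_addgt0Pr => e e0.
  (* (s + e')^2 exceeds s^2 by e' (2 s + e') <= 3 s e' <= e. *)
  pose e' := Num.min (s / 2) (e / (3 * s)).
  have e'0 : 0 < e' by rewrite lt_min !divr_gt0// mulr_gt0.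
  have e's : e' <= s / 2 by rewrite ge_min lexx.
  have e'e : e' * (3 * s) <= e.
    by rewrite -ler_pdivlMr ?mulr_gt0// ge_min lexx orbT.
  apply: (le_trans (up e' e'0 _)); nra.
pose e' := Num.min (s / 2) (e / (3 * s)).
have e'0 : 0 < e' by rewrite lt_min !divr_gt0// mulr_gt0.
have e's : e' <= s / 2 by rewrite ge_min lexx.
have e'e : e' * (3 * s) <= e.
  by rewrite -ler_pdivlMr ?mulr_gt0// ge_min lexx orbT.
have := lo e' e'0; nra.
Qed.

End gaussian_moments.

(** * Independence and the Brownian filtration *)

Section independence.
Context {R : realType} {d : measure_display} {T : measurableType d}.
Variable P : probability T R.

Let probability_setD (B C : set T) : measurable B -> measurable C -> C `<=` B ->
  P (B `\` C) = (P B - P C)%E.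
Proof.
move=> mB mC CB; rewrite -[in RHS](setIidr CB); apply: measureD => //.
by rewrite -ge0_fin_numE ?fin_num_measure.
Qed.

(** The class to which Dynkin's pi-lambda theorem is applied in [indep_generated]: differences come
    from additivity, increasing unions from continuity from below. *)
Lemma lambda_system_indep (A : set T) : measurable A ->
  lambda_system setT [set E | measurable E /\ P (A `&` E) = (P A * P E)%E].
Proof.
move=> mA; split=> //.
- by split => //; rewrite setIT probability_setT mule1.
- move=> E F EF [mE PE] [mF PF]; split; first exact: measurableD.
  have -> : A `&` (E `\` F) = (A `&` E) `\` (A `&` F).
    apply/seteqP; split => [w [Aw [Ew nF]]|w [[Aw Ew] nAF]]; split => //.
      by case.
    by split => // Fw; apply: nAF.
  rewrite (probability_setD _ _ (@setIS _ A _ _ EF)); [|by apply: measurableI|by apply: measurableI].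
  rewrite (probability_setD mE mF EF) PE PF muleBr ?fin_num_measure//.
  by rewrite fin_num_adde_defr// fin_num_measure.
- move=> F ndF FE; have mF n : measurable (F n) by have [] := FE n.
  split; first exact: bigcupT_measurable.
  have mAF : measurable (\bigcup_n (A `&` F n)).
    by apply: bigcupT_measurable => n; exact: measurableI.
  have h1 : P (A `&` F n) @[n --> \oo] --> P (A `&` \bigcup_n F n).
    rewrite setI_bigcupr; apply: nondecreasing_cvg_mu => //.
      by move=> n; exact: measurableI.
    by move=> n m nm; apply/subsetPset; apply: setIS; apply/subsetPset/ndF.
  have h2 : (P A * P (F n))%E @[n --> \oo] --> (P A * P (\bigcup_n F n))%E.
    apply: cvgeZl; first by rewrite fin_num_measure.
    by apply: nondecreasing_cvg_mu => //; exact: bigcupT_measurable.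
  have e : (fun n => P (A `&` F n)) = (fun n => P A * P (F n))%E.
    by apply/funext => n; exact: (FE n).2.
  rewrite e in h1; apply: (cvg_unique _ h1 h2); exact: ereal_hausdorff.
Qed.

Lemma indep_generated (A : set T) (G : set (set T)) : measurable A ->
  setI_closed G ->
  (forall E, G E -> measurable E /\ P (A `&` E) = (P A * P E)%E) ->
  forall E, <<s G >> E -> measurable E /\ P (A `&` E) = (P A * P E)%E.
Proof.
move=> mA GI GE E sE.
exact: (lambda_system_subset GI (lambda_system_indep mA) GE) sE.
Qed.

Lemma Ex_pushforward (nu : probability (measurableTypeR R) R) (X : T -> R)
    (f : R -> R) :
  measurable_fun setT X -> measurable_fun setT f -> L1 nu f ->
  (forall B, measurable B -> P (X @^-1` B) = nu B) ->
  L1 P (fun w => f (X w)) /\ Ex P (fun w => f (X w)) = Ex nu f.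
Proof.
move=> mX mf lf nuE; have mX' : @measurable_fun _ _ T (measurableTypeR R) setT X by exact: mX.
pose X' : {mfun T >-> measurableTypeR R} :=
  @mfun_Sub _ _ T (measurableTypeR R) X (mem_set mX').
have l1 : L1 P (fun w => f (X w)).
  apply/integrableP; split; first exact/measurable_EFinP/measurableT_comp.
  have /integrableP[_] := lf; apply: le_lt_trans.
  rewrite [leRHS](eq_measure_integral (pushforward P X')); last first.
    by move=> B mB _; exact/esym/nuE.
  rewrite ge0_integral_pushforward//.
  by apply: measurableT_comp => //; exact/measurable_EFinP.
split=> //; rewrite /Ex /Rintegral; congr fine.
rewrite [RHS](eq_measure_integral (pushforward P X')); last first.
  by move=> B mB _; exact/esym/nuE.
rewrite integral_pushforward//.
exact/measurable_EFinP.
Qed.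

(** Independence on rectangles identifies the joint law with the product of the marginal laws, and
    Fubini then factors the mean of the product. *)
Lemma Ex_indep (X Y : T -> R) : L2 P X -> L2 P Y ->
  (forall A B, measurable A -> measurable B ->
     P (X @^-1` A `&` Y @^-1` B) = (P (X @^-1` A) * P (Y @^-1` B))%E) ->
  Ex P (fun w => X w * Y w) = Ex P X * Ex P Y.
Proof.
move=> lX lY XYindep; have mX := L2_measurable lX; have mY := L2_measurable lY.
pose X' : {RV P >-> R} := mfun_Sub (mem_set mX).
pose Y' : {RV P >-> R} := mfun_Sub (mem_set mY).
have mXY : measurable_fun setT (fun w => (X w, Y w)).
  exact: measurable_fun_pair.
pose XY : {RV P >-> (R * R)%type} := mfun_Sub (mem_set mXY).
have law A : measurable A ->
    (distribution P X' \x distribution P Y')%E A = distribution P XY A.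
  apply: product_measure_unique => B C mB mC; exact: XYindep.
have lXY : P.-integrable setT (EFin \o (fun z : R * R => z.1 * z.2) \o XY).
  exact: L2M.
have mm : measurable_fun setT (fun z : R * R => z.1 * z.2).
  exact: measurable_funM.
apply: EFin_inj; rewrite -ExE; last exact: L2M.
transitivity (\int[distribution P XY]_z (z.1 * z.2)%:E)%E.
  by rewrite integral_distribution//; exact/measurable_EFinP.
rewrite (eq_measure_integral (distribution P X' \x distribution P Y')%E); last first.
  by move=> A mA _; exact/esym/law.
rewrite -integral12_prod_meas1; last first.
  apply/integrableP; split; first exact/measurable_EFinP.
  rewrite (eq_measure_integral (distribution P XY)); last first.
    by move=> A mA _; exact: law.
  rewrite ge0_integral_distribution//; last first.
    by apply: measurableT_comp => //; exact/measurable_EFinP.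
  by have /integrableP[] := lXY.
have lX1 := L2_L1 lX; have lY1 := L2_L1 lY.
have fE x : fubini_F (distribution P Y') (fun z : R * R => (z.1 * z.2)%:E) x =
    (x * Ex P Y)%:E.
  rewrite /fubini_F /= -[LHS]/(\int[distribution P Y']_y (x * y)%:E)%E.
  rewrite integral_distribution//.
  - by rewrite [LHS](ExE (X := fun w => x * Y w)) ?ExZ//; exact: L1Z.
  - by apply/measurable_EFinP; exact: measurable_funM.
  - exact: L1Z.
under eq_integral do rewrite fE.
rewrite integral_distribution//.
- rewrite [LHS](ExE (X := fun w => X w * Ex P Y)).
    by under eq_Ex do rewrite mulrC; rewrite ExZ// mulrC.
  by under eq_fun do rewrite mulrC; exact: L1Z.
- by apply/measurable_EFinP; exact: measurable_funM.
- by rewrite /comp/=; under eq_fun do rewrite mulrC; exact: L1Z.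
Qed.
End independence.

Section brownian_filtration.
Context {R : realType} {dO : measure_display} {Omega : measurableType dO}.
Variable P : probability Omega R.
Hypothesis P_complete : measure_is_complete P.
Context {n : nat}.
Variable W : R -> Omega -> 'cV[R]_n.
Hypothesis W_bm : brownian_motion P W.

Definition adapted (t : R) (X : Omega -> R) : Prop :=
  measurable_fun [set: g_sigma_algebraType (augmented_past P W t)]
    (X : g_sigma_algebraType (augmented_past P W t) -> R).

(** Completeness of P makes the null sets that augment the filtration measurable. *)
Lemma augmented_past_measurable (t : R) :
  <<s augmented_past P W t >> `<=` measurable.
Proof.
apply: smallest_sub; first exact: sigma_algebra_measurable.
move=> A [[u [i [B [/andP[u0 _] mB ->]]]]|/P_complete//].
by rewrite -[X in measurable X]setTI; exact: (bm_measurable W_bm).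
Qed.

Lemma adapted_measurable (t : R) X : adapted t X -> measurable_fun setT X.
Proof.
move=> aX _ B mB; apply: (@augmented_past_measurable t).
exact: (aX measurableT B mB).
Qed.

Lemma augmented_past_le (s t : R) : s <= t ->
  <<s augmented_past P W s >> `<=` <<s augmented_past P W t >>.
Proof.
move=> st; apply: sub_sigma_algebra2 => A [[u [i [B [us mB ->]]]]|NA]; last by right.
left; exists u, i, B; split => //; have /andP[-> us'] := us.
exact: le_trans st.
Qed.

Lemma adapted_le (s t : R) X : s <= t -> adapted s X -> adapted t X.
Proof.
move=> st aX _ B mB; apply: (augmented_past_le st).
exact: (aX measurableT B mB).
Qed.

Lemma adapted_brownian (u t : R) i : 0 <= u <= t ->
  adapted t (fun w => W u w i 0).
Proof.
move=> ut _ B mB; rewrite setTI; apply: sub_gen_smallest; left.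
by exists u, i, B.
Qed.

Lemma progressive_adapted (X : R -> Omega -> R) (t : R) :
  progressive P W X -> 0 <= t -> adapted t (X t).
Proof.
move=> pX t0; have := pX t t0 => mX.
have mp : measurable_fun [set: g_sigma_algebraType (augmented_past P W t)]
    (fun w : g_sigma_algebraType (augmented_past P W t) => (t, w)).
  exact: pair1_measurable.
move=> _ B mB; rewrite setTI.
have mD : measurable [set p : R * g_sigma_algebraType (augmented_past P W t) |
    0 <= p.1 <= t].
  rewrite (_ : [set _ | _] = fst @^-1` `[0, t]%classic); last first.
    by apply/seteqP; split => p /=; rewrite in_itv.
  by rewrite -[X in measurable X]setTI; exact: measurable_fst.
have := mp measurableT _ (mX mD B mB); rewrite setTI.
congr measurable; apply/seteqP; split => w //=.
  by case.
by split => //=; rewrite t0 lexx.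
Qed.

Let eq_prob_negligible (A A' N : set Omega) : measurable A -> measurable A' ->
  P.-negligible N -> (forall w, ~ N w -> A w <-> A' w) -> P A = P A'.
Proof.
move=> mA mA' [N' [mN' PN' NN']] AA'.
suff le B B' : measurable B -> measurable B' ->
    (forall w, ~ N w -> B w <-> B' w) -> (P B <= P B')%E.
  apply/eqP; rewrite eq_le !le// => w Nw; split; exact: (AA' w Nw).2 || exact: (AA' w Nw).1.
move=> mB mB' BB'.
have : (P B <= P (B' `|` N'))%E.
  apply: le_measure; rewrite ?inE//; first exact: measurableU.
  move=> w Bw; have [Nw|nN] := pselect (N w); first by right; exact: NN'.
  by left; apply/BB'.
move=> /le_trans; apply; apply: (le_trans (measureU2 _ mB' mN')).
by rewrite [X in (_ + X)%E]PN' adde0.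
Qed.

(** The increments of W are assumed independent of the raw past only; discarding a null set carries
    this over to the augmented filtration, to which the integrands are adapted. *)
Lemma augmented_past_modification (t : R) (A : set Omega) :
  <<s augmented_past P W t >> A -> exists2 A', <<s past W t >> A' &
    exists2 N, P.-negligible N & forall w, ~ N w -> A w <-> A' w.
Proof.
move: A; apply: smallest_sub; last first.
  move=> A [pA|NA].
    exists A; first exact: sub_gen_smallest.
    by exists set0 => //; exact: negligible_set0.
  exists set0; first exact: sigma_algebra0.
  by exists A.
split.
- exists set0; first exact: sigma_algebra0.
  by exists set0 => //; exact: negligible_set0.
- move=> A [A' sA' [N nN AA']]; exists (~` A').
    by rewrite -setTD; apply: sigma_algebraCD.
  exists N => // w /AA' [h1 h2]; rewrite setTD; split=> nA.
    by move=> /h2.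
  by move=> /h1.
- move=> F HF.
  have /choice[A' hA'] : forall k, exists A', <<s past W t >> A' /\
      exists2 N, P.-negligible N & forall w, ~ N w -> F k w <-> A' w.
    by move=> k; have [A' ? ?] := HF k; exists A'.
  have /choice[N hN] : forall k, exists N, P.-negligible N /\
      forall w, ~ N w -> F k w <-> A' k w.
    by move=> k; have [_ [N ? ?]] := hA' k; exists N.
  exists (\bigcup_k A' k).
    by apply: sigma_algebra_bigcup => k; exact: (hA' k).1.
  exists (\bigcup_k N k).
    by apply: negligible_bigcup => k; exact: (hN k).1.
  move=> w nNw; split => -[k _ Fk]; exists k => //.
    by apply/(hN k).2 => // Nk; apply: nNw; exists k.
  by apply/(hN k).2 => // Nk; apply: nNw; exists k.
Qed.

(** A pi-system of boxes, and exactly the events about which [brownian_motion] makes assumptions. *)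
Definition increment_system (s t : R) : set (set Omega) :=
  [set E | exists2 B : 'I_n -> set R, (forall i, measurable (B i)) &
    E = increment_in W s t B].

Definition increment_measurable (s t : R) (X : Omega -> R) : Prop :=
  measurable_fun [set: g_sigma_algebraType (increment_system s t)]
    (X : g_sigma_algebraType (increment_system s t) -> R).

Lemma measurable_increment (s t : R) i : 0 <= s <= t ->
  measurable_fun setT (fun w => (W t w - W s w) i 0).
Proof.
move=> /andP[s0 st]; under eq_fun do rewrite !mxE.
by apply: measurable_funB; apply: (bm_measurable W_bm) => //; exact: le_trans st.
Qed.

Lemma increment_in_measurable (s t : R) (B : 'I_n -> set R) : 0 <= s <= t ->
  (forall i, measurable (B i)) -> measurable (increment_in W s t B).
Proof.
move=> st mB; rewrite (_ : increment_in _ _ _ _ =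
  \bigcap_(i in setT) ((fun w => (W t w - W s w) i 0) @^-1` B i)).
  apply: fin_bigcap_measurable => // i _; rewrite -[X in measurable X]setTI.
  exact: measurable_increment.
by apply/seteqP; split => w /= h i; [move=> _|]; exact: h.
Qed.

Lemma increment_component (s t : R) i :
  increment_measurable s t (fun w => (W t w - W s w) i 0).
Proof.
move=> _ B mB; rewrite setTI; apply: sub_gen_smallest.
exists (fun j => if j == i then B else setT); first by move=> j; case: ifP.
apply/seteqP; split => w /=.
  by move=> Bw j; case: eqP => // ->.
by move=> /(_ i); rewrite eqxx.
Qed.

Lemma increment_indep (s t : R) (A E : set Omega) : 0 <= s < t ->
  <<s augmented_past P W s >> A -> <<s increment_system s t >> E ->
  measurable E /\ P (A `&` E) = (P A * P E)%E.
Proof.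
move=> st sA; have [/andP[s0 lst]] := st; have st' : 0 <= s <= t by rewrite s0 ltW.
have mA := augmented_past_measurable sA.
move: E; apply: indep_generated => //.
  move=> _ _ [B mB ->] [C mC ->]; exists (fun i => B i `&` C i).
    by move=> i; exact: measurableI.
  apply/seteqP; split => w /=; first by move=> [hB hC] i; split.
  by move=> h; split => i; have [] := h i.
move=> _ [B mB ->]; have mI := increment_in_measurable st' mB; split => //.
have [A' sA' [N nN AA']] := augmented_past_modification sA.
have mA' : measurable A'.
  apply: (@augmented_past_measurable s).
  by apply: sub_sigma_algebra2 sA' => X ?; left.
rewrite (eq_prob_negligible mA mA' nN AA') -(bm_independent W_bm st mB sA').
apply: eq_prob_negligible nN _; [exact: measurableI..|].
by move=> w /AA' [h1 h2]; split => -[? ?]; split => //; [exact: h1|exact: h2].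
Qed.

End brownian_filtration.

(** * Moments of Brownian increments *)

Section brownian_moments.
Context {R : realType} {dO : measure_display} {Omega : measurableType dO}.
Variable P : probability Omega R.
Hypothesis P_complete : measure_is_complete P.
Context {n : nat}.
Variable W : R -> Omega -> 'cV[R]_n.
Hypothesis W_bm : brownian_motion P W.
Local Notation adapted := (adapted P W).

Definition dW (s t : R) (i : 'I_n) (w : Omega) : R := (W t w - W s w) i 0.

Lemma dW_eq0 (s : R) i w : dW s s i w = 0.
Proof. by rewrite /dW subrr mxE. Qed.

Section increment.
Variables (s t : R).
Hypothesis st : 0 <= s < t.
Let st' : 0 <= s <= t. Proof. by have /andP[-> /ltW] := st. Qed.
Let r := Num.sqrt (t - s).
Let r0 : 0 < r. Proof. by rewrite sqrtr_gt0 subr_gt0; have /andP[] := st. Qed.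
Let r2 : r ^+ 2 = t - s.
Proof. by rewrite sqr_sqrtr// subr_ge0; have /andP[_ /ltW] := st. Qed.
Let nu : probability (measurableTypeR R) R := normal_prob 0 r.

Let mdW i : measurable_fun setT (dW s t i).
Proof. exact: (measurable_increment W_bm). Qed.

Let law i (B : set R) : measurable B -> P (dW s t i @^-1` B) = nu B.
Proof.
move=> mB; pose Bs j := if j == i then B else setT.
have -> : dW s t i @^-1` B = increment_in W s t Bs.
  apply/seteqP; split => w /=; rewrite /Bs.
    by move=> Bw j; case: eqP => // ->.
  by move=> /(_ i); rewrite eqxx.
rewrite (bm_gaussian W_bm)//; last by move=> j; rewrite /Bs; case: ifP.
rewrite (bigD1 i)//= /Bs eqxx big1 ?mule1// => j /negbTE ->.
exact: (probability_setT nu).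
Qed.

Let law_integral i (f : R -> R) : measurable_fun setT f -> L1 nu f ->
  L1 P (fun w => f (dW s t i w)) /\ Ex P (fun w => f (dW s t i w)) = Ex nu f.
Proof.
move=> mf lf; apply: Ex_pushforward => // B mB; exact: law.
Qed.

Let L2_dW_lt i : L2 P (dW s t i).
Proof.
split; first exact: mdW.
have mf : measurable_fun setT (fun x : R => x ^+ 2) by exact: measurable_funX.
exact: (law_integral i mf (L2_sqr (L2_normal r0))).1.
Qed.

Let Ex_dW i : Ex P (dW s t i) = 0.
Proof.
have := (law_integral i (@measurable_id _ _ setT) (L2_L1 (L2_normal r0))).2.
by rewrite normal_mean.
Qed.

Let Ex_dW2 i : Ex P (fun w => dW s t i w ^+ 2) = t - s.
Proof.
have mf : measurable_fun setT (fun x : R => x ^+ 2) by exact: measurable_funX.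
by rewrite (law_integral i mf (L2_sqr (L2_normal r0))).2 normal_variance// r2.
Qed.

Let L1_dW4 i : L1 P (fun w => dW s t i w ^+ 4) /\
  Ex P (fun w => dW s t i w ^+ 4) <= 57 * (t - s) ^+ 2.
Proof.
have mf : measurable_fun setT (fun x : R => x ^+ 4) by exact: measurable_funX.
have [l4 E4] := normal_moment4 r0; have [l4' E4'] := law_integral i mf l4.
by split => //; rewrite E4' -r2 -exprM.
Qed.

Let Ex_dWdW i j : Ex P (fun w => dW s t i w * dW s t j w) = (i == j)%:R * (t - s).
Proof.
have [<-|ij] := eqVneq i j.
  by rewrite mul1r -(Ex_dW2 i); apply: eq_Ex => w; rewrite expr2.
rewrite mul0r Ex_indep ?Ex_dW ?mul0r// => A B mA mB.
pose Bs k := if k == i then A else if k == j then B else setT.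
have -> : dW s t i @^-1` A `&` dW s t j @^-1` B = increment_in W s t Bs.
  apply/seteqP; split => w /=; rewrite /Bs.
    by move=> [Aw Bw] k; case: eqP => [->//|_]; case: eqP => // ->.
  by move=> h; split; [have := h i|have := h j]; rewrite ?eqxx// eq_sym (negbTE ij).
rewrite (bm_gaussian W_bm)//; last by move=> k; rewrite /Bs; do 2 case: ifP => // _.
rewrite !law// (bigD1 i)//= (bigD1 j)/=; last by rewrite eq_sym.
rewrite big1 ?mule1; first by rewrite /Bs eqxx eq_sym (negbTE ij) eqxx.
move=> k /andP[/negbTE ki /negbTE kj]; rewrite /Bs ki kj.
exact: (probability_setT nu).
Qed.

Let L2_phi_lt i j (c := (i == j)%:R * (t - s)) :
  L2 P (fun w => dW s t i w * dW s t j w - c) /\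
  Ex P (fun w => (dW s t i w * dW s t j w - c) ^+ 2) <= 116 * (t - s) ^+ 2.
Proof.
have [li Ei] := L1_dW4 i; have [lj Ej] := L1_dW4 j.
have mphi : measurable_fun setT (fun w => dW s t i w * dW s t j w - c).
  by apply: measurable_funB => //; exact: measurable_funM.
have c2 : c ^+ 2 <= (t - s) ^+ 2.
  by rewrite /c; case: eqP => _; rewrite ?mul1r// mul0r expr0n/= sqr_ge0.
pose Y w := (dW s t i w ^+ 4 + dW s t j w ^+ 4) + 2 * (t - s) ^+ 2.
have lY : L1 P Y by apply: L1D; [exact: L1D|exact: L1_cst].
(* (x y - c)^2 <= 2 x^2 y^2 + 2 c^2 <= x^4 + y^4 + 2 (t - s)^2; two fourth moments of at most 57 (t
   - s)^2 then give 116 = 57 + 57 + 2. *)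
have phiY w : (dW s t i w * dW s t j w - c) ^+ 2 <= Y w.
  rewrite /Y; set x := dW s t i w; set y := dW s t j w.
  have -> : x ^+ 4 = (x ^+ 2) ^+ 2 by rewrite -exprM.
  have -> : y ^+ 4 = (y ^+ 2) ^+ 2 by rewrite -exprM.
  have := sqr_ge0 (x * y + c); have := sqr_ge0 (x ^+ 2 - y ^+ 2); nra.
have l2 : L1 P (fun w => (dW s t i w * dW s t j w - c) ^+ 2).
  apply: (L1_le _ _ lY); first exact: measurable_funX.
  by move=> w; rewrite ger0_norm ?sqr_ge0.
split=> //; apply: (le_trans (Ex_le l2 lY phiY)).
rewrite /Y ExD ?ExD//; [|exact: L1D|exact: L1_cst].
rewrite (Ex_cst P (2 * (t - s) ^+ 2) : Ex P (fun=> _) = _).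
lra.
Qed.

Let Ex_adapted_indep (c Y : Omega -> R) : adapted s c -> L2 P c ->
  increment_measurable W s t Y -> L2 P Y ->
  Ex P (fun w => c w * Y w) = Ex P c * Ex P Y.
Proof.
move=> ac lc mY lY; apply: Ex_indep => // A B mA mB.
have [] := @increment_indep _ _ _ _ P_complete _ _ W_bm s t (c @^-1` A) (Y @^-1` B) st.
- by have := ac measurableT A mA; rewrite setTI.
- by have := mY measurableT B mB; rewrite setTI.
- by [].
Qed.

Lemma increment_moments i j (c : Omega -> R) (d := (i == j)%:R * (t - s)) :
  [/\ L2 P (dW s t i), Ex P (fun w => dW s t i w ^+ 2) = t - s,
    L2 P (fun w => dW s t i w * dW s t j w - d),
    Ex P (fun w => (dW s t i w * dW s t j w - d) ^+ 2) <= 116 * (t - s) ^+ 2 &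
  adapted s c -> L2 P c -> Ex P (fun w => c w * dW s t i w) = 0 /\
    Ex P (fun w => c w * (dW s t i w * dW s t j w - d)) = 0].
Proof.
have [l2 E2] := L2_phi_lt i j; split => // ac lc; split.
  by rewrite Ex_adapted_indep// ?Ex_dW ?mulr0//; exact: increment_component.
rewrite Ex_adapted_indep//; last first.
  apply: measurable_funB => //; apply: measurable_funM.
    exact: increment_component.
  exact: increment_component.
rewrite ExB; [|exact: L2M|exact: L1_cst].
by rewrite Ex_dWdW (Ex_cst P d : Ex P (fun=> _) = _) subrr mulr0.
Qed.
End increment.

(** The case s = t is separate: the Gaussian law is assumed for s < t only, while partitions may
    repeat a point. *)
Lemma L2_dW (s t : R) i : 0 <= s <= t -> L2 P (dW s t i).
Proof.
move=> /andP[s0]; rewrite le_eqVlt => /predU1P[<-|st].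
  have -> : dW s s i = cst 0 by apply/funext => w; exact: dW_eq0.
  exact: L2_cst.
have h : 0 <= s < t by rewrite s0.
by have [] := increment_moments h i i (cst 0).
Qed.

Lemma Ex_adapted_dW (s t : R) i c : 0 <= s <= t -> adapted s c -> L2 P c ->
  Ex P (fun w => c w * dW s t i w) = 0.
Proof.
move=> /andP[s0]; rewrite le_eqVlt => /predU1P[<-|st] ac lc.
  rewrite (@eq_Ex _ _ _ _ _ (cst 0)) ?Ex_cst// => w; by rewrite dW_eq0 mulr0.
have h : 0 <= s < t by rewrite s0.
by have [_ _ _ _ /(_ ac lc)[]] := increment_moments h i i c.
Qed.

(** Compensated product of two components: orthogonal to the past at time s, with second moment of
    order (t - s)^2. Weighted sums of it are the errors in the quadratic variation. *)
Definition qvar (s t : R) (i j : 'I_n) (w : Omega) : R :=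
  dW s t i w * dW s t j w - (i == j)%:R * (t - s).

Lemma L2_qvar (s t : R) i j : 0 <= s <= t -> L2 P (qvar s t i j) /\
  Ex P (fun w => qvar s t i j w ^+ 2) <= 116 * (t - s) ^+ 2.
Proof.
move=> /andP[s0]; rewrite le_eqVlt => /predU1P[<-|st].
  rewrite (_ : qvar s s i j = cst 0); last first.
    by apply/funext => w; rewrite /qvar dW_eq0 subrr mulr0 mul0r subr0.
  split; first exact: L2_cst.
  by rewrite (@eq_Ex _ _ _ _ _ (cst 0)) ?Ex_cst ?subrr ?expr0n/= ?mulr0// => w; rewrite expr0n.
have h : 0 <= s < t by rewrite s0.
by have [] := increment_moments h i j (cst 0).
Qed.

Lemma Ex_adapted_qvar (s t : R) i j c : 0 <= s <= t -> adapted s c -> L2 P c ->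
  Ex P (fun w => c w * qvar s t i j w) = 0.
Proof.
move=> /andP[s0]; rewrite le_eqVlt => /predU1P[<-|st] ac lc.
  rewrite (@eq_Ex _ _ _ _ _ (cst 0)) ?Ex_cst// => w.
  by rewrite /qvar dW_eq0 subrr mulr0 mul0r subr0 mulr0.
have h : 0 <= s < t by rewrite s0.
by have [_ _ _ _ /(_ ac lc)[]] := increment_moments h i j c.
Qed.

Lemma adapted_dW (s t u : R) i : 0 <= s <= t -> t <= u -> adapted u (dW s t i).
Proof.
move=> /andP[s0 st] tu; rewrite /dW; under eq_fun do rewrite !mxE.
apply: measurable_funB; apply: adapted_brownian.
  by rewrite (le_trans s0 st).
by rewrite s0 (le_trans st tu).
Qed.

Lemma adapted_qvar (s t u : R) i j : 0 <= s <= t -> t <= u ->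
  adapted u (qvar s t i j).
Proof.
move=> st tu; apply: measurable_funB; last exact: measurable_cst.
by apply: measurable_funM; exact: adapted_dW.
Qed.

End brownian_moments.

(** * Entries and the Frobenius norm *)

Section euclidean_norm.
Context {R : realType}.

Lemma enorm_sqr m n (A : 'M[R]_(m, n)) : enorm A ^+ 2 = \sum_i \sum_j A i j ^+ 2.
Proof.
rewrite /enorm sqr_sqrtr /inner; first by under eq_bigr do under eq_bigr do rewrite -expr2.
by apply: sumr_ge0 => i _; apply: sumr_ge0 => j _; rewrite -expr2 sqr_ge0.
Qed.

Lemma enorm_ge0 m n (A : 'M[R]_(m, n)) : 0 <= enorm A.
Proof. exact: sqrtr_ge0. Qed.

Lemma entry_le_enorm m n (A : 'M[R]_(m, n)) i j : A i j ^+ 2 <= enorm A ^+ 2.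
Proof.
rewrite enorm_sqr (bigD1 i)//= (bigD1 j)//= -addrA lerDl addr_ge0//.
  by apply: sumr_ge0 => l _; exact: sqr_ge0.
by apply: sumr_ge0 => k _; apply: sumr_ge0 => l _; exact: sqr_ge0.
Qed.

Lemma normr_entry_le_enorm m n (A : 'M[R]_(m, n)) i j : `|A i j| <= enorm A.
Proof.
rewrite -(@ler_pXn2r _ 2)// ?nnegrE ?enorm_ge0//.
by rewrite real_normK ?num_real// entry_le_enorm.
Qed.

End euclidean_norm.

(** * Stochastic integrals as square-integrable martingales *)

Section martingales.
Context {R : realType} {dO : measure_display} {Omega : measurableType dO}.
Variable P : probability Omega R.
Hypothesis P_complete : measure_is_complete P.
Context {n : nat}.
Variable W : R -> Omega -> 'cV[R]_n.
Hypothesis W_bm : brownian_motion P W.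
Local Notation adapted := (adapted P W).

Lemma adaptedD t X Y : adapted t X -> adapted t Y -> adapted t (fun w => X w + Y w).
Proof. exact: measurable_funD. Qed.

Lemma adaptedB t X Y : adapted t X -> adapted t Y -> adapted t (fun w => X w - Y w).
Proof. exact: measurable_funB. Qed.

Lemma adaptedM t X Y : adapted t X -> adapted t Y -> adapted t (fun w => X w * Y w).
Proof. exact: measurable_funM. Qed.

Lemma adapted_cst t c : adapted t (cst c).
Proof. exact: measurable_cst. Qed.

Lemma adapted_sum t I (s : seq I) (F : I -> Omega -> R) :
  (forall i, adapted t (F i)) -> adapted t (fun w => \sum_(i <- s) F i w).
Proof. by move=> aF; apply: measurable_sum. Qed.

Let amF t X := @adapted_measurable _ _ _ _ P_complete _ _ W_bm t X.

(** The martingale property is tested against square-integrable variables of the past; this avoids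
    conditional expectations and passes directly to L2 limits. *)
Definition L2mart (M : R -> Omega -> R) : Prop :=
  [/\ forall t, 0 <= t -> adapted t (M t), forall t, 0 <= t -> L2 P (M t) &
   forall s t c, 0 <= s <= t -> adapted s c -> L2 P c ->
     Ex P (fun w => c w * (M t w - M s w)) = 0].

Lemma L2mart0 : L2mart (fun _ _ => 0).
Proof.
split=> [t _|t _|s t c _ _ _]; [exact: adapted_cst|exact: L2_cst|].
rewrite (@eq_Ex _ _ _ _ _ (cst 0)) ?Ex_cst// => w.
by rewrite subrr mulr0.
Qed.

Lemma L2martD M N : L2mart M -> L2mart N -> L2mart (fun t w => M t w + N t w).
Proof.
move=> [aM lM mM] [aN lN mN]; split=> [t t0|t t0|s t c st ac lc].
- by apply: adaptedD; [exact: aM|exact: aN].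
- by apply: L2D; [exact: lM|exact: lN].
have [s0 t0] : 0 <= s /\ 0 <= t.
  by have /andP[s0 st'] := st; split => //; exact: le_trans st'.
have dM : L2 P (fun w => M t w - M s w) by apply: L2B; exact: lM.
have dN : L2 P (fun w => N t w - N s w) by apply: L2B; exact: lN.
rewrite (@eq_Ex _ _ _ _ _ (fun w => c w * (M t w - M s w) + c w * (N t w - N s w))).
  by rewrite ExD ?mM ?mN ?addr0//; exact: L2M.
by move=> w; ring.
Qed.

Lemma L2martZ a M : L2mart M -> L2mart (fun t w => a * M t w).
Proof.
move=> [aM lM mM]; split=> [t t0|t t0|s t c st ac lc].
- by apply: adaptedM; [exact: adapted_cst|exact: aM].
- by apply: L2Z; exact: lM.
have [s0 t0] : 0 <= s /\ 0 <= t.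
  by have /andP[s0 st'] := st; split => //; exact: le_trans st'.
rewrite (@eq_Ex _ _ _ _ _ (fun w => a * (c w * (M t w - M s w)))).
  by rewrite ExZ ?mM ?mulr0//; apply: L2M => //; apply: L2B; exact: lM.
by move=> w; ring.
Qed.

Lemma L2martB M N : L2mart M -> L2mart N -> L2mart (fun t w => M t w - N t w).
Proof.
move=> lM /(L2martZ (-1)) lN; have := L2martD lM lN.
by rewrite (_ : (fun t w => M t w + -1 * N t w) = (fun t w => M t w - N t w))//;
  apply/funext => t; apply/funext => w; rewrite mulN1r.
Qed.

Lemma L2mart_sum I (s : seq I) (M : I -> R -> Omega -> R) :
  (forall i, L2mart (M i)) -> L2mart (fun t w => \sum_(i <- s) M i t w).
Proof.
move=> lM; elim: s => [|i s IH].
  rewrite (_ : (fun _ => _) = (fun _ _ => 0)); first exact: L2mart0.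
  by apply/funext => t; apply/funext => w; rewrite big_nil.
rewrite (_ : (fun _ => _) = (fun t w => M i t w + \sum_(j <- s) M j t w)).
  exact: L2martD.
by apply/funext => t; apply/funext => w; rewrite big_cons.
Qed.

(* Stopping the increment of [W] over [a, b] at time [t], and taking its
   increment over [s, t], is the same as clipping [a] and [b] to [s, t]. *)
Lemma dW_clip (a b s t : R) i w : s <= t -> a <= b ->
  dW W (Num.min a t) (Num.min b t) i w - dW W (Num.min a s) (Num.min b s) i w =
  dW W (Num.max s (Num.min a t)) (Num.max s (Num.min b t)) i w.
Proof.
move=> st ab; have key x : (W (Num.min x t) w) i 0 - (W (Num.min x s) w) i 0 =
    (W (Num.max s (Num.min x t)) w) i 0 - (W s w) i 0.
  have [xs|sx] := leP x s.
    rewrite (min_idPl (le_trans xs st)).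
    by rewrite (max_idPl xs) !subrr.
  have [xt|tx] := leP x t; first by rewrite (max_idPr (ltW sx)).
  by rewrite (max_idPr st).
by rewrite /dW !mxE; have := key a; have := key b; lra.
Qed.

(** Over [s, t] only the clipped interval [a', b'] contributes. Either t <= a and it is degenerate,
    or its left end is at least a and s, so that both [v] and the test variable are known there. *)
Lemma L2mart_stopped_dW (a b : R) i (v : Omega -> R) (C : R) : 0 <= a <= b ->
  adapted a v -> (forall w, `|v w| <= C) ->
  L2mart (fun t w => v w * dW W (Num.min a t) (Num.min b t) i w).
Proof.
move=> /andP[a0 ab] av vC; have mv := amF av.
have mintt (t : R) : 0 <= t -> 0 <= Num.min a t <= Num.min b t.
  by move=> t0; rewrite le_min a0 t0/= le_min ge_min ab/= ge_min lexx orbT.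
split=> [t t0|t t0|s t c /andP[s0 st] ac lc].
- have [ta|a_t] := leP t a.
    rewrite (_ : (fun w => _) = cst 0); first exact: adapted_cst.
    apply/funext => w; rewrite (min_idPr (le_trans ta ab)).
    by rewrite dW_eq0 mulr0.
  apply: adaptedM; first exact: adapted_le (ltW a_t) _.
  apply: adapted_dW; last by rewrite ge_min lexx orbT.
  by have := mintt t t0; rewrite (min_idPl (ltW a_t)).
- by apply: (L2_Mbounded mv vC); apply: (L2_dW P_complete W_bm); exact: mintt.
pose a' := Num.max s (Num.min a t); pose b' := Num.max s (Num.min b t).
have a'b' : 0 <= a' <= b'.
  rewrite le_max s0/= ge_max le_max lexx/= le_max.
  by have /andP[_ ->] := mintt t (le_trans s0 st); rewrite orbT.
rewrite (@eq_Ex _ _ _ _ _ (fun w => c w * v w * dW W a' b' i w)); last first.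
  by move=> w; rewrite -mulrBr dW_clip// mulrA.
have [ta|a_t] := leP t a.
  rewrite (@eq_Ex _ _ _ _ _ (cst 0)) ?Ex_cst// => w.
  rewrite /a' /b' (min_idPr ta) (min_idPr (le_trans ta ab)).
  by rewrite dW_eq0 mulr0.
have aa' : a <= a' by rewrite /a' (min_idPl (ltW a_t)) le_max lexx orbT.
have sa' : s <= a' by rewrite /a' le_max lexx.
apply: (Ex_adapted_dW P_complete W_bm) => //.
  by apply: adaptedM; [exact: adapted_le sa' _|exact: adapted_le aa' _].
under eq_fun do rewrite mulrC; exact: (L2_Mbounded mv vC).
Qed.

Lemma simple_integralE k (S : simple_process P W k) t w j :
  simple_integral S t w j 0 = \sum_(q < sp_size S) \sum_(l < n)
    sp_val S q w j l *
    dW W (Num.min (sp_time S q) t) (Num.min (sp_time S q.+1) t) l w.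
Proof. by rewrite summxE; apply: eq_bigr => q _; rewrite mxE. Qed.

Lemma sp_time_mono k (S : simple_process P W k) q : 0 <= sp_time S q <= sp_time S q.+1.
Proof.
rewrite (le_trans (sp_time_ge0 S))/=; last exact: sp_time_nondecreasing.
exact: sp_time_nondecreasing.
Qed.

Lemma L2mart_simple k (S : simple_process P W k) j :
  L2mart (fun t w => simple_integral S t w j 0).
Proof.
rewrite (_ : (fun t => _) = (fun t w => \sum_(q < sp_size S) \sum_(l < n)
    sp_val S q w j l *
    dW W (Num.min (sp_time S q) t) (Num.min (sp_time S q.+1) t) l w)); last first.
  by apply/funext => t; apply/funext => w; rewrite simple_integralE.
apply: L2mart_sum => q; apply: L2mart_sum => l.
have [C SC] := sp_val_bounded S.
apply: (@L2mart_stopped_dW _ _ _ _ C); first exact: sp_time_mono.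
  exact: sp_val_adapted.
by move=> w; apply: le_trans (SC q w); exact: normr_entry_le_enorm.
Qed.

End martingales.

(** * Ito integrals and martingale differences along a partition *)

Section ito_martingale.
Context {R : realType} {dO : measure_display} {Omega : measurableType dO}.
Variable P : probability Omega R.
Hypothesis P_complete : measure_is_complete P.
Context {n : nat}.
Variable W : R -> Omega -> 'cV[R]_n.
Hypothesis W_bm : brownian_motion P W.
Local Notation adapted := (adapted P W).
Local Notation L2mart := (L2mart P W).
Local Notation mu := (@lebesgue_measure R).

Let amF t X := @adapted_measurable _ _ _ _ P_complete _ _ W_bm t X.

Lemma cvge0_lt (u : nat -> \bar R) (e : R) : u @ \oo --> 0%E -> 0 < e ->
  exists N, forall m, (N <= m)%N -> (u m < e%:E)%E.
Proof.
move=> /fine_cvgP[ufin uc] e0.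
have /cvgr_lt/(_ e e0) h := uc.
have [N _ hN] : \forall m \near \oo, (u m < e%:E)%E.
  near=> m; have fm : u m \is a fin_num by near: m.
  by rewrite -(fineK fm) lte_fin; near: m.
by exists N => m /hN.
Unshelve. all: by end_near. Qed.

Lemma measurable_enorm2 k l (A : Omega -> 'M[R]_(k, l)) :
  (forall i j, measurable_fun setT (fun w => A w i j)) ->
  measurable_fun setT (fun w => enorm (A w) ^+ 2).
Proof.
move=> mA; under eq_fun do rewrite enorm_sqr.
apply: measurable_sum => i; apply: measurable_sum => j.
exact: measurable_funX.
Qed.

Lemma ito_approximation k (H : R -> Omega -> 'M[R]_(k, n)) J :
  ito_integral P W H J -> exists S : nat -> simple_process P W k,
  forall T e, 0 <= T -> 0 < e -> exists N, forall m, (N <= m)%N ->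
    [/\ (\int[P]_w \int[mu]_(s in `[0%R, T])
          (enorm (simple_eval (S m) s w - H s w) ^+ 2)%:E < e%:E)%E,
      L1 P (fun w => enorm (simple_integral (S m) T w - J T w) ^+ 2) &
      Ex P (fun w => enorm (simple_integral (S m) T w - J T w) ^+ 2) < e].
Proof.
move=> [_ pJ _ [S SJ]]; exists S => T e T0 e0.
have [/cvge0_lt/(_ e0)[N1 h1] /cvge0_lt/(_ e0)[N2 h2]] := SJ T T0.
exists (maxn N1 N2) => m; rewrite geq_max => /andP[/h1 lt1 /h2 lt2].
have mX : measurable_fun setT
    (fun w => enorm (simple_integral (S m) T w - J T w) ^+ 2).
  apply: measurable_enorm2 => i j; rewrite (ord1 j).
  under eq_fun do rewrite 2!mxE.
  apply: measurable_funB.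
    have [aI _ _] := L2mart_simple P_complete W_bm (S m) i.
    exact: amF (aI T T0).
  exact: amF (progressive_adapted (pJ i 0) T0).
have lX : L1 P (fun w => enorm (simple_integral (S m) T w - J T w) ^+ 2).
  apply: L1_lty => //; first by move=> w; exact: sqr_ge0.
  by apply: lt_trans lt2 _; rewrite ltry.
by split => //; rewrite -lte_fin -ExE.
Qed.

(** The martingale property of the simple integrals survives the L2 limit, because the test variable
    is itself in L2. *)
Lemma L2mart_ito k (H : R -> Omega -> 'M[R]_(k, n)) J j :
  ito_integral P W H J -> L2mart (fun t w => J t w j 0).
Proof.
move=> itoJ; have [S SJ] := ito_approximation itoJ.
have [_ pJ _ _] := itoJ.
have aJ t : 0 <= t -> adapted t (fun w => J t w j 0).
  by move=> t0; exact: progressive_adapted (pJ j 0) t0.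
have lS m := L2mart_simple P_complete W_bm (S m) j.
pose D m t w := simple_integral (S m) t w j 0 - J t w j 0.
have mD m t : 0 <= t -> measurable_fun setT (D m t).
  move=> t0; apply: measurable_funB; last exact: amF (aJ t t0).
  by have [aI _ _] := lS m; exact: amF (aI t t0).
have DX m t w : D m t w ^+ 2 <= enorm (simple_integral (S m) t w - J t w) ^+ 2.
  by apply: le_trans (entry_le_enorm _ j 0); rewrite !mxE.
have small t e : 0 <= t -> 0 < e -> exists N, forall m, (N <= m)%N ->
    L2 P (D m t) /\ Ex P (fun w => D m t w ^+ 2) < e.
  move=> t0 e0; have [N hN] := SJ t e t0 e0; exists N => m /hN[_ lX EX].
  have lD : L1 P (fun w => D m t w ^+ 2).
    apply: (L1_le _ _ lX); first by apply: measurable_funX; exact: mD.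
    by move=> w; rewrite ger0_norm ?sqr_ge0// DX.
  split; first by split => //; exact: mD.
  by apply: le_lt_trans EX; exact: Ex_le.
have lJ t : 0 <= t -> L2 P (fun w => J t w j 0).
  move=> t0; have [N /(_ N (leqnn N))[lD _]] := small t 1 t0 ltr01.
  have [_ lI _] := lS N; have := L2B (lI t t0) lD.
  by congr L2; apply/funext => w; rewrite /D; ring.
split => // s t c st ac lc; have /andP[s0 st'] := st.
have t0 : 0 <= t := le_trans s0 st'.
apply/eqP; rewrite -normr_le0; apply/ler_addgt0Pr => e e0; rewrite add0r.
pose E := Ex P (fun w => c w ^+ 2).
have E0 : 0 <= E by apply: Ex_ge0 => w; exact: sqr_ge0.
(* With this weight, Young's inequality bounds each of the errors at times s and t by r E + (r e /
   8) / r <= e / 4 + e / 8, hence their sum by e. *)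
pose r := e / (4 * (E + 1)).
have r0 : 0 < r by rewrite divr_gt0// mulr_gt0// ltr_wpDl.
have re0 : 0 < r * (e / 8) by rewrite mulr_gt0// divr_gt0.
have [N1 h1] := small s _ s0 re0; have [N2 h2] := small t _ t0 re0.
pose m := maxn N1 N2.
have [ls Es] := h1 m (leq_maxl _ _); have [lt Et] := h2 m (leq_maxr _ _).
have [_ lI mI] := lS m.
have lE u : 0 <= u -> L2 P (D m u) -> L1 P (fun w => c w * D m u w).
  by move=> u0 lu; exact: L2M.
rewrite (@eq_Ex _ _ _ _ _ (fun w => c w * (simple_integral (S m) t w j 0 -
    simple_integral (S m) s w j 0) - (c w * D m t w - c w * D m s w))); last first.
  by move=> w; rewrite /D; ring.
rewrite ExB; [|by apply: L2M => //; apply: L2B; exact: lI|by apply: L1B; exact: lE].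
rewrite mI// sub0r normrN ExB; [|exact: lE..].
have yt := Ex_young r0 lc lt; have ys := Ex_young r0 lc ls.
apply: le_trans (ler_normB _ _) _; apply: le_trans (lerD yt ys) _.
rewrite -/E.
have rE : r * E <= e / 4.
  rewrite /r mulrAC ler_pdivrMr ?mulr_gt0 ?ltr_wpDl//.
  have -> : e / 4 * (4 * (E + 1)) = e * (E + 1) by field.
  by rewrite ler_pM2l// lerDl.
have half (y : R) : y < r * (e / 8) -> r^-1 * y <= e / 8.
  by move=> h; rewrite mulrC ler_pdivrMr// mulrC ltW.
by have := half _ Et; have := half _ Es; lra.
Qed.

Section martingale_differences.
Variable tt : nat -> R.
Hypothesis tt0 : forall i, 0 <= tt i.
Hypothesis tt_mono : forall i, tt i <= tt i.+1.

(** Martingale differences for the filtration sampled along [tt], again expressed by L2 test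
    variables. *)
Definition mdiff (D : nat -> Omega -> R) : Prop := forall i,
  [/\ adapted (tt i.+1) (D i), L2 P (D i) &
    forall c, adapted (tt i) c -> L2 P c -> Ex P (fun w => c w * D i w) = 0].

Let tt_le i j : (i <= j)%N -> tt i <= tt j.
Proof.
by apply: (@homo_leq _ tt (fun x y : R => x <= y)) => //; exact: le_trans.
Qed.

Lemma mdiff_L2 D i : mdiff D -> L2 P (D i).
Proof. by move=> /(_ i)[]. Qed.

Lemma mdiff_sqr_sum D K : mdiff D ->
  Ex P (fun w => (\sum_(i < K) D i w) ^+ 2) = \sum_(i < K) Ex P (fun w => D i w ^+ 2).
Proof.
move=> mD; apply: Ex_sqr_sum_orthogonal => [i|i j /andP[ij jK]].
  exact: mdiff_L2.
have [aDi lDi _] := mD i; have [_ _ oDj] := mD j; apply: oDj => //.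
by apply: adapted_le aDi; exact: tt_le.
Qed.

Lemma mdiff_mean D K : mdiff D -> Ex P (fun w => \sum_(i < K) D i w) = 0.
Proof.
move=> mD; rewrite Ex_sum; last by move=> i; apply: L2_L1; exact: mdiff_L2.
rewrite big1// => i _; have [_ _ /(_ (cst 1))] := mD i.
rewrite (@eq_Ex _ _ _ _ _ (D i)); last by move=> w; rewrite mul1r.
by apply; [exact: adapted_cst|exact: L2_cst].
Qed.

Lemma mdiffD D E : mdiff D -> mdiff E -> mdiff (fun i w => D i w + E i w).
Proof.
move=> mD mE i; have [aD lD oD] := mD i; have [aE lE oE] := mE i; split.
- exact: adaptedD.
- exact: L2D.
move=> c ac lc.
rewrite (@eq_Ex _ _ _ _ _ (fun w => c w * D i w + c w * E i w)).
  by rewrite ExD ?oD ?oE ?addr0//; exact: L2M.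
by move=> w; rewrite mulrDr.
Qed.

Lemma mdiff0 : mdiff (fun _ _ => 0).
Proof.
move=> i; split; [exact: adapted_cst|exact: L2_cst|move=> c _ _].
by rewrite (@eq_Ex _ _ _ _ _ (cst 0)) ?Ex_cst// => w; rewrite mulr0.
Qed.

Lemma mdiff_sum I (s : seq I) (D : I -> nat -> Omega -> R) :
  (forall k, mdiff (D k)) -> mdiff (fun i w => \sum_(k <- s) D k i w).
Proof.
move=> mD; elim: s => [|k s IH].
  rewrite (_ : (fun _ => _) = (fun _ _ => 0)); first exact: mdiff0.
  by apply/funext => i; apply/funext => w; rewrite big_nil.
rewrite (_ : (fun _ => _) = (fun i w => D k i w + \sum_(j <- s) D j i w)).
  exact: mdiffD.
by apply/funext => i; apply/funext => w; rewrite big_cons.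
Qed.

(** A discrete stochastic integral: [c i] is known at the left end point, and its boundedness keeps
    the product in L2. *)
Lemma mdiffM (c D : nat -> Omega -> R) : (forall i, adapted (tt i) (c i)) ->
  (forall i, exists C : R, forall w, `|c i w| <= C) -> mdiff D ->
  mdiff (fun i w => c i w * D i w).
Proof.
move=> ac bc mD i; have [aD lD oD] := mD i; have [C cC] := bc i.
have mc := amF (ac i); split.
- by apply: adaptedM => //; apply: adapted_le (ac i); exact: tt_mono.
- exact: (L2_Mbounded mc cC).
move=> b ab lb.
rewrite (@eq_Ex _ _ _ _ _ (fun w => (c i w * b w) * D i w)).
  by apply: oD; [exact: adaptedM|exact: (L2_Mbounded mc cC)].
by move=> w; ring.
Qed.

Lemma mdiff_mart M : L2mart M -> mdiff (fun i w => M (tt i.+1) w - M (tt i) w).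
Proof.
move=> [aM lM mM] i; split.
- apply: adaptedB; first exact: aM.
  by apply: (adapted_le (tt_mono i)); exact: aM.
- by apply: L2B; exact: lM.
by move=> c ac lc; apply: mM => //; rewrite tt0 tt_mono.
Qed.

Lemma mdiff_qvar k l : mdiff (fun i => qvar W (tt i) (tt i.+1) k l).
Proof.
move=> i; have h : 0 <= tt i <= tt i.+1 by rewrite tt0 tt_mono.
split; [exact: adapted_qvar|exact: (L2_qvar P_complete W_bm _ _ h).1|].
by move=> c; exact: (Ex_adapted_qvar P_complete W_bm).
Qed.

(** By orthogonality the left side is the second moment of a telescoping sum, so it depends on the
    two end points and not on the fineness of the partition. *)
Lemma mart_sqr_increments M K : L2mart M ->
  \sum_(i < K) Ex P (fun w => (M (tt i.+1) w - M (tt i) w) ^+ 2) =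
  Ex P (fun w => (M (tt K) w - M (tt 0) w) ^+ 2).
Proof.
move=> lM; have := mdiff_sqr_sum K (mdiff_mart lM); move=> <-.
apply: eq_Ex => w; congr (_ ^+ 2).
by rewrite -(big_mkord xpredT (fun i => M (tt i.+1) w - M (tt i) w)) telescope_sumr.
Qed.

End martingale_differences.
End ito_martingale.

(** * Partitions and quadratic variation *)

Section partitions.
Context {R : realType}.

(* Partitions are sequences that are constant equal to [T] from index [K] on. *)
Record partition_of (T : R) (pts : seq R) (h : R) (K : nat) (tt : nat -> R) : Prop := {
  part_start : tt 0%N = 0;
  part_end : tt K = T;
  part_ge0 : forall i, 0 <= tt i;
  part_le : forall i, tt i <= T;
  part_mono : forall i, tt i <= tt i.+1;
  part_mesh : forall i, tt i.+1 - tt i <= h;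
  part_gap : forall p i, p \in pts -> p <= tt i \/ tt i.+1 <= p }.

Lemma partition_exists (T h : R) (pts : seq R) : 0 <= T -> 0 < h ->
  exists K tt, partition_of T pts h K tt.
Proof.
move=> T0 h0.
(* The grid goes one step beyond T, so that every point of [0, T] has a grid point to its right. *)
pose grid := [seq j%:R * h | j <- iota 0 (Num.truncn (T / h)).+2].
pose s := sort <=%R (0 :: T :: [seq p <- pts ++ grid | 0 <= p <= T]).
have s_sorted : sorted <=%R s by apply: sort_sorted; exact: le_total.
have sP p : p \in s -> 0 <= p <= T.
  rewrite mem_sort !inE => /or3P[/eqP->|/eqP->|]; rewrite ?lexx ?T0//.
  by rewrite mem_filter => /andP[].
(* The default value makes the sequence stay at T once the list is exhausted. *)
pose tt i := nth T s i.
have ttP i : 0 <= tt i <= T.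
  rewrite /tt; have [lt|ge] := ltnP i (size s); first exact/sP/mem_nth.
  by rewrite nth_default// T0 lexx.
have mono i j : (i <= j)%N -> tt i <= tt j.
  move=> ij; have [lt|ge] := ltnP j (size s); last first.
    by rewrite {2}/tt nth_default//; have /andP[] := ttP i.
  apply: (sorted_leq_nth le_trans le_refl) => //.
  by rewrite inE (leq_ltn_trans ij).
have gap p i : p \in pts ++ grid -> p <= tt i \/ tt i.+1 <= p.
  move=> pin; have /andP[i0 iT] := ttP i; have /andP[i10 i1T] := ttP i.+1.
  have [p0|p0] := ltP p 0; first by left; apply: le_trans i0; exact: ltW.
  have [pT|pT] := leP p T; last by right; apply: le_trans i1T _; exact: ltW.
  have ps : p \in s by rewrite mem_sort !inE mem_filter p0 pT pin !orbT.
  have E : p = tt (index p s) by rewrite /tt nth_index.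
  have [le|lt] := leqP (index p s) i; [left|right]; rewrite E; exact: mono.
exists (size s), tt; split=> //.
- apply/eqP; rewrite eq_le; have /andP[-> _] := ttP 0%N; rewrite andbT.
  have -> : 0 = tt (index 0 s) by rewrite /tt nth_index// mem_sort inE eqxx.
  exact: mono.
- by rewrite /tt nth_default.
- by move=> i; have /andP[] := ttP i.
- by move=> i; have /andP[] := ttP i.
- by move=> i; exact: mono.
- move=> i; have /andP[i0 iT] := ttP i.
  (* (j + 1) h is the first grid point beyond tt i. It does not lie strictly inside the interval, so
     tt i.+1 <= (j + 1) h <= tt i + h. *)
  have q0 : 0 <= tt i / h by rewrite divr_ge0// ltW.
  have /andP[j1 j2] := truncn_itv q0.
  set j := Num.truncn (tt i / h) in j1 j2.
  have [] := gap (j.+1%:R * h) i.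
  + rewrite mem_cat; apply/orP; right; apply/mapP; exists j.+1 => //.
    rewrite mem_iota add0n ltnS ltnS/=; apply: le_truncn.
    by rewrite ler_pM2r// invr_gt0.
  + by rewrite -ler_pdivlMr// leNgt j2.
  + move: j1; rewrite ler_pdivlMr// -natr1 mulrDl mul1r => j1 j3.
    by rewrite lerBlDl (le_trans j3)// lerD2r.
- by move=> p i pin; apply: gap; rewrite mem_cat pin.
Qed.

Context {dO : measure_display} {Omega : measurableType dO}.
Variable P : probability Omega R.
Hypothesis P_complete : measure_is_complete P.
Context {n : nat}.
Variable W : R -> Omega -> 'cV[R]_n.
Hypothesis W_bm : brownian_motion P W.

(** The right end of the last interval is included, hence one more time than there are steps. *)
Definition sp_times k (S : simple_process P W k) : seq R :=
  [seq sp_time S q | q <- iota 0 (sp_size S).+1].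

Section simple_on_partition.
Variables (T : R) (pts : seq R) (h : R) (K : nat) (tt : nat -> R).
Hypothesis ptt : partition_of T pts h K tt.
Variables (k : nat) (S : simple_process P W k).
Hypothesis Spts : {subset sp_times S <= pts}.

Let gapS q i : (q <= sp_size S)%N -> sp_time S q <= tt i \/ tt i.+1 <= sp_time S q.
Proof.
move=> qS; apply: (part_gap ptt); apply: Spts; apply/mapP; exists q => //.
by rewrite mem_iota add0n ltnS.
Qed.

(** Simple processes are constant on intervals open on the left, so the value on a cell is read at
    its right end; it is nevertheless known at time [tt i], by [simple_step_adapted]. *)
Definition simple_step (i : nat) (w : Omega) : 'M[R]_(k, n) :=
  simple_eval S (tt i.+1) w.

Lemma simple_stepE i w j l : simple_step i w j l =
  \sum_(q < sp_size S)
   (\1_(`]sp_time S q, sp_time S q.+1]) (tt i.+1) : R) * sp_val S q w j l.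
Proof. by rewrite /simple_step /simple_eval summxE; apply: eq_bigr => q _; rewrite mxE. Qed.

Lemma simple_eval_step i s w : tt i < s <= tt i.+1 ->
  simple_eval S s w = simple_step i w.
Proof.
move=> /andP[ils sil]; rewrite /simple_step /simple_eval; apply: eq_bigr => q _.
congr (_ *: _); rewrite !indicE; congr (_%:R); congr nat_of_bool.
have q1 : (q <= sp_size S)%N by exact: ltnW.
rewrite !mem_setE !in_itv/=.
have -> : (sp_time S q < s) = (sp_time S q < tt i.+1).
  apply/idP/idP => [|qi]; first by move=> /lt_le_trans; apply.
  have [h1|] := gapS i q1; first exact: le_lt_trans ils.
  by rewrite leNgt qi.
congr (_ && _); apply/idP/idP => [sq|]; last exact: le_trans.
have [h1|h1] := gapS i (ltn_ord q : (q.+1 <= sp_size S)%N); last by [].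
by have := lt_le_trans ils sq; rewrite ltNge h1.
Qed.

(** Since no jump time lies inside a cell, each interval of [S] either contains the cell or meets it
    in end points at most. *)
Lemma simple_step_integral i w j :
  simple_integral S (tt i.+1) w j 0 - simple_integral S (tt i) w j 0 =
  \sum_(l < n) simple_step i w j l * dW W (tt i) (tt i.+1) l w.
Proof.
under eq_bigr do rewrite simple_stepE mulr_suml.
rewrite [RHS]exchange_big/= !simple_integralE -sumrB; apply: eq_bigr => q _.
rewrite -sumrB; apply: eq_bigr => l _.
rewrite -mulrBr dW_clip; [|exact: (part_mono ptt)|by have /andP[] := sp_time_mono S q].
rewrite -mulrA mulrCA; congr (_ * _).
have q1 : (q <= sp_size S)%N by exact: ltnW.
have ii := part_mono ptt i; rewrite indicE mem_setE in_itv/=.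
have /andP[_ qq] := sp_time_mono S q.
have [h1|h1] := gapS i q1; last first.
  rewrite (min_idPr h1) (min_idPr (le_trans h1 qq)) dW_eq0.
  by rewrite ltNge h1 mul0r.
have [h2|h2] := gapS i (ltn_ord q : (q.+1 <= sp_size S)%N).
  have h3 : Num.min (sp_time S q) (tt i.+1) <= tt i by rewrite ge_min h1.
  have h4 : Num.min (sp_time S q.+1) (tt i.+1) <= tt i by rewrite ge_min h2.
  rewrite (max_idPl h3) (max_idPl h4) dW_eq0.
  (* The interval of [S] ends before the cell; its indicator at [tt i.+1] can be 1 only if the cell
     is a single point, where the increment of W vanishes. *)
  have [t0|_] := boolP (_ && _); last by rewrite mul0r.
  have /andP[_ h5] := t0; have E : tt i = tt i.+1.
    by apply/eqP; rewrite eq_le ii (le_trans h5 h2).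
  by rewrite -E dW_eq0 mulr0.
have h3 : Num.min (sp_time S q) (tt i.+1) <= tt i by rewrite ge_min h1.
rewrite (max_idPl h3) (min_idPr h2) (max_idPr ii).
rewrite h2 andbT; have [_|h4] := ltP (sp_time S q) (tt i.+1); first by rewrite mul1r.
by rewrite mul0r (_ : tt i.+1 = tt i) ?dW_eq0//; apply/eqP; rewrite eq_le ii (le_trans h4 h1).
Qed.

(** A nonzero indicator forces [sp_time S q] < [tt i.+1], hence [sp_time S q] <= [tt i] because no
    jump time lies inside the cell. *)
Lemma simple_step_adapted i j l : adapted P W (tt i) (fun w => simple_step i w j l).
Proof.
under eq_fun do rewrite simple_stepE.
apply: adapted_sum => q; rewrite indicE; case: (boolP (_ \in _)) => [|_]; last first.
  by under eq_fun do rewrite mul0r; exact: adapted_cst.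
rewrite mem_setE in_itv/= => /andP[qi _].
apply: adaptedM; first exact: adapted_cst.
apply: (@adapted_le _ _ _ _ _ _ (sp_time S q)); last exact: sp_val_adapted.
have [h1|] := gapS i (ltnW (ltn_ord q)); first by [].
by rewrite leNgt qi.
Qed.

End simple_on_partition.

Lemma simple_eval_bounded k (S : simple_process P W k) : exists C : R, forall s w j l,
  `|simple_eval S s w j l| <= C.
Proof.
have [C SC] := sp_val_bounded S; exists (\sum_(q < sp_size S) C) => s w j l.
rewrite summxE (le_trans (ler_norm_sum _ _ _))//; apply: ler_sum => q _.
rewrite mxE normrM; apply: (@le_trans _ _ (1 * `|sp_val S q w j l|)).
  by rewrite ler_wpM2r// indicE; case: (_ \in _); rewrite ?normr1 ?normr0.
by rewrite mul1r; apply: le_trans (SC q w); exact: normr_entry_le_enorm.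
Qed.

End partitions.

(** * Measurability in time and outcome jointly *)

Section joint_measurability.
Context {R : realType} {dO : measure_display} {Omega : measurableType dO}.
Variable P : probability Omega R.
Hypothesis P_complete : measure_is_complete P.
Context {n : nat}.
Variable W : R -> Omega -> 'cV[R]_n.
Hypothesis W_bm : brownian_motion P W.
Local Notation mu := (@lebesgue_measure R).

Definition time_strip (T : R) : set (R * Omega) := [set p | 0 <= p.1 <= T].

Lemma measurable_time_strip T : measurable (time_strip T).
Proof.
rewrite (_ : time_strip T = fst @^-1` `[0, T]%classic); last first.
  by apply/seteqP; split => p /=; rewrite in_itv.
by rewrite -[X in measurable X]setTI; exact: measurable_fst.
Qed.

Lemma progressive_joint X T : progressive P W X -> 0 <= T ->
  measurable_fun (time_strip T) (fun p => X p.1 p.2).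
Proof.
move=> pX T0; have := pX T T0.
set D := [set p | _]; set f := (fun p => _) => mf.
have mD : measurable D.
  rewrite (_ : D = fst @^-1` `[0, T]%classic); last first.
    by apply/seteqP; split => p /=; rewrite in_itv.
  by rewrite -[X in measurable X]setTI; exact: measurable_fst.
pose i (p : R * Omega) : R * g_sigma_algebraType (augmented_past P W T) := p.
have mi : measurable_fun setT i.
  apply/measurable_fun_pairP; split; first exact: measurable_fst.
  move=> _ B mB; rewrite setTI.
  have : measurable (B : set Omega).
    exact: (augmented_past_measurable P_complete W_bm mB).
  by move=> mB'; rewrite -[X in measurable X]setTI; exact: measurable_snd.
move=> _ B mB; have := mi measurableT _ (mf mD B mB).
by rewrite setTI.
Qed.

Lemma measurable_time_section (f : R -> Omega -> R) T w :
  measurable_fun (time_strip T) (fun p => f p.1 p.2) ->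
  measurable_fun `[0, T] (fun s => f s w).
Proof.
move=> mf _ B mB.
have := mf (measurable_time_strip T) B mB => mA.
have mp : measurable_fun setT (fun s : R => (s, w)) by exact: pair2_measurable.
by have := mp measurableT _ mA; rewrite setTI.
Qed.

Lemma measurable_time_integral (f : R -> Omega -> R) T :
  (forall s w, 0 <= f s w) ->
  measurable_fun (time_strip T) (fun p => f p.1 p.2) ->
  measurable_fun setT (fun w => \int[mu]_(s in `[0%R, T]) (f s w)%:E)%E.
Proof.
move=> f0 mf; pose g (p : measurableTypeR R * Omega) :=
  (((fun p => f p.1 p.2) \_ (time_strip T)) p)%:E.
have mg : measurable_fun setT g.
  apply/measurable_EFinP; apply: (measurable_restrictT _ _).1; first exact: measurable_time_strip.
  exact: mf.
have g0 p : (0 <= g p)%E by rewrite lee_fin /g patchE; case: ifP.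
have := @measurable_fun_fubini_tonelli_G _ _ _ _ _ mu g mg g0.
congr measurable_fun; apply/funext => w; rewrite /fubini_G [RHS]integral_mkcond.
apply: eq_integral => s _; rewrite /g !patchE.
have -> : (s \in `[0%R, T]%classic) = (0 <= s <= T) by rewrite mem_setE in_itv.
have -> : ((s, w) \in time_strip T) = (0 <= s <= T) by exact: asboolb.
by case: ifP.
Qed.

Lemma measurable_simple_eval k (S : simple_process P W k) D i j :
  measurable_fun D (fun p : R * Omega => simple_eval S p.1 p.2 i j).
Proof.
apply: measurable_funTS; rewrite /simple_eval.
under eq_fun do rewrite summxE; apply: measurable_sum => q.
under eq_fun do rewrite mxE; apply: measurable_funM.
  have mi : measurable_fun setT
      (\1_(`]sp_time S q, sp_time S q.+1]%classic) : R -> R).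
    exact: measurable_indic.
  exact: (measurableT_comp mi measurable_fst).
have mv : measurable_fun setT (fun w => sp_val S q w i j).
  have av : adapted P W (sp_time S q) (fun w => sp_val S q w i j).
    exact: sp_val_adapted.
  exact: (adapted_measurable P_complete W_bm av).
exact: (measurableT_comp mv measurable_snd).
Qed.

End joint_measurability.

(** * Almost sure convergence from summable means *)

Section ae_convergence.
Context {R : realType} {d : measure_display} {T : measurableType d}.
Variable P : probability T R.

(** The sum of all X m has mean at most 1, so it is almost surely finite and its terms tend to 0. *)
Lemma ae_cvg0_geometric (X : nat -> T -> \bar R) :
  (forall m, measurable_fun setT (X m)) -> (forall m w, (0 <= X m w)%E) ->
  (forall m, (\int[P]_w X m w <= (1 / (2 ^ m.+1)%:R)%:E)%E) ->
  {ae P, forall w, X ^~ w @ \oo --> 0%E}.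
Proof.
move=> mX X0 XI.
have X0' m w : setT w -> true -> (0 <= X m w)%E by move=> _ _; exact: X0.
pose Y w := (\sum_(0 <= m <oo) X m w)%E.
have Y0 w : (0 <= Y w)%E by apply: nneseries_ge0.
have mY : measurable_fun setT Y by apply: ge0_emeasurable_sum.
have YI : (\int[P]_w Y w < +oo)%E.
  rewrite /Y integral_nneseries//.
  apply: (@le_lt_trans _ _ (\sum_(0 <= m <oo) (1 / (2 ^ m.+1)%:R)%:E)%E).
    by apply: lee_nneseries => m _; [move=> _; apply: integral_ge0|exact: XI].
  by apply: (le_lt_trans (epsilon_trick0 xpredT ler01)); rewrite ltry.
have iY : P.-integrable setT Y.
  apply/integrableP; split => //.
  by under eq_integral do rewrite gee0_abs//.
have := integrable_ae measurableT iY; apply: filterS => w /(_ I) Yw.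
have Xfin m : X m w \is a fin_num.
  rewrite ge0_fin_numE//; apply: (@le_lt_trans _ _ (Y w)).
    rewrite /Y (nneseriesD1 (n := m))//= leeDl//.
    by apply: nneseries_ge0.
  by rewrite -ge0_fin_numE.
have partial n : (series (fun m => fine (X m w)) n)%:E = (\sum_(0 <= m < n) X m w)%E.
  rewrite /series/= -sumEFin; apply: eq_bigr => m _; exact: fineK.
have : cvgn (series (fun m => fine (X m w))).
  apply: nondecreasing_is_cvgn.
    move=> n m nm; rewrite -lee_fin !partial; exact: ereal_nondecreasing_series.
  exists (fine (Y w)) => _ [n _ <-]; rewrite -lee_fin partial fineK//.
  exact: nneseries_lim_ge.
move=> /cvg_series_cvg_0 h; apply: cvg_EFin => //.
exact: nearW.
Qed.
End ae_convergence.

(** * Quadratic variation along a partition *)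

Section quadratic_variation.
Context {R : realType} {dO : measure_display} {Omega : measurableType dO}.
Variable P : probability Omega R.
Hypothesis P_complete : measure_is_complete P.
Context {n : nat}.
Variable W : R -> Omega -> 'cV[R]_n.
Hypothesis W_bm : brownian_motion P W.
Local Notation adapted := (adapted P W).

(** Defect between the realized quadratic variation of the integral of [u] and its compensator. *)
Definition qvsum (K : nat) (tt : nat -> R) (u : nat -> Omega -> 'rV[R]_n)
    (w : Omega) : R :=
  \sum_(i < K) ((\sum_l u i w 0 l * dW W (tt i) (tt i.+1) l w) ^+ 2 -
    (\sum_l u i w 0 l ^+ 2) * (tt i.+1 - tt i)).

(** Expanding the square exhibits the defect as a combination of [qvar] terms, which are martingale
    differences as soon as [u] is adapted and bounded. *)
Lemma qvsumE K tt u w : qvsum K tt u w = \sum_k \sum_l \sum_(i < K)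
  u i w 0 k * u i w 0 l * qvar W (tt i) (tt i.+1) k l w.
Proof.
under [RHS]eq_bigr do rewrite exchange_big/=.
rewrite [RHS]exchange_big/=; apply: eq_bigr => i _.
rewrite expr2 !mulr_suml -sumrB; apply: eq_bigr => k _.
rewrite mulr_sumr (bigD1 k)//= [RHS](bigD1 k)//= /qvar eqxx mul1r.
rewrite addrAC; congr (_ + _); first by ring.
by apply: eq_bigr => l; rewrite eq_sym => /negbTE ->; rewrite mul0r subr0; ring.
Qed.

(** By orthogonality each component has second moment at most 116 U^4 times the sum of the squared
    steps, hence at most 116 U^4 h T. The mesh [h] depends on T, U and e only: in [stage_exists] the
    bound U is known before the partition. *)
Lemma qvsum_small (T U e : R) : 0 <= T -> 0 < e -> exists2 h : R, 0 < h &
  forall pts K tt, partition_of T pts h K tt ->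
  forall u : nat -> Omega -> 'rV[R]_n,
    (forall i l, adapted (tt i) (fun w => u i w 0 l)) ->
    (forall i w l, `|u i w 0 l| <= U) ->
  L1 P (fun w => `|qvsum K tt u w|) /\ Ex P (fun w => `|qvsum K tt u w|) <= e.
Proof.
move=> T0 e0.
pose N : R := (n * n)%:R; pose r := e / (2 * (N + 1)).
have N0 : 0 <= N by [].
have r0 : 0 < r by rewrite divr_gt0// mulr_gt0// ltr_wpDl.
pose A := 116 * U ^+ 4 * T.
have U4 : 0 <= U ^+ 4 by rewrite exprn_even_ge0.
have A0 : 0 <= A by apply: mulr_ge0 => //; exact: mulr_ge0.
pose h := r ^+ 2 / (A + 1).
have A1 : 0 < A + 1 by rewrite ltr_wpDl.
have h0 : 0 < h by rewrite divr_gt0// exprn_gt0.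
exists h => // pts K tt ptt u au uU.
have tt0 := part_ge0 ptt; have ttm := part_mono ptt.
pose X k l w := \sum_(i < K)
  u i w 0 k * u i w 0 l * qvar W (tt i) (tt i.+1) k l w.
have mX k l : mdiff P W tt
    (fun i w => u i w 0 k * u i w 0 l * qvar W (tt i) (tt i.+1) k l w).
  apply: (mdiffM P_complete W_bm ttm); last exact: mdiff_qvar.
    by move=> i; exact: adaptedM.
  move=> i; exists (U * U) => w; rewrite normrM.
  by apply: ler_pM.
have lX k l : L2 P (X k l) by apply: L2_sum => i; exact: mdiff_L2 (mX k l).
have EX k l : Ex P (fun w => X k l w ^+ 2) <= r ^+ 2.
  rewrite (mdiff_sqr_sum ttm K (mX k l)).
  apply: (@le_trans _ _ (\sum_(i < K) 116 * U ^+ 4 * h * (tt i.+1 - tt i))).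
    apply: ler_sum => i _.
    have hi : 0 <= tt i <= tt i.+1 by rewrite tt0 ttm.
    have [lq Eq] := L2_qvar P_complete W_bm k l hi.
    apply: (@le_trans _ _ (U ^+ 4 * Ex P (fun w => qvar W (tt i) (tt i.+1) k l w ^+ 2))).
      rewrite -ExZ; last exact: L2_sqr.
      apply: Ex_le; [exact: L2_sqr (mdiff_L2 i (mX k l))|exact: L1Z (L2_sqr lq)|].
      move=> w; rewrite exprMn ler_wpM2r ?sqr_ge0//.
      rewrite -(real_normK (num_real _)) normrM.
      have -> : U ^+ 4 = (U * U) ^+ 2 by ring.
      have U0 : 0 <= U by exact: le_trans (normr_ge0 _) (uU i w k).
      by rewrite lerXn2r ?nnegrE ?mulr_ge0//; apply: ler_pM.
    have := part_mesh ptt i; have := ttm i; rewrite -subr_ge0.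
    set D := tt i.+1 - tt i in Eq * => D0 Dh.
    apply: (le_trans (ler_wpM2l U4 Eq)).
    have -> : U ^+ 4 * (116 * D ^+ 2) = 116 * U ^+ 4 * D * D by ring.
    rewrite ler_wpM2r// ler_wpM2l// mulr_ge0//.
  rewrite -mulr_sumr -(big_mkord xpredT (fun i => tt i.+1 - tt i)).
  rewrite telescope_sumr// (part_start ptt) (part_end ptt) subr0.
  have -> : 116 * U ^+ 4 * h * T = A * h by rewrite /A; ring.
  rewrite /h mulrCA ger_pMr ?exprn_gt0//.
  by rewrite ler_pdivrMr// mul1r lerDl.
(* Each of the n^2 components satisfies |X| <= r + X^2 / r, whose mean is at most 2 r, and 2 n^2 r
   <= e. *)
have lY : L1 P (fun w => \sum_k \sum_l (r + r^-1 * X k l w ^+ 2)).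
  apply: L1_sum => k; apply: L1_sum => l; apply: L1D; first exact: L1_cst.
  by apply: L1Z; exact: L2_sqr.
have lq : L1 P (fun w => `|qvsum K tt u w|).
  apply: L1_norm; rewrite (_ : qvsum K tt u = fun w => \sum_k \sum_l X k l w).
    by apply: L1_sum => k; apply: L1_sum => l; exact: L2_L1.
  by apply/funext => w; exact: qvsumE.
split => //; apply: le_trans (Ex_le lq lY _) _.
  move=> w; rewrite qvsumE; apply: le_trans (ler_norm_sum _ _ _) _.
  apply: ler_sum => k _; apply: le_trans (ler_norm_sum _ _ _) _.
  apply: ler_sum => l _; rewrite -/(X k l w) -(real_normK (num_real (X k l w))).
  set x := `|X k l w|.
  have -> : r + r^-1 * x ^+ 2 = x + ((r - x / 2) ^+ 2 / r + 3 / 4 * (x ^+ 2 / r)).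
    by field; rewrite gt_eqF.
  rewrite lerDl; apply: addr_ge0; first by rewrite divr_ge0 ?sqr_ge0// ltW.
  by rewrite mulr_ge0// divr_ge0 ?sqr_ge0// ltW.
rewrite Ex_sum; last first.
  move=> k; apply: L1_sum => l; apply: L1D; first exact: L1_cst.
  by apply: L1Z; exact: L2_sqr.
apply: (@le_trans _ _ (\sum_(k < n) \sum_(l < n) (r + r))).
  apply: ler_sum => k _; rewrite Ex_sum; last first.
    by move=> l; apply: L1D; [exact: L1_cst|apply: L1Z; exact: L2_sqr].
  apply: ler_sum => l _; rewrite ExD; [|exact: L1_cst|apply: L1Z; exact: L2_sqr].
  rewrite (Ex_cst P r : Ex P (fun=> _) = _) ExZ ?lerD2l; last exact: L2_sqr.
  by rewrite mulrC ler_pdivrMr// -expr2.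
rewrite !sumr_const !card_ord -mulrnA -mulr_natl.
rewrite -/N -mulr2n -mulr_natl /r.
have -> : N * (2 * (e / (2 * (N + 1)))) = e * (N / (N + 1)).
  by field; rewrite gt_eqF// ltr_wpDl.
by rewrite ger_pMr// ler_pdivrMr ?mul1r ?lerDl ?ltr_wpDl.
Qed.

End quadratic_variation.

(** * Scalar product, Cauchy-Schwarz and the triangle inequality *)

Section inner_product.
Context {R : realType}.
Implicit Types m n k : nat.

Lemma innerC m n (A B : 'M[R]_(m, n)) : inner A B = inner B A.
Proof. by apply: eq_bigr => i _; apply: eq_bigr => j _; rewrite mulrC. Qed.

Lemma innerDl m n (A B C : 'M[R]_(m, n)) : inner (A + B) C = inner A C + inner B C.
Proof.
rewrite /inner -big_split/=; apply: eq_bigr => i _.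
by rewrite -big_split/=; apply: eq_bigr => j _; rewrite mxE mulrDl.
Qed.

Lemma innerZl m n a (A B : 'M[R]_(m, n)) : inner (a *: A) B = a * inner A B.
Proof.
rewrite /inner mulr_sumr; apply: eq_bigr => i _.
by rewrite mulr_sumr; apply: eq_bigr => j _; rewrite mxE mulrA.
Qed.

Lemma innerDr m n (A B C : 'M[R]_(m, n)) : inner A (B + C) = inner A B + inner A C.
Proof. by rewrite innerC innerDl !(innerC A). Qed.

Lemma innerZr m n a (A B : 'M[R]_(m, n)) : inner A (a *: B) = a * inner A B.
Proof. by rewrite innerC innerZl innerC. Qed.

Lemma inner_enorm m n (A : 'M[R]_(m, n)) : inner A A = enorm A ^+ 2.
Proof.
by rewrite enorm_sqr; apply: eq_bigr => i _; apply: eq_bigr => j _; rewrite expr2.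
Qed.

Lemma enormD_sqr m n (A B : 'M[R]_(m, n)) :
  enorm (A + B) ^+ 2 = enorm A ^+ 2 + 2 * inner A B + enorm B ^+ 2.
Proof. by rewrite -!inner_enorm !(innerDl, innerDr) (innerC B A); ring. Qed.

Lemma enormZ_sqr m n a (A : 'M[R]_(m, n)) : enorm (a *: A) ^+ 2 = a ^+ 2 * enorm A ^+ 2.
Proof. by rewrite -!inner_enorm innerZl innerZr; ring. Qed.

Lemma enormZ m n a (A : 'M[R]_(m, n)) : enorm (a *: A) = `|a| * enorm A.
Proof.
apply/eqP; rewrite -(@eqrXn2 _ 2)// ?mulr_ge0 ?enorm_ge0//.
by rewrite enormZ_sqr exprMn real_normK ?num_real.
Qed.

Lemma enormN m n (A : 'M[R]_(m, n)) : enorm (- A) = enorm A.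
Proof. by rewrite -scaleN1r enormZ normrN1 mul1r. Qed.

Lemma enorm_subC m n (A B : 'M[R]_(m, n)) : enorm (A - B) = enorm (B - A).
Proof. by rewrite -enormN opprB. Qed.

Lemma cauchy_schwarz_sqr m n (A B : 'M[R]_(m, n)) :
  inner A B ^+ 2 <= enorm A ^+ 2 * enorm B ^+ 2.
Proof.
set b := inner A B; set c := enorm B ^+ 2; set a := enorm A ^+ 2.
have h t : 0 <= a + 2 * t * b + t ^+ 2 * c.
  have := sqr_ge0 (enorm (A + t *: B)).
  by rewrite enormD_sqr innerZr enormZ_sqr mulrA.
have c0 : 0 <= c by exact: sqr_ge0.
have [c1|c1] := eqVneq c 0.
  have a0 : 0 <= a by exact: sqr_ge0.
  have [->|b0] := eqVneq b 0; first by rewrite expr0n mulr_ge0.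
  (* With c = 0 the polynomial is affine in t, and this t gives it the negative value - a - 2. *)
  have := h (- (a + 1) / b); rewrite c1 mulr0 addr0.
  have -> : a + 2 * (- (a + 1) / b) * b = - a - 2 by field.
  lra.
have cp : 0 < c by rewrite lt_neqAle eq_sym c1.
have := h (- b / c).
have -> : a + 2 * (- b / c) * b + (- b / c) ^+ 2 * c = (a * c - b ^+ 2) / c by field.
by rewrite pmulr_lge0 ?invr_gt0// subr_ge0.
Qed.

Lemma cauchy_schwarz m n (A B : 'M[R]_(m, n)) : `|inner A B| <= enorm A * enorm B.
Proof.
rewrite -(@ler_pXn2r _ 2)// ?nnegrE ?mulr_ge0 ?enorm_ge0//.
by rewrite real_normK ?num_real// exprMn cauchy_schwarz_sqr.
Qed.

Lemma enorm_triangle m n (A B : 'M[R]_(m, n)) : enorm (A + B) <= enorm A + enorm B.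
Proof.
rewrite -(@ler_pXn2r _ 2)// ?nnegrE ?addr_ge0 ?enorm_ge0//.
rewrite enormD_sqr; have := le_trans (ler_norm _) (cauchy_schwarz A B).
lra.
Qed.

Lemma enorm_add_sqr m n (A B : 'M[R]_(m, n)) :
  enorm (A + B) ^+ 2 <= 2 * enorm A ^+ 2 + 2 * enorm B ^+ 2.
Proof.
rewrite enormD_sqr; have := cauchy_schwarz A B.
have := ler_norm (inner A B); have := sqr_ge0 (enorm A - enorm B).
lra.
Qed.

Lemma cauchy_schwarz_sum n (a b : 'I_n -> R) :
  (\sum_i a i * b i) ^+ 2 <= (\sum_i a i ^+ 2) * (\sum_i b i ^+ 2).
Proof.
have := cauchy_schwarz_sqr (\row_i a i) (\row_i b i).
have -> : inner (\row_i a i) (\row_i b i) = \sum_i a i * b i.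
  by rewrite /inner big_ord1; apply: eq_bigr => i _; rewrite !mxE.
have e (c : 'I_n -> R) : enorm (\row_i c i) ^+ 2 = \sum_i c i ^+ 2.
  by rewrite enorm_sqr big_ord1; apply: eq_bigr => i _; rewrite !mxE.
by rewrite !e.
Qed.

Lemma enorm_mul_sqr m n k (A : 'M[R]_(m, n)) (B : 'M[R]_(n, k)) :
  enorm (A *m B) ^+ 2 <= enorm A ^+ 2 * enorm B ^+ 2.
Proof.
rewrite !enorm_sqr mulr_suml; apply: ler_sum => i _.
rewrite [X in _ * X]exchange_big/= mulr_sumr; apply: ler_sum => j _.
by rewrite mxE; exact: cauchy_schwarz_sum.
Qed.

Lemma enorm_mul m n k (A : 'M[R]_(m, n)) (B : 'M[R]_(n, k)) :
  enorm (A *m B) <= enorm A * enorm B.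
Proof.
rewrite -(@ler_pXn2r _ 2)// ?nnegrE ?mulr_ge0 ?enorm_ge0//.
by rewrite exprMn enorm_mul_sqr.
Qed.

Lemma enorm_trmx m n (A : 'M[R]_(m, n)) : enorm A^T = enorm A.
Proof.
rewrite /enorm /inner exchange_big/=; congr Num.sqrt.
by apply: eq_bigr => i _; apply: eq_bigr => j _; rewrite mxE.
Qed.

Lemma mul_trmx_inner n (a b : 'cV[R]_n) : (a^T *m b) 0 0 = inner a b.
Proof.
rewrite mxE /inner; apply: eq_bigr => i _.
by rewrite big_ord1 mxE.
Qed.

Lemma sum_sqr_le (n : nat) (x : 'I_n -> R) :
  (\sum_i x i) ^+ 2 <= n%:R * \sum_i x i ^+ 2.
Proof.
have := cauchy_schwarz_sum (fun=> 1) x.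
under eq_bigr do rewrite mul1r.
by rewrite sumr_const card_ord expr1n.
Qed.

Lemma enorm_le_entries m n (A : 'M[R]_(m, n)) (c : R) :
  (forall i j, `|A i j| <= c) -> enorm A ^+ 2 <= (m * n)%:R * c ^+ 2.
Proof.
move=> h; rewrite enorm_sqr.
apply: (@le_trans _ _ (\sum_(i < m) \sum_(j < n) c ^+ 2)).
  apply: ler_sum => i _; apply: ler_sum => j _.
  rewrite -(real_normK (num_real (A i j))) lerXn2r// nnegrE.
  exact: le_trans (normr_ge0 _) (h i j).
by rewrite !sumr_const !card_ord -mulrnA mulr_natl mulnC.
Qed.

End inner_product.

(** * The exponential Lyapunov function over one interval *)

Section one_step.
Context {R : realType} {n : nat}.

(** Square of 1 + x / 2 <= exp (x / 2), whose left side is nonnegative as x >= -2. This replaces the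
    second order term of Ito's formula, at the price of 1 / 4 in place of 1 / 2. *)
Lemma expR_ge_quadratic (x : R) : -2 <= x -> 1 + x + x ^+ 2 / 4 <= expR x.
Proof.
move=> x2; have -> : expR x = expR (x / 2) ^+ 2.
  by rewrite expr2 -expRD; congr expR; field.
have -> : 1 + x + x ^+ 2 / 4 = (1 + x / 2) ^+ 2 by field.
rewrite lerXn2r ?nnegrE ?expR_ge0//; first by lra.
exact: expR_ge1Dx.
Qed.

(* [q] and [q + 2 (c + e) + D] are the squared norms of [v] and [v + be + dJ], and
   [c], [e] the scalar products of [v] with the drift [be] and the martingale
   increment [dJ], of squared norms [b2] and [j2]. *)
Lemma exp_increment_scalar (a th y al dz q c e D b2 j2 : R)
  (q' := q + 2 * (c + e) + D)
  (g := expR (a * (y - th * q ^+ 2)))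
  (g' := expR (a * (y + al + dz - th * q' ^+ 2)))
  (dN := dz - 4 * th * q * e) :
  0 < a -> 0 <= th -> 0 <= q -> 0 <= D <= 1 ->
  (c + e) ^+ 2 <= q * D -> c ^+ 2 <= q * b2 -> D <= 2 * (b2 + j2) ->
  -2 <= a * (y + al + dz - th * q' ^+ 2 - (y - th * q ^+ 2)) ->
  g * (a * al - 4 * a * th * q * c - 20 * a * th * (1 + q) * (b2 + j2)
    + a ^+ 2 * dN ^+ 2 / 8
    - a ^+ 2 * (al ^+ 2 + 16 * th ^+ 2 * q ^+ 3 * b2
                + 100 * th ^+ 2 * (1 + q) ^+ 2 * D ^+ 2))
  <= g' - g - a * (g * dN).
Proof.
move=> a0 th0 q0 /andP[D0 D1] ceD cb Dbj; set x := a * _ => x2.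
have g0 : 0 < g by exact: expR_gt0.
have -> : g' = g * expR x by rewrite /g /g' -expRD /x; congr expR; ring.
have -> : g * expR x - g - a * (g * dN) = g * (expR x - 1 - a * dN) by ring.
rewrite ler_pM2l//; have := expR_ge_quadratic x2.
set E := expR x => hE.
(* q'^2 - q^2 = 4 q (c + e) + X, so X is the second order part of the penalty and the exponent
   increases by a (dN + B), where dN carries the first order martingale terms. *)
pose X := 2 * q * D + (2 * (c + e) + D) ^+ 2.
pose B := al - 4 * th * q * c - th * X.
have xE : x = a * (dN + B) by rewrite /x /B /X /dN /q'; ring.
have X0 : 0 <= X by apply: addr_ge0; [rewrite !mulr_ge0|exact: sqr_ge0].
(* Both squares reduce to D: (c + e)^2 <= q D, and D^2 <= D because D <= 1. *)
have XD : X <= 10 * (1 + q) * D.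
  have h1 : (2 * (c + e) + D) ^+ 2 <= 8 * (c + e) ^+ 2 + 2 * D ^+ 2.
    by have := sqr_ge0 (2 * (c + e) - D); lra.
  have h2 : D ^+ 2 <= D by rewrite expr2 ler_piMr.
  have qD : 0 <= q * D by rewrite mulr_ge0.
  by rewrite /X; lra.
have B2 : B ^+ 2 <= 3 * (al ^+ 2 + 16 * th ^+ 2 * q ^+ 3 * b2
    + 100 * th ^+ 2 * (1 + q) ^+ 2 * D ^+ 2).
  have h : B ^+ 2 <= 3 * (al ^+ 2 + (4 * th * q * c) ^+ 2 + (th * X) ^+ 2).
    rewrite /B; set u := 4 * th * q * c; set t := th * X.
    have := sqr_ge0 (al + u); have := sqr_ge0 (al + t); have := sqr_ge0 (u - t); lra.
  apply: le_trans h _; rewrite ler_pM2l// -!addrA lerD2l; apply: lerD.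
    have -> : (4 * th * q * c) ^+ 2 = 16 * th ^+ 2 * q ^+ 2 * c ^+ 2 by ring.
    have -> : 16 * th ^+ 2 * q ^+ 3 * b2 = 16 * th ^+ 2 * q ^+ 2 * (q * b2) by ring.
    by rewrite ler_wpM2l// !mulr_ge0// sqr_ge0.
  have -> : 100 * th ^+ 2 * (1 + q) ^+ 2 * D ^+ 2 = (th * (10 * (1 + q) * D)) ^+ 2 by ring.
  have q1 : 0 <= 1 + q by lra.
  rewrite lerXn2r ?nnegrE ?mulr_ge0//; exact: ler_wpM2l.
(* Half of dN^2 survives whatever B is; with the 1 / 4 of [expR_ge_quadratic] this produces the
   coefficient 1 / 8. *)
have dNB : dN ^+ 2 / 2 - B ^+ 2 <= (dN + B) ^+ 2.
  by have := sqr_ge0 (dN / 2 + B); have := sqr_ge0 dN; lra.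
have a2 : 0 < a ^+ 2 by rewrite exprn_gt0.
have x2E : x ^+ 2 = a ^+ 2 * (dN + B) ^+ 2 by rewrite xE exprMn.
have h3 : a ^+ 2 * (dN ^+ 2 / 2 - B ^+ 2) <= x ^+ 2 by rewrite x2E ler_pM2l.
have h4 : a ^+ 2 * B ^+ 2 <= a ^+ 2 * (3 * (al ^+ 2 + 16 * th ^+ 2 * q ^+ 3 * b2
    + 100 * th ^+ 2 * (1 + q) ^+ 2 * D ^+ 2)) by rewrite ler_pM2l.
set Q := _ + _ + 100 * _ * _ * _ in B2 h4 *.
have Q0 : 0 <= Q by have := sqr_ge0 B; lra.
have Q1 : 0 <= a ^+ 2 * Q by rewrite mulr_ge0// ltW.
have athX : a * (th * X) <= 20 * a * th * (1 + q) * (b2 + j2).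
  have -> : 20 * a * th * (1 + q) * (b2 + j2) =
      a * (th * (10 * (1 + q) * (2 * (b2 + j2)))) by ring.
  rewrite ler_pM2l// ler_wpM2l// (le_trans XD)// ler_wpM2l//.
  by rewrite mulr_ge0//; lra.
have xlin : x = a * dN + a * al - 4 * a * th * q * c - a * (th * X).
  by rewrite xE /B; ring.
rewrite mulrBr in h3; lra.
Qed.

Lemma exp_increment (a th y al dz : R) (v be dJ : 'cV[R]_n)
  (q := enorm v ^+ 2) (q' := enorm (v + be + dJ) ^+ 2) (D := enorm (be + dJ) ^+ 2)
  (g := expR (a * (y - th * q ^+ 2)))
  (g' := expR (a * (y + al + dz - th * q' ^+ 2)))
  (dN := dz - 4 * th * q * inner v dJ) :
  0 < a -> 0 <= th -> D <= 1 ->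
  -2 <= a * (y + al + dz - th * q' ^+ 2 - (y - th * q ^+ 2)) ->
  g * (a * al - 4 * a * th * q * inner v be
    - 20 * a * th * (1 + q) * (enorm be ^+ 2 + enorm dJ ^+ 2)
    + a ^+ 2 * dN ^+ 2 / 8
    - a ^+ 2 * (al ^+ 2 + 16 * th ^+ 2 * q ^+ 3 * enorm be ^+ 2
                + 100 * th ^+ 2 * (1 + q) ^+ 2 * D ^+ 2))
  <= g' - g - a * (g * dN).
Proof.
have q'E : q' = q + 2 * (inner v be + inner v dJ) + D.
  by rewrite /q' /q /D -(addrA v be dJ) (enormD_sqr v (be + dJ)) (innerDr v be dJ).
rewrite /g' q'E => a0 th0 D1 h.
apply: exp_increment_scalar => //.
- exact: sqr_ge0.
- by rewrite D1 sqr_ge0.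
- by rewrite -innerDr; exact: cauchy_schwarz_sqr.
- exact: cauchy_schwarz_sqr.
- by rewrite mulrDr; exact: enorm_add_sqr.
Qed.

End one_step.

(** * The drift of the exponent at one instant *)

Section pointwise.
Context {R : realType} {n : nat}.

Lemma quartic_lower_bound (A B D : R) : 0 < A -> 0 <= B -> 0 <= D ->
  exists2 C : R, 0 <= C &
    forall p, 0 <= p -> - C <= A * p ^+ 4 - B * p ^+ 3 - D * (1 + p ^+ 2).
Proof.
(* Beyond p0 one has p >= 1 and A p >= B + 2 D, so A p^4 >= (B + 2 D) p^3 and the expression is
   nonnegative; below p0 its negative part is bounded. *)
move=> A0 B0 D0; pose p0 := 1 + (B + 2 * D) / A.
have F0 : 0 <= (B + 2 * D) / A by apply: divr_ge0; [lra|exact: ltW].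
have p1 : 1 <= p0 by rewrite lerDl.
have p00 : 0 <= p0 by lra.
exists (B * p0 ^+ 3 + D * (1 + p0 ^+ 2)).
  by rewrite addr_ge0 ?mulr_ge0 ?exprn_ge0// addr_ge0// exprn_ge0.
move=> p p_ge0; have [pp|pp] := leP p p0.
  have h3 : B * p ^+ 3 <= B * p0 ^+ 3.
    by rewrite ler_wpM2l// lerXn2r// nnegrE.
  have h2 : D * (1 + p ^+ 2) <= D * (1 + p0 ^+ 2).
    by rewrite ler_wpM2l// lerD2l lerXn2r// nnegrE.
  have h4 : 0 <= A * p ^+ 4 by rewrite mulr_ge0 ?exprn_ge0// ltW.
  lra.
have p2 : 1 <= p by rewrite ltW// (le_lt_trans p1).
have Ap : B + 2 * D <= A * p.
  rewrite -ler_pdivrMl// mulrC; apply: le_trans (ltW pp).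
  by rewrite lerDr.
have p3 : 0 <= p ^+ 3 by rewrite exprn_ge0.
have h : (B + 2 * D) * p ^+ 3 <= A * p ^+ 4.
  have -> : A * p ^+ 4 = A * p * p ^+ 3 by ring.
  exact: ler_wpM2r.
have e1 : 1 <= p ^+ 3 by rewrite exprn_ege1.
have e2 : p ^+ 2 <= p ^+ 3 by rewrite [leRHS]exprS ler_peMl// exprn_ge0.
have h1 : D * (1 + p ^+ 2) <= D * (p ^+ 3 + p ^+ 3) by rewrite ler_wpM2l// lerD.
have C0 : 0 <= B * p0 ^+ 3 + D * (1 + p0 ^+ 2).
  by rewrite addr_ge0 ?mulr_ge0 ?exprn_ge0// addr_ge0// exprn_ge0.
lra.
Qed.

Variables (a th lt kap M sg eta K1 C : R).
Hypotheses (a0 : 0 < a) (th0 : 0 <= th) (M0 : 0 <= M) (sg0 : 0 <= sg).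
(** Here p is |v|. The quartic term comes from dissipativity, the cubic one from the rest of the
    drift (K1) and from the passage between zeta and u (M sg), the last one from the second order
    part of the penalty. A factor a theta has been divided out, so that C depends on neither. *)
Hypothesis quartic : forall p, 0 <= p ->
  - C <= 4 * eta * p ^+ 4 - (4 * K1 + 4 * M * sg) * p ^+ 3 - 80 * sg ^+ 2 * (1 + p ^+ 2).
Hypothesis kapE : kap <= a * lt - a * th * C - 4 * M ^+ 2.

(** The driver is bounded through |zeta| <= |u| + 4 theta |v|^3 sg + errors. The part a M |u| is
    absorbed by a^2 |u|^2 / 16 + 4 M^2, and the cubic part enters [quartic]. The term 40 a theta (1
    + q) |s|^2 is set aside to compensate the second order part of the penalty in [step_bound]. *)
Lemma drift_pointwise (v fv fs : 'cV[R]_n) (s sigma : 'M[R]_n) (z zeta : 'rV[R]_n)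
  (gs om e1 Q : R) (q := enorm v ^+ 2) (u := z + (- (4 * th * q)) *: v^T *m s)
  (E := enorm (s - sigma) ^+ 2 + enorm (z - zeta) ^+ 2)
  (Cw := a * M * (1 + 4 * th * Q ^+ 2) + 80 * a * th * Q + 4 * a * th * Q ^+ 2) :
  gs <= M * enorm zeta -> enorm sigma <= sg ->
  inner v fv <= - eta * q + K1 * enorm v ->
  enorm (fs - fv) <= om -> 0 < e1 <= 1 -> 1 + q <= Q ->
  kap + 40 * a * th * (1 + q) * enorm s ^+ 2 - a ^+ 2 / 16 * enorm u ^+ 2
    - Cw * (e1 + e1^-1 * E + om) <= a * (lt - gs) - 4 * a * th * q * inner v fs.
Proof.
move=> gsM sgM vfv fom /andP[e10 e11] qQ.
set p := enorm v; have p0 : 0 <= p := enorm_ge0 v.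
have q0 : 0 <= q := sqr_ge0 _.
have om0 : 0 <= om := le_trans (enorm_ge0 _) fom.
set t := enorm (s - sigma) in E *; set k := enorm (z - zeta) in E *.
have t0 : 0 <= t := enorm_ge0 _; have k0 : 0 <= k := enorm_ge0 _.
have E0 : 0 <= E by rewrite addr_ge0 ?sqr_ge0.
(* The L2 approximation controls squared errors only; this converts the linear ones. The factor 1 /
   e1 is harmless, since the integral of E will be at most e1^2. *)
have young x y : 0 <= x -> x ^+ 2 <= y -> x <= e1 + e1^-1 * y.
  move=> x0 xy; have h : e1^-1 * x ^+ 2 <= e1^-1 * y by rewrite ler_pM2l// invr_gt0.
  apply: le_trans (_ : e1 + e1^-1 * x ^+ 2 <= _); last by rewrite lerD2l.
  have -> : e1 + e1^-1 * x ^+ 2 = x + ((e1 - x / 2) ^+ 2 / e1 + 3 / 4 * (x ^+ 2 / e1)).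
    by field; rewrite gt_eqF.
  rewrite lerDl; apply: addr_ge0; first by rewrite divr_ge0 ?sqr_ge0// ltW.
  by rewrite mulr_ge0// divr_ge0 ?sqr_ge0// ltW.
set Y := e1 + e1^-1 * E in young *.
have Y0 : 0 <= Y by apply: addr_ge0; [exact: ltW|rewrite mulr_ge0 ?invr_ge0// ltW].
have kY : k <= Y by apply: young => //; rewrite lerDr sqr_ge0.
have tY : t <= Y by apply: young => //; rewrite lerDl sqr_ge0.
have tY2 : t ^+ 2 <= Y.
  apply: (@le_trans _ _ (e1^-1 * E)); last by rewrite lerDr ltW.
  apply: (@le_trans _ _ E); first by rewrite lerDl sqr_ge0.
  by rewrite ler_peMl// invf_ge1.
have pq : p <= 1 + q by have := sqr_ge0 (p - 1); rewrite /q -/p; nra.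
have pQ : q * p <= Q ^+ 2.
  by rewrite expr2; apply: ler_pM => //; lra.
have r_norm m (A : 'M[R]_(n, m)) :
    enorm ((- (4 * th * q)) *: v^T *m A) <= 4 * th * (q * p) * enorm A.
  rewrite (le_trans (enorm_mul _ _))// enormZ enorm_trmx normrN ger0_norm.
    by rewrite -/p mulrA.
  by rewrite !mulr_ge0.
have zetaE : zeta = u + (- ((- (4 * th * q)) *: v^T *m sigma)) +
    (- (z - zeta)) + (- ((- (4 * th * q)) *: v^T *m (s - sigma))).
  by rewrite /u mulmxBr; apply/matrixP => i j; rewrite !mxE; ring.
have th40 : 0 <= 4 * th * (q * p) by rewrite !mulr_ge0.
have zeta_le : enorm zeta <= enorm u + 4 * th * (q * p) * sg + k
    + 4 * th * (q * p) * t.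
  rewrite {1}zetaE; apply: le_trans (enorm_triangle _ _) _; apply: lerD; last first.
    by rewrite enormN; exact: r_norm.
  apply: le_trans (enorm_triangle _ _) _; apply: lerD; last by rewrite enormN.
  apply: le_trans (enorm_triangle _ _) _; apply: lerD => //.
  rewrite enormN (le_trans (r_norm _ _))//; exact: ler_wpM2l.
have s_le : enorm s ^+ 2 <= 2 * sg ^+ 2 + 2 * t ^+ 2.
  rewrite -[s](subrK sigma) addrC (le_trans (enorm_add_sqr _ _))// lerD2r ler_pM2l//.
  by rewrite lerXn2r ?nnegrE ?enorm_ge0.
have inner_le : inner v fs <= - eta * q + K1 * p + p * om.
  rewrite -[fs](subrK fv) innerDr addrC lerD// (le_trans (ler_norm _))//.
  by rewrite (le_trans (cauchy_schwarz _ _))// ler_wpM2l.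
have qt := quartic p0.
have u_le : a * M * enorm u <= a ^+ 2 / 16 * enorm u ^+ 2 + 4 * M ^+ 2.
  have -> : a ^+ 2 / 16 * enorm u ^+ 2 + 4 * M ^+ 2 =
    a * M * enorm u + (a / 4 * enorm u - 2 * M) ^+ 2 by field.
  by rewrite lerDl sqr_ge0.
have aM : 0 <= a * M by rewrite mulr_ge0// ltW.
have ath : 0 <= a * th by rewrite mulr_ge0// ltW.
have G : a * gs <= a * M * (enorm u + 4 * th * (q * p) * sg + k + 4 * th * (q * p) * t).
  rewrite -mulrA ler_pM2l//; apply: le_trans gsM _; exact: ler_wpM2l.
have F : 4 * a * th * q * inner v fs <=
    4 * (a * th) * q * (- eta * q + K1 * p + p * om).
  rewrite [4 * a * th * q](_ : _ = 4 * (a * th) * q); last by ring.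
  by apply: ler_wpM2l => //; apply: mulr_ge0 => //; exact: mulr_ge0.
have q1 : 0 <= 1 + q by lra.
have S : 40 * a * th * (1 + q) * enorm s ^+ 2 <=
    40 * (a * th) * (1 + q) * (2 * sg ^+ 2 + 2 * t ^+ 2).
  rewrite -(mulrA 40 a); apply: ler_wpM2l => //; apply: mulr_ge0 => //.
  exact: mulr_ge0.
have err1 : a * M * k <= a * M * Y by exact: ler_wpM2l.
have err2 : a * M * (4 * th * (q * p) * t) <= a * M * (4 * th * Q ^+ 2 * Y).
  apply: ler_wpM2l => //; apply: ler_pM => //.
  by apply: ler_wpM2l => //; exact: mulr_ge0.
have err3 : 80 * (a * th) * (1 + q) * t ^+ 2 <= 80 * (a * th) * Q * Y.
  apply: ler_pM => //; [|exact: sqr_ge0|].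
    by apply: mulr_ge0 => //; exact: mulr_ge0.
  by apply: ler_wpM2l => //; exact: mulr_ge0.
have err4 : 4 * (a * th) * (q * p) * om <= 4 * (a * th) * Q ^+ 2 * om.
  by apply: ler_wpM2r => //; apply: ler_wpM2l => //; exact: mulr_ge0.
have Cw_ge : a * M * Y + a * M * (4 * th * Q ^+ 2 * Y) + 80 * (a * th) * Q * Y
    + 4 * (a * th) * Q ^+ 2 * om <= Cw * (Y + om).
  have Q0 : 0 <= Q by lra.
  have t1 : 0 <= a * M * om by rewrite mulr_ge0.
  have t2 : 0 <= a * M * (4 * th * Q ^+ 2 * om).
    by apply: mulr_ge0 => //; rewrite !mulr_ge0// sqr_ge0.
  have t3 : 0 <= 80 * (a * th) * Q * om.
    by do 2 (apply: mulr_ge0 => //); exact: mulr_ge0.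
  have t4 : 0 <= 4 * (a * th) * Q ^+ 2 * Y.
    by apply: mulr_ge0 => //; apply: mulr_ge0; [exact: mulr_ge0|exact: sqr_ge0].
  rewrite /Cw -subr_ge0; rewrite (_ : _ - _ = a * M * om +
    a * M * (4 * th * Q ^+ 2 * om) + 80 * (a * th) * Q * om +
    4 * (a * th) * Q ^+ 2 * Y); last by ring.
  by rewrite !addr_ge0.
have qt' : - (a * th * C) <= a * th * (4 * eta * p ^+ 4
    - (4 * K1 + 4 * M * sg) * p ^+ 3 - 80 * sg ^+ 2 * (1 + p ^+ 2)).
  by rewrite -mulrN; exact: ler_wpM2l.
have qpE : q = p ^+ 2 by [].
set L := a * th * (4 * eta * _ - _ - _) in qt'.
have LE : L = - 4 * (a * th) * q * (- eta * q + K1 * p)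
    - a * M * (4 * th * (q * p) * sg) - 80 * (a * th) * (1 + q) * sg ^+ 2.
  by rewrite /L qpE; ring.
have main : kap <= a * lt + L - 4 * M ^+ 2.
  by apply: le_trans kapE _; rewrite lerD2r lerD2l.
rewrite (mulrBr a); clear -main LE Cw_ge err1 err2 err3 err4 S F G u_le.
lra.
Qed.

End pointwise.

Section step_bound.
Context {R : realType} {n : nat}.

Local Ltac pos := repeat first [done | exact: sqr_ge0 | apply: mulr_ge0
  | apply: addr_ge0 | apply: divr_ge0 | apply: exprn_ge0 | exact: ltW].

(** Each second order term in dW is paired with its compensator, which makes the first two lines
    quadratic variation defects: their summands are not small individually, only their sums are. The
    other errors have a sign. *)
Lemma step_bound (a th kap Q B Cw e1 y al dz Delta ee rhoz : R)
  (v be dJ dW rho : 'cV[R]_n) (s : 'M[R]_n) (z : 'rV[R]_n)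
  (q := enorm v ^+ 2) (q' := enorm (v + be + dJ) ^+ 2)
  (D := enorm (be + dJ) ^+ 2)
  (g := expR (a * (y - th * q ^+ 2)))
  (g' := expR (a * (y + al + dz - th * q' ^+ 2)))
  (dN := dz - 4 * th * q * inner v dJ)
  (u := z + (- (4 * th * q)) *: v^T *m s) :
  0 < a -> 0 <= th -> 0 <= Cw -> 0 < e1 <= 1 -> D <= e1 ^+ 2 ->
  1 + q <= Q -> g <= B -> 0 <= Delta -> 0 <= ee ->
  -2 <= a * (y + al + dz - th * q' ^+ 2 - (y - th * q ^+ 2)) ->
  dJ = s *m dW + rho -> dz = (z *m dW) 0 0 + rhoz ->
  (kap + 40 * a * th * (1 + q) * enorm s ^+ 2 - a ^+ 2 / 16 * enorm u ^+ 2
    - Cw * (2 * e1)) * Delta - Cw * e1^-1 * ee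
   <= a * al - 4 * a * th * q * inner v be ->
  40 * a * th * (g * (1 + q) * enorm s ^+ 2 * Delta
                 - g * (1 + q) * enorm (s *m dW) ^+ 2)
  + a ^+ 2 / 16 * (g * (u *m dW) 0 0 ^+ 2 - g * enorm u ^+ 2 * Delta)
  - B * (Cw * 2 * e1 * Delta + Cw * e1^-1 * ee
         + (20 * a * th * Q + 16 * a ^+ 2 * th ^+ 2 * Q ^+ 3) * enorm be ^+ 2
         + (40 * a * th * Q + 4 * a ^+ 2 * th ^+ 2 * Q ^+ 3) * enorm rho ^+ 2
         + a ^+ 2 * rhoz ^+ 2 + a ^+ 2 * al ^+ 2)
  - 100 * a ^+ 2 * th ^+ 2 * Q ^+ 2 * e1 ^+ 2 * (g * D)
  <= g' - g - a * (g * dN) - kap * (g * Delta).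
Proof.
move=> a0 th0 Cw0 /andP[e10 e11] De qQ gB Del0 ee0 h2 dJE dzE drift.
have e12 : e1 ^+ 2 <= 1 by rewrite exprn_ile1// ltW.
have := exp_increment a0 th0 (le_trans De e12) h2.
rewrite -/q -/q' -/D -/g -/g' -/dN => step.
have q0 : 0 <= q := sqr_ge0 _; have Q0 : 0 <= Q by lra.
have qQ' : q <= Q by lra.
have g0 : 0 <= g := expR_ge0 _; have D0 : 0 <= D := sqr_ge0 _.
set b2 := enorm be ^+ 2 in step *; have b0 : 0 <= b2 := sqr_ge0 _.
set r2 := enorm rho ^+ 2 in step *; have r0 : 0 <= r2 := sqr_ge0 _.
set w2 := enorm (s *m dW) ^+ 2; set x := (u *m dW) 0 0.
set j2 := enorm dJ ^+ 2 in step.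
have jw : j2 <= 2 * w2 + 2 * r2 by rewrite /j2 dJE; exact: enorm_add_sqr.
have q3 : q ^+ 3 <= Q ^+ 3 by rewrite lerXn2r.
have q30 : 0 <= q ^+ 3 by rewrite exprn_ge0.
have dNE : dN = x + (rhoz - 4 * th * q * inner v rho).
  have xE : x = (z *m dW) 0 0 - 4 * th * q * inner v (s *m dW).
    rewrite /x /u mulmxDl -!scalemxAl -mulmxA [LHS]mxE [X in _ + X]mxE.
    by rewrite mul_trmx_inner mulNr.
  by rewrite /dN dJE innerDr dzE xE; ring.
have inner_sqr : inner v rho ^+ 2 <= q * r2 by exact: cauchy_schwarz_sqr.
(* From (x + r)^2 >= x^2 / 2 - r^2 with r = rhoz - 4 th q (v, rho); the factor 1 / 2 turns the a^2 /
   8 of [exp_increment] into a^2 / 16. *)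
have dN2 : x ^+ 2 / 2 - 2 * rhoz ^+ 2 - 32 * th ^+ 2 * Q ^+ 3 * r2 <= dN ^+ 2.
  have h : 16 * th ^+ 2 * q ^+ 2 * inner v rho ^+ 2 <= 16 * th ^+ 2 * Q ^+ 3 * r2.
    apply: (@le_trans _ _ (16 * th ^+ 2 * q ^+ 2 * (q * r2))).
      by apply: ler_wpM2l; pos.
    have -> : 16 * th ^+ 2 * q ^+ 2 * (q * r2) = 16 * th ^+ 2 * q ^+ 3 * r2 by ring.
    by apply: ler_wpM2r; pos; apply: ler_wpM2l; pos.
  rewrite dNE; set t := 4 * th * q * inner v rho.
  have tE : t ^+ 2 = 16 * th ^+ 2 * q ^+ 2 * inner v rho ^+ 2 by rewrite /t; ring.
  have := sqr_ge0 (x / 2 + (rhoz - t)); have := sqr_ge0 (rhoz + t).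
  have := sqr_ge0 x; lra.
have ath : 0 <= a * th by rewrite mulr_ge0// ltW.
have a2 : 0 <= a ^+ 2 := sqr_ge0 _.
have th2 : 0 <= th ^+ 2 := sqr_ge0 _.
have D2 : D ^+ 2 <= e1 ^+ 2 * D by rewrite expr2 ler_wpM2r.
have Q2 : (1 + q) ^+ 2 <= Q ^+ 2 by rewrite lerXn2r// nnegrE; lra.
pose inside := (kap + 40 * a * th * (1 + q) * enorm s ^+ 2
    - a ^+ 2 / 16 * enorm u ^+ 2 - Cw * (2 * e1)) * Delta - Cw * e1^-1 * ee
  - 20 * a * th * Q * b2 - 40 * a * th * (1 + q) * w2 - 40 * a * th * Q * r2
  + a ^+ 2 / 16 * x ^+ 2 - a ^+ 2 / 4 * rhoz ^+ 2
  - 4 * a ^+ 2 * th ^+ 2 * Q ^+ 3 * r2 - a ^+ 2 * al ^+ 2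
  - 16 * a ^+ 2 * th ^+ 2 * Q ^+ 3 * b2
  - 100 * a ^+ 2 * th ^+ 2 * Q ^+ 2 * (e1 ^+ 2 * D).
have step2 : g * inside <= g' - g - a * (g * dN).
  apply: le_trans step; apply: ler_wpM2l => //.
  have t1 : 20 * a * th * (1 + q) * (b2 + j2) <= 20 * a * th * Q * b2
      + 40 * a * th * (1 + q) * w2 + 40 * a * th * Q * r2.
    have h3 : (1 + q) * (b2 + j2) <= Q * b2 + 2 * ((1 + q) * w2) + 2 * (Q * r2).
      have h4 : (1 + q) * b2 <= Q * b2 by exact: ler_wpM2r.
      have h5 : (1 + q) * r2 <= Q * r2 by exact: ler_wpM2r.
      have h6 : (1 + q) * j2 <= (1 + q) * (2 * w2 + 2 * r2).
        by apply: ler_wpM2l => //; lra.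
      lra.
    have := ler_wpM2l ath h3; lra.
  have t2 : a ^+ 2 / 8 * (x ^+ 2 / 2 - 2 * rhoz ^+ 2 - 32 * th ^+ 2 * Q ^+ 3 * r2)
      <= a ^+ 2 / 8 * dN ^+ 2.
    by apply: ler_wpM2l; pos.
  have t3 : a ^+ 2 * (16 * th ^+ 2 * q ^+ 3 * b2) <= a ^+ 2 * (16 * th ^+ 2 * Q ^+ 3 * b2).
    by apply: ler_wpM2l; pos; apply: ler_wpM2r; pos; apply: ler_wpM2l; pos.
  have t4 : a ^+ 2 * (100 * th ^+ 2 * (1 + q) ^+ 2 * D ^+ 2) <=
      a ^+ 2 * (100 * th ^+ 2 * Q ^+ 2 * (e1 ^+ 2 * D)).
    by apply: ler_wpM2l; pos; apply: ler_pM; pos; apply: ler_wpM2l; pos.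
  rewrite /inside; clear -drift t1 t2 t3 t4; lra.
(* [N] is nonnegative, so its factor g may be replaced by B; the defects have no sign and keep g. *)
set N := Cw * 2 * e1 * Delta + Cw * e1^-1 * ee + _ + _ + _ + _.
have e1V : 0 <= e1^-1 by rewrite invr_ge0 ltW.
have N0 : 0 <= N by rewrite /N; pos.
have gN : g * N <= B * N by exact: ler_wpM2r.
have rz : 0 <= g * (a ^+ 2 * rhoz ^+ 2) by pos.
have E : g * inside = kap * (g * Delta)
  + 40 * a * th * (g * (1 + q) * enorm s ^+ 2 * Delta - g * (1 + q) * w2)
  + a ^+ 2 / 16 * (g * x ^+ 2 - g * enorm u ^+ 2 * Delta)
  - g * N + 3 / 4 * (g * (a ^+ 2 * rhoz ^+ 2))
  - 100 * a ^+ 2 * th ^+ 2 * Q ^+ 2 * e1 ^+ 2 * (g * D).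
  by rewrite /inside /N; field; rewrite gt_eqF.
rewrite -/N in gN *; clear -step2 E gN rz; lra.
Qed.

End step_bound.

(** * Integrals over subintervals of [0, T] *)

Section interval_integral.
Context {R : realType}.
Local Notation mu := (@lebesgue_measure R).
Variable T : R.

Definition Itg (f : R -> R) (s t : R) : R := \int[mu]_(x in `[s, t]) f x.

Definition integrable_upto (f : R -> R) : Prop := mu.-integrable `[0, T] (EFin \o f).

Section sub.
Variables (s t : R).
Hypotheses (s0 : 0 <= s) (st : s <= t) (tT : t <= T).

Let integrable_sub f (b1 b2 : bool) : integrable_upto f ->
  mu.-integrable [set` Interval (BSide b1 s) (BSide b2 t)] (EFin \o f).
Proof.
apply: integrableS => // x /=; rewrite !in_itv/= => /andP[h1 h2].
have h3 : s <= x by case: b1 h1 => // /ltW.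
have h4 : x <= t by case: b2 h2 => // /ltW.
by rewrite (le_trans s0 h3) (le_trans h4 tT).
Qed.

(** A simple process agrees with its step value only on a cell open on the left, so integrands are
    compared on ]s, t]. *)
Lemma Itg_oc f : integrable_upto f -> Itg f s t = \int[mu]_(x in `]s, t]) f x.
Proof.
move=> fi; rewrite /Itg -Rintegral_itv_obnd_cbnd//; exact: integrable_sub.
Qed.

Lemma Itg_le f g : integrable_upto f -> integrable_upto g ->
  (forall x, s < x <= t -> f x <= g x) -> Itg f s t <= Itg g s t.
Proof.
move=> fi gi fg; rewrite !Itg_oc//; apply: le_Rintegral => //.
all: by [exact: integrable_sub|move=> x /=; exact: fg].
Qed.

Lemma Itg_norm f : integrable_upto f -> `|Itg f s t| <= Itg (fun x => `|f x|) s t.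
Proof. by move=> fi; apply: le_normr_Rintegral => //; exact: integrable_sub. Qed.

Lemma ItgD f g : integrable_upto f -> integrable_upto g ->
  Itg (fun x => f x + g x) s t = Itg f s t + Itg g s t.
Proof. by move=> fi gi; apply: RintegralD => //; exact: integrable_sub. Qed.

Lemma ItgB f g : integrable_upto f -> integrable_upto g ->
  Itg (fun x => f x - g x) s t = Itg f s t - Itg g s t.
Proof. by move=> fi gi; apply: RintegralB => //; exact: integrable_sub. Qed.

Lemma ItgZ c f : integrable_upto f -> Itg (fun x => c * f x) s t = c * Itg f s t.
Proof. by move=> fi; apply: RintegralZl => //; exact: integrable_sub. Qed.

Lemma Itg_cst c : Itg (fun=> c) s t = c * (t - s).
Proof.
rewrite /Itg Rintegral_cst//= lebesgue_measure_itv/= lte_fin.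
have [_|ts] := ltP s t; first by rewrite -EFinB.
by rewrite (le_anti (_ : s <= t <= s)) ?subrr// st.
Qed.

End sub.

Lemma Itg_sub f s t : integrable_upto f -> 0 <= s -> s <= t -> t <= T ->
  Itg f s t = Itg f 0 t - Itg f 0 s.
Proof.
move=> fi s0 st tT; rewrite Itg_oc//.
rewrite /Itg Rintegral_itvB//.
apply: integrableS fi => // x /=; rewrite !in_itv/= => /andP[-> h].
exact: le_trans tT.
Qed.

Lemma integrable_uptoD f g : integrable_upto f -> integrable_upto g ->
  integrable_upto (fun x => f x + g x).
Proof. by move=> fi gi; apply: (integrableD _ fi gi). Qed.

Lemma integrable_uptoB f g : integrable_upto f -> integrable_upto g ->
  integrable_upto (fun x => f x - g x).
Proof. by move=> fi gi; apply: (integrableB _ fi gi). Qed.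

Lemma integrable_uptoZ c f : integrable_upto f -> integrable_upto (fun x => c * f x).
Proof. by move=> fi; apply: (integrableZl _ c fi). Qed.

Lemma integrable_upto_norm f : integrable_upto f -> integrable_upto (fun x => `|f x|).
Proof. exact: integrable_norm. Qed.

Lemma integrable_upto_cst c : integrable_upto (fun=> c).
Proof.
apply: measurable_bounded_integrable => //; last first.
  by exists `|c|; split; [exact: num_real|move=> x hx y _ /=; exact: ltW].
by rewrite /= lebesgue_measure_itv/=; case: ifP; rewrite ?ltry// -EFinB ltry.
Qed.

Lemma integrable_upto_le (f g : R -> R) : measurable_fun `[0, T] f ->
  (forall x, 0 <= x <= T -> `|f x| <= g x) -> integrable_upto g -> integrable_upto f.
Proof.
move=> mf fg; apply: le_integrable => //; first exact/measurable_EFinP.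
move=> x /=; rewrite in_itv/= lee_fin => /fg h.
by rewrite (le_trans h)// ler_norm.
Qed.

Lemma integrable_upto_sum I (r : seq I) (f : I -> R -> R) :
  (forall i, integrable_upto (f i)) ->
  integrable_upto (fun x => \sum_(i <- r) f i x).
Proof.
move=> fi; elim: r => [|i r IH].
  by under eq_fun do rewrite big_nil; exact: integrable_upto_cst.
by under eq_fun do rewrite big_cons; exact: integrable_uptoD.
Qed.

Lemma Itg_sum I (r : seq I) (f : I -> R -> R) s t : 0 <= s -> s <= t -> t <= T ->
  (forall i, integrable_upto (f i)) ->
  Itg (fun x => \sum_(i <- r) f i x) s t = \sum_(i <- r) Itg (f i) s t.
Proof.
move=> s0 st tT fi; elim: r => [|i r IH].
  by under eq_fun do rewrite big_nil; rewrite big_nil Itg_cst// mul0r.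
under eq_fun do rewrite big_cons; rewrite big_cons ItgD ?IH//.
exact: integrable_upto_sum.
Qed.

Lemma Itg_partition f pts h K tt : partition_of T pts h K tt -> integrable_upto f ->
  \sum_(i < K) Itg f (tt i) (tt i.+1) = Itg f 0 T.
Proof.
move=> ptt fi; have tt0 := part_ge0 ptt.
under eq_bigr => i _ do rewrite (Itg_sub fi (tt0 i) (part_mono ptt i) (part_le ptt i.+1)).
rewrite -(big_mkord xpredT (fun i => Itg f 0 (tt i.+1) - Itg f 0 (tt i))).
rewrite telescope_sumr// (part_start ptt) (part_end ptt).
by rewrite [X in _ - X](_ : _ = 0) ?subr0// /Itg set_itv1 Rintegral_set1.
Qed.

End interval_integral.

(** Coefficient of e1 in the total error of [pathwise_fixed]. It depends on the path through Q, B,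
    Kf and AZ, but neither on e1 nor on the partition. *)
Definition pathwise_const {R : realType} (n : nat) (T a th lt M sg Q B Kf AZ : R) : R :=
  let Cw := a * M * (1 + 4 * th * Q ^+ 2) + 80 * a * th * Q + 4 * a * th * Q ^+ 2 in
  let cb := 20 * a * th * Q + 16 * a ^+ 2 * th ^+ 2 * Q ^+ 3 in
  let cr := 40 * a * th * Q + 4 * a ^+ 2 * th ^+ 2 * Q ^+ 3 in
  let Al := `|lt| + M + M * AZ in
  let Al' := (`|lt| + M) * T + M * AZ in
  let Kb := (n * 1)%:R * Kf ^+ 2 * T in
  40 * a * th + a ^+ 2 / 16
  + B * (Cw * 2 * T + Cw + cb * Kb + cr + a ^+ 2 + a ^+ 2 * (Al * Al'))
  + 100 * a ^+ 2 * th ^+ 2 * Q ^+ 2 *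
    (2 * B * Kb + 4 * (1 + B * Q * (2 * sg ^+ 2 * T + 2)) + 4 * B).

(** * The pathwise inequality along a partition *)

(* [v], [jv], [fs] are a path of the diffusion, of its martingale part and of its drift;
   [y], [jz], [gs], [zeta] are the paths of [Y - Y'], of its martingale part, of the
   difference of the drivers and of [Z - Z'].  The errors [e1 ^+ 2] come from replacing
   [sigma] and [zeta] by step processes [sS] and [zS]. *)
Section pathwise.
Context {R : realType} {n : nat}.
Variables (T a th kap lt M sg eta K1 C0 Q B Kf AZ : R).
Variables (v fs jv : R -> 'cV[R]_n) (y gs jz : R -> R) (sigma : R -> 'M[R]_n)
  (zeta : R -> 'rV[R]_n).
Hypotheses (T0 : 0 <= T) (a0 : 0 < a) (th0 : 0 <= th) (M0 : 0 <= M) (sg0 : 0 <= sg).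
Hypothesis quartic : forall p, 0 <= p ->
  - C0 <= 4 * eta * p ^+ 4 - (4 * K1 + 4 * M * sg) * p ^+ 3 - 80 * sg ^+ 2 * (1 + p ^+ 2).
Hypothesis kapE : kap <= a * lt - a * th * C0 - 4 * M ^+ 2.
Hypothesis fs_int : forall j, integrable_upto T (fun s => fs s j 0).
Hypothesis gs_int : integrable_upto T gs.
Hypothesis zeta_int : integrable_upto T (fun s => enorm (zeta s) ^+ 2).
Hypothesis zetaAZ : Itg (fun s => enorm (zeta s) ^+ 2) 0 T <= AZ.
Hypothesis v_eq : forall s t, 0 <= s -> s <= t -> t <= T ->
  v t = v s + \col_j Itg (fun x => fs x j 0) s t + (jv t - jv s).
Hypothesis y_eq : forall s t, 0 <= s -> s <= t -> t <= T ->
  y t = y s + Itg (fun x => lt - gs x) s t + (jz t - jz s).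
Hypothesis gsM : forall s, 0 <= s <= T -> `|gs s| <= M * enorm (zeta s).
Hypothesis sigma_le : forall s, 0 <= s <= T -> enorm (sigma s) <= sg.
Hypothesis f_dissip : forall s, 0 <= s <= T ->
  inner (v s) (fs s) <= - eta * enorm (v s) ^+ 2 + K1 * enorm (v s).
Hypothesis vQ : forall s, 0 <= s <= T -> 1 + enorm (v s) ^+ 2 <= Q.
Hypothesis fK : forall s j, 0 <= s <= T -> `|fs s j 0| <= Kf.

Let g (s : R) : R := expR (a * (y s - th * (enorm (v s) ^+ 2) ^+ 2)).
Hypothesis gB : forall s, 0 <= s <= T -> g s <= B.

Let Cw : R := a * M * (1 + 4 * th * Q ^+ 2) + 80 * a * th * Q + 4 * a * th * Q ^+ 2.
Let cb : R := 20 * a * th * Q + 16 * a ^+ 2 * th ^+ 2 * Q ^+ 3.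
Let cr : R := 40 * a * th * Q + 4 * a ^+ 2 * th ^+ 2 * Q ^+ 3.
Let Al : R := `|lt| + M + M * AZ.
Let Al' : R := (`|lt| + M) * T + M * AZ.
Let Kb : R := (n * 1)%:R * Kf ^+ 2 * T.
Let Cp : R := pathwise_const n T a th lt M sg Q B Kf AZ.

Let Q1 : 1 <= Q.
Proof.
have := vQ (_ : 0 <= 0 <= T); rewrite lexx T0 => /(_ isT); apply: le_trans.
by rewrite lerDl sqr_ge0.
Qed.

Let B0 : 0 <= B.
Proof.
have := gB (_ : 0 <= 0 <= T); rewrite lexx T0 => /(_ isT); apply: le_trans.
exact: expR_ge0.
Qed.

Let AZ0 : 0 <= AZ.
Proof. by apply: le_trans zetaAZ; apply: Rintegral_ge0 => x _; exact: sqr_ge0. Qed.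

Local Ltac pos := repeat first [done | exact: sqr_ge0 | apply: mulr_ge0
  | apply: addr_ge0 | apply: divr_ge0 | apply: exprn_ge0 | exact: ltW].

Let Q0 : 0 <= Q. Proof. exact: le_trans Q1. Qed.
Let Cw0 : 0 <= Cw. Proof. by rewrite /Cw; pos. Qed.
Let cb0 : 0 <= cb. Proof. by rewrite /cb; pos. Qed.
Let cr0 : 0 <= cr. Proof. by rewrite /cr; pos. Qed.
Let Kb0 : 0 <= Kb. Proof. by rewrite /Kb; pos. Qed.

Section fixed_partition.
Variables (e1 h : R) (pts : seq R) (K : nat) (tt : nat -> R)
  (sS : nat -> 'M[R]_n) (zS : nat -> 'rV[R]_n) (dWv : nat -> 'cV[R]_n) (Ef : R -> R).
Hypotheses (e1_itv : 0 < e1 <= 1) (ptt : partition_of T pts h K tt) (he1 : h <= e1 ^+ 2).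
Hypothesis v_mod : forall i, enorm (v (tt i.+1) - v (tt i)) <= e1.
Hypothesis f_mod : forall i s, tt i < s <= tt i.+1 -> enorm (fs s - fs (tt i)) <= e1.
(** Keeps each increment of the exponent in the range of [expR_ge_quadratic]. *)
Hypothesis U_mod : forall i, -2 <= a * (y (tt i.+1) - th * (enorm (v (tt i.+1)) ^+ 2) ^+ 2
  - (y (tt i) - th * (enorm (v (tt i)) ^+ 2) ^+ 2)).
Hypothesis Ef_int : integrable_upto T Ef.
Hypothesis Ef0 : forall s, 0 <= Ef s.
Hypothesis Ef_le : Itg Ef 0 T <= e1 ^+ 2.
Hypothesis EfE : forall i s, (i < K)%N -> tt i < s <= tt i.+1 ->
  enorm (sS i - sigma s) ^+ 2 + enorm (zS i - zeta s) ^+ 2 <= Ef s.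

Let q i := enorm (v (tt i)) ^+ 2.
Let Delta i := tt i.+1 - tt i.
Let dJ i := jv (tt i.+1) - jv (tt i).
Let dz i := jz (tt i.+1) - jz (tt i).
Let rho i := dJ i - sS i *m dWv i.
Let rhoz i := dz i - (zS i *m dWv i) 0 0.
Let u i := zS i + (- (4 * th * q i)) *: (v (tt i))^T *m sS i.
Let dN i := dz i - 4 * th * q i * inner (v (tt i)) (dJ i).

Hypothesis rho_le : \sum_(i < K) enorm (rho i) ^+ 2 <= e1 ^+ 2.
Hypothesis rhoz_le : \sum_(i < K) rhoz i ^+ 2 <= e1 ^+ 2.
Hypothesis qv1 : `|\sum_(i < K) (g (tt i) * (u i *m dWv i) 0 0 ^+ 2
   - g (tt i) * enorm (u i) ^+ 2 * Delta i)| <= e1 ^+ 2.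
Hypothesis qv2 : `|\sum_(i < K) (g (tt i) * (1 + q i) * enorm (sS i *m dWv i) ^+ 2
   - g (tt i) * (1 + q i) * enorm (sS i) ^+ 2 * Delta i)| <= e1 ^+ 2.

Let al i := Itg (fun x => lt - gs x) (tt i) (tt i.+1).
Let be i : 'cV[R]_n := \col_j Itg (fun x => fs x j 0) (tt i) (tt i.+1).
Let ee i := Itg Ef (tt i) (tt i.+1).
Let zz i := Itg (fun s => enorm (zeta s) ^+ 2) (tt i) (tt i.+1).

Let e1p : 0 < e1. Proof. by case/andP: e1_itv. Qed.
Let e1le : e1 <= 1. Proof. by case/andP: e1_itv. Qed.
Let e1sq : e1 ^+ 2 <= e1. Proof. by rewrite expr2 ler_piMl// ltW. Qed.
Let tt0 := part_ge0 ptt.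
Let ttm := part_mono ptt.
Let ttT := part_le ptt.
Let ttI i : 0 <= tt i <= T. Proof. by rewrite tt0 ttT. Qed.
Let Delta0 i : 0 <= Delta i. Proof. by rewrite subr_ge0. Qed.
Let Delta_le i : Delta i <= e1 ^+ 2. Proof. exact: le_trans (part_mesh ptt i) he1. Qed.
Let in_T i s : tt i < s <= tt i.+1 -> 0 <= s <= T.
Proof. by move=> /andP[h1 h2]; rewrite (le_trans (tt0 i) (ltW h1)) (le_trans h2 (ttT i.+1)). Qed.
Let sum_Delta : \sum_(i < K) Delta i = T.
Proof.
rewrite -(big_mkord xpredT (fun i => tt i.+1 - tt i)) telescope_sumr//.
by rewrite (part_start ptt) (part_end ptt) subr0.
Qed.

Let ee0 i : 0 <= ee i. Proof. by apply: Rintegral_ge0 => x _; exact: Ef0. Qed.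
Let zz0 i : 0 <= zz i. Proof. by apply: Rintegral_ge0 => x _; exact: sqr_ge0. Qed.
Let sum_ee : \sum_(i < K) ee i <= e1 ^+ 2.
Proof. by rewrite /ee (Itg_partition ptt Ef_int). Qed.
Let sum_zz : \sum_(i < K) zz i <= AZ.
Proof. by rewrite /zz (Itg_partition ptt zeta_int). Qed.
Let gi0 i : 0 <= g (tt i). Proof. exact: expR_ge0. Qed.
Let giB i : g (tt i) <= B. Proof. exact: gB. Qed.
Let qi0 i : 0 <= q i. Proof. exact: sqr_ge0. Qed.
Let qiQ i : 1 + q i <= Q. Proof. exact: vQ. Qed.

Let inner_be i (w : 'cV[R]_n) :
  inner w (be i) = Itg (fun x => inner w (fs x)) (tt i) (tt i.+1).
Proof.
have e (b : 'cV[R]_n) : inner w b = \sum_j w j 0 * b j 0.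
  by apply: eq_bigr => j _; rewrite big_ord1.
have -> : (fun x => inner w (fs x)) = (fun x => \sum_j w j 0 * fs x j 0).
  by apply/funext => x; exact: e.
rewrite e (Itg_sum _ (tt0 i) (ttm i) (ttT i.+1)); last first.
  by move=> j; exact: integrable_uptoZ.
apply: eq_bigr => j _; rewrite mxE.
by rewrite (ItgZ (tt0 i) (ttT i.+1)).
Qed.

(** Integral of [drift_pointwise] over one cell, where [u i] and [sS i] are constant and the drift
    oscillates by at most e1. *)
Let drift_step i : (i < K)%N ->
  (kap + 40 * a * th * (1 + q i) * enorm (sS i) ^+ 2 - a ^+ 2 / 16 * enorm (u i) ^+ 2
    - Cw * (2 * e1)) * Delta i - Cw * e1^-1 * ee i
   <= a * al i - 4 * a * th * q i * inner (v (tt i)) (be i).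
Proof.
move=> iK; rewrite inner_be; set c := kap + _ - _ - _.
have ltg : integrable_upto T (fun x => lt - gs x).
  by apply: integrable_uptoB => //; exact: integrable_upto_cst.
have iin : integrable_upto T (fun x => inner (v (tt i)) (fs x)).
  rewrite (_ : (fun x => _) = (fun x => \sum_j (v (tt i)) j 0 * fs x j 0)).
    by apply: integrable_upto_sum => j; exact: integrable_uptoZ.
  by apply/funext => x; apply: eq_bigr => j _; rewrite big_ord1.
have ia := integrable_uptoZ a ltg.
have ib := integrable_uptoZ (4 * a * th * q i) iin.
have ic := integrable_upto_cst T c.
have id := integrable_uptoZ (Cw * e1^-1) Ef_int.
have <- : Itg (fun x => a * (lt - gs x) - 4 * a * th * q i * inner (v (tt i)) (fs x))
    (tt i) (tt i.+1) = a * al i - 4 * a * th * q i *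
    Itg (fun x => inner (v (tt i)) (fs x)) (tt i) (tt i.+1).
  by rewrite (ItgB (tt0 i) (ttT i.+1) ia ib) !(ItgZ (tt0 i) (ttT i.+1)).
have <- : Itg (fun x => c - Cw * e1^-1 * Ef x) (tt i) (tt i.+1) =
    c * Delta i - Cw * e1^-1 * ee i.
  by rewrite (ItgB (tt0 i) (ttT i.+1) ic id) (ItgZ (tt0 i) (ttT i.+1))// (Itg_cst (ttm i)).
apply: (Itg_le (tt0 i) (ttT i.+1)); [exact: integrable_uptoB..|].
move=> x xi; have xT := in_T xi.
have := @drift_pointwise _ _ a th lt kap M sg eta K1 C0 a0 th0 M0 sg0 quartic kapE
  (v (tt i)) (fs (tt i)) (fs x) (sS i) (sigma x) (zS i) (zeta x) (gs x) e1 e1 Q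
  (le_trans (ler_norm _) (gsM xT)) (sigma_le xT) (f_dissip (ttI i))
  (f_mod xi) e1_itv (qiQ i).
rewrite -/Cw -/(q i) -/(u i).
apply: le_trans; rewrite /c.
have : e1^-1 * (enorm (sS i - sigma x) ^+ 2 + enorm (zS i - zeta x) ^+ 2)
    <= e1^-1 * Ef x by rewrite ler_pM2l ?invr_gt0//; exact: EfE.
move=> /(ler_wpM2l Cw0); set X := _ + enorm (zS i - zeta x) ^+ 2; lra.
Qed.

Let be_le i : enorm (be i) ^+ 2 <= e1 ^+ 2 * ((n * 1)%:R * Kf ^+ 2 * Delta i).
Proof.
have h1 j l : `|be i j l| <= Kf * Delta i.
  rewrite mxE; apply: le_trans (Itg_norm (tt0 i) (ttT i.+1) (fs_int j)) _.
  rewrite -(Itg_cst (ttm i)); apply: (Itg_le (tt0 i) (ttT i.+1)).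
  - exact: integrable_upto_norm.
  - exact: integrable_upto_cst.
  - by move=> x /in_T; exact: fK.
apply: le_trans (enorm_le_entries h1) _.
have -> : e1 ^+ 2 * ((n * 1)%:R * Kf ^+ 2 * Delta i) =
  (n * 1)%:R * (Kf ^+ 2 * (e1 ^+ 2 * Delta i)) by ring.
rewrite ler_wpM2l// exprMn ler_wpM2l ?sqr_ge0// expr2.
by rewrite ler_wpM2r.
Qed.

Let sum_be : \sum_(i < K) enorm (be i) ^+ 2 <= e1 ^+ 2 * Kb.
Proof.
apply: le_trans; first by apply: ler_sum => i _; exact: be_le.
by rewrite -mulr_sumr -mulr_sumr sum_Delta.
Qed.

(** The weight r is left free because [sum_al] uses two: r = e1 makes the largest |al i| of order
    e1, and r = 1 bounds the sum of all of them. *)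
Let al_bound i (r : R) : 0 < r ->
  `|al i| <= (`|lt| + M * r^-1) * Delta i + M * r * zz i.
Proof.
move=> r0; have ltg : integrable_upto T (fun x => lt - gs x).
  by apply: integrable_uptoB => //; exact: integrable_upto_cst.
apply: le_trans (Itg_norm (tt0 i) (ttT i.+1) ltg) _.
rewrite -(Itg_cst (ttm i)) -(ItgZ (tt0 i) (ttT i.+1))//.
have ii : integrable_upto T (fun x => M * r * enorm (zeta x) ^+ 2).
  exact: integrable_uptoZ.
rewrite -(ItgD (tt0 i) (ttT i.+1)) ?integrable_upto_cst//; last first.
  exact: integrable_upto_cst.
apply: (Itg_le (tt0 i) (ttT i.+1)).
- exact: integrable_upto_norm.
- by apply: integrable_uptoD => //; exact: integrable_upto_cst.
move=> x /in_T xT; apply: le_trans (ler_normB _ _) _; rewrite -addrA lerD2l.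
apply: le_trans (gsM xT) _.
have -> : M / r + M * r * enorm (zeta x) ^+ 2 = M * (r^-1 + r * enorm (zeta x) ^+ 2).
  by ring.
rewrite ler_wpM2l//; set k := enorm (zeta x).
have -> : r^-1 + r * k ^+ 2 = k + r * ((k - r^-1 / 2) ^+ 2 + 3 / 4 * r^-1 ^+ 2).
  by field; rewrite gt_eqF.
by rewrite lerDl; pos.
Qed.

Let sum_al : \sum_(i < K) al i ^+ 2 <= e1 * (Al * Al').
Proof.
have zzA i : (i < K)%N -> zz i <= AZ.
  move=> iK; apply: le_trans sum_zz; rewrite (bigD1 (Ordinal iK))//= lerDl.
  by apply: sumr_ge0.
have h1 i : (i < K)%N -> `|al i| <= e1 * Al.
  move=> iK; apply: le_trans (al_bound i e1p) _.
  have t1 : `|lt| * Delta i <= `|lt| * e1 by apply: ler_wpM2l => //; exact: le_trans e1sq.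
  have t2 : M / e1 * Delta i <= M * e1.
    rewrite -mulrA ler_wpM2l// mulrC ler_pdivrMr// -expr2; exact: Delta_le.
  have t3 : M * e1 * zz i <= M * e1 * AZ.
    by apply: ler_wpM2l; [pos|exact: zzA].
  rewrite /Al; lra.
have h2 : \sum_(i < K) `|al i| <= Al'.
  apply: le_trans; first by apply: ler_sum => i _; exact: (al_bound i ltr01).
  rewrite big_split/= -!mulr_sumr sum_Delta invr1 !mulr1 /Al' lerD2l.
  by rewrite ler_wpM2l.
apply: (@le_trans _ _ (\sum_(i < K) e1 * Al * `|al i|)).
  apply: ler_sum => i _; rewrite -(real_normK (num_real (al i))) expr2.
  by rewrite ler_wpM2r// h1.
rewrite -mulr_sumr -mulrA; apply: ler_wpM2l; first exact: ltW.
by apply: ler_wpM2l => //; rewrite /Al; pos.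
Qed.

Let D i := enorm (be i + dJ i) ^+ 2.

Let vS i : v (tt i.+1) = v (tt i) + be i + dJ i.
Proof. exact: v_eq. Qed.

Let yS i : y (tt i.+1) = y (tt i) + al i + dz i.
Proof. exact: y_eq. Qed.

Let D_le i : D i <= e1 ^+ 2.
Proof.
have := v_mod i; rewrite vS -(addrA (v (tt i))) addrAC subrr add0r => h1.
by rewrite /D lerXn2r ?nnegrE ?enorm_ge0// ltW.
Qed.

(** The step processes have no uniform bound, so |sS i|^2 is compared with sg^2 in the integral, up
    to [Ef]; then [qv2] carries the bound over to the realized variation. *)
Let sum_gs : \sum_(i < K) g (tt i) * (1 + q i) * enorm (sS i *m dWv i) ^+ 2 <=
  1 + B * Q * (2 * sg ^+ 2 * T + 2).
Proof.
have h1 i : (i < K)%N -> enorm (sS i) ^+ 2 * Delta i <= 2 * sg ^+ 2 * Delta i + 2 * ee i.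
  move=> iK; rewrite -!(Itg_cst (ttm i)) -(ItgZ (tt0 i) (ttT i.+1))//.
  rewrite -(ItgD (tt0 i) (ttT i.+1)); last exact: integrable_uptoZ; last first.
    exact: integrable_upto_cst.
  apply: (Itg_le (tt0 i) (ttT i.+1)).
  - exact: integrable_upto_cst.
  - by apply: integrable_uptoD; [exact: integrable_upto_cst|exact: integrable_uptoZ].
  move=> x xi; have := EfE iK xi; have := sigma_le (in_T xi) => s1 s2.
  have s3 : enorm (sigma x) ^+ 2 <= sg ^+ 2 by rewrite lerXn2r ?nnegrE ?enorm_ge0.
  have := enorm_add_sqr (sigma x) (sS i - sigma x); rewrite addrC subrK => s4.
  have := sqr_ge0 (enorm (zS i - zeta x)); lra.
have h2 : \sum_(i < K) g (tt i) * (1 + q i) * enorm (sS i) ^+ 2 * Delta i <=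
    B * Q * (2 * sg ^+ 2 * T + 2).
  apply: (@le_trans _ _ (\sum_(i < K) B * Q * (2 * sg ^+ 2 * Delta i + 2 * ee i))).
    apply: ler_sum => i _; rewrite -mulrA; apply: ler_pM.
    - by apply: mulr_ge0 => //; apply: addr_ge0.
    - by apply: mulr_ge0 => //; exact: sqr_ge0.
    - by apply: ler_pM => //; apply: addr_ge0.
    - exact: h1.
  rewrite -mulr_sumr; apply: ler_wpM2l; first by pos.
  rewrite big_split/= -!mulr_sumr sum_Delta lerD2l.
  by rewrite -[leRHS]mulr1 ler_wpM2l// (le_trans sum_ee)// (le_trans e1sq).
have := le_trans (ler_norm _) qv2; rewrite sumrB => h3.
have : e1 ^+ 2 <= 1 by apply: le_trans e1sq _.
lra.
Qed.

(** A bounded total suffices, since [step_bound] multiplies it by e1^2. *)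
Let sum_gD : \sum_(i < K) g (tt i) * D i <=
  2 * B * Kb + 4 * (1 + B * Q * (2 * sg ^+ 2 * T + 2)) + 4 * B.
Proof.
have h1 i : g (tt i) * D i <= 2 * B * enorm (be i) ^+ 2 +
    4 * (g (tt i) * (1 + q i) * enorm (sS i *m dWv i) ^+ 2) +
    4 * B * enorm (rho i) ^+ 2.
  set b2 := enorm (be i) ^+ 2; set r2 := enorm (rho i) ^+ 2.
  set w2 := enorm (sS i *m dWv i) ^+ 2.
  have D1 : D i <= 2 * b2 + 4 * w2 + 4 * r2.
    have t1 := enorm_add_sqr (be i) (dJ i).
    have := enorm_add_sqr (sS i *m dWv i) (rho i).
    rewrite /rho addrC subrK -/(rho i) => t2.
    rewrite /D; move: t1 t2; rewrite -/b2 -/r2 -/w2; lra.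
  have t3 := ler_wpM2l (gi0 i) D1.
  have t4 : g (tt i) * b2 <= B * b2 by apply: ler_wpM2r => //; exact: sqr_ge0.
  have t5 : g (tt i) * r2 <= B * r2 by apply: ler_wpM2r => //; exact: sqr_ge0.
  have t6 : g (tt i) * w2 <= g (tt i) * (1 + q i) * w2.
    rewrite -mulrA ler_wpM2l// ler_peMl ?sqr_ge0//.
    by rewrite lerDl.
  lra.
apply: le_trans; first by apply: ler_sum => i _; exact: h1.
rewrite !big_split/= -!mulr_sumr; apply: lerD; first apply: lerD.
- apply: ler_wpM2l; first by pos.
  by apply: le_trans sum_be _; rewrite ler_piMl// (le_trans e1sq).
- by apply: ler_wpM2l => //; exact: sum_gs.
- rewrite -[leRHS]mulr1; apply: ler_wpM2l; first by pos.
  by rewrite (le_trans rho_le)// (le_trans e1sq).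
Qed.

Lemma pathwise_fixed : \sum_(i < K) a * (g (tt i) * dN i) <=
  g T - g 0 - kap * (\sum_(i < K) g (tt i) * Delta i) + Cp * e1.
Proof.
have step i : (i < K)%N ->
  40 * a * th * (g (tt i) * (1 + q i) * enorm (sS i) ^+ 2 * Delta i
                 - g (tt i) * (1 + q i) * enorm (sS i *m dWv i) ^+ 2)
  + a ^+ 2 / 16 * (g (tt i) * (u i *m dWv i) 0 0 ^+ 2 - g (tt i) * enorm (u i) ^+ 2 * Delta i)
  - B * (Cw * 2 * e1 * Delta i + Cw * e1^-1 * ee i
         + cb * enorm (be i) ^+ 2 + cr * enorm (rho i) ^+ 2
         + a ^+ 2 * rhoz i ^+ 2 + a ^+ 2 * al i ^+ 2)
  - 100 * a ^+ 2 * th ^+ 2 * Q ^+ 2 * e1 ^+ 2 * (g (tt i) * D i)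
  <= g (tt i.+1) - g (tt i) - a * (g (tt i) * dN i) - kap * (g (tt i) * Delta i).
  move=> iK.
  have := @step_bound _ _ a th kap Q B Cw e1 (y (tt i)) (al i) (dz i) (Delta i) (ee i)
    (rhoz i) (v (tt i)) (be i) (dJ i) (dWv i) (rho i) (sS i) (zS i) a0 th0 Cw0 e1_itv
    (D_le i) (qiQ i) (giB i) (Delta0 i) (ee0 i).
  rewrite -vS -yS; apply => //.
  - by rewrite /rho addrC subrK.
  - by rewrite /rhoz addrC subrK.
  - exact: drift_step.
(* The two defects are made opaque so that the sums below are split around them and not through
   them. *)
have [x1 x1E] : exists x1 : nat -> R, x1 =
    fun i => g (tt i) * (u i *m dWv i) 0 0 ^+ 2 - g (tt i) * enorm (u i) ^+ 2 * Delta i.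
  by eexists.
have [x2 x2E] : exists x2 : nat -> R, x2 = fun i =>
    g (tt i) * (1 + q i) * enorm (sS i *m dWv i) ^+ 2
    - g (tt i) * (1 + q i) * enorm (sS i) ^+ 2 * Delta i.
  by eexists.
have step' (i : 'I_K) : true -> a ^+ 2 / 16 * x1 i +
    (B * (Cw * 2 * e1 * Delta i + Cw * e1^-1 * ee i
         + cb * enorm (be i) ^+ 2 + cr * enorm (rho i) ^+ 2
         + a ^+ 2 * rhoz i ^+ 2 + a ^+ 2 * al i ^+ 2) * (-1)
   + (40 * a * th) * x2 i * (-1)
   + (100 * a ^+ 2 * th ^+ 2 * Q ^+ 2 * e1 ^+ 2) * (g (tt i) * D i) * (-1)
   + a * (g (tt i) * dN i) + kap * (g (tt i) * Delta i))
   <= g (tt i.+1) - g (tt i).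
  move=> _; have hs := step i (ltn_ord i); rewrite -subr_ge0 in hs.
  have E (b c : R) : b = c -> 0 <= b -> 0 <= c by move=> ->.
  by rewrite -subr_ge0; apply: E hs; rewrite x1E x2E; ring.
have := ler_sum (index_enum _) step'.
rewrite (_ : \sum_(i < K) (g (tt i.+1) - g (tt i)) = g T - g 0); last first.
  rewrite -(big_mkord xpredT (fun i => g (tt i.+1) - g (tt i))) telescope_sumr//.
  by rewrite (part_start ptt) (part_end ptt).
rewrite !big_split/= -!mulr_suml -!mulr_sumr !big_split/= -!mulr_sumr sum_Delta.
have q1 : `|\sum_(i < K) x1 i| <= e1 ^+ 2 by rewrite x1E; exact: qv1.
have q2 : `|\sum_(i < K) x2 i| <= e1 ^+ 2 by rewrite x2E; exact: qv2.
have hb := sum_be; have hr := rho_le; have hz := rhoz_le; have ha := sum_al.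
have he := sum_ee; have hD := sum_gD.
set S1 := \sum_(i < K) x1 i in q1 *; set S2 := \sum_(i < K) x2 i in q2 *.
set Sb := \sum_(i < K) enorm (be i) ^+ 2 in hb *.
set Sr := \sum_(i < K) enorm (rho i) ^+ 2 in hr *.
set Sz := \sum_(i < K) rhoz i ^+ 2 in hz *.
set Sa := \sum_(i < K) al i ^+ 2 in ha *.
set Se := \sum_(i < K) ee i in he *.
set SD := \sum_(i < K) g (tt i) * D i in hD *.
set SN := \sum_(i < K) g (tt i) * dN i.
set SK := \sum_(i < K) g (tt i) * Delta i.
move=> main.
have a2 : 0 <= a ^+ 2 := sqr_ge0 _.
have b1 : - (a ^+ 2 / 16 * S1) <= a ^+ 2 / 16 * e1.
  rewrite -mulrN ler_wpM2l ?divr_ge0//.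
  by apply: le_trans e1sq; apply: le_trans q1; rewrite -normrN; exact: ler_norm.
have b2 : 40 * a * th * S2 <= 40 * a * th * e1.
  apply: ler_wpM2l; first by pos.
  by apply: le_trans e1sq; apply: le_trans q2; exact: ler_norm.
have b3 : cb * Sb <= cb * (e1 * Kb).
  by apply: ler_wpM2l => //; apply: le_trans hb _; exact: ler_wpM2r.
have b4 : cr * Sr <= cr * e1 by apply: ler_wpM2l => //; exact: le_trans e1sq.
have b5 : a ^+ 2 * Sz <= a ^+ 2 * e1 by apply: ler_wpM2l => //; exact: le_trans e1sq.
have b6 : a ^+ 2 * Sa <= a ^+ 2 * (e1 * (Al * Al')) by exact: ler_wpM2l.
have b7 : Cw * e1^-1 * Se <= Cw * e1.
  rewrite -mulrA; apply: ler_wpM2l => //.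
  by rewrite mulrC ler_pdivrMr// -expr2.
pose c100 := 100 * a ^+ 2 * th ^+ 2 * Q ^+ 2.
pose KD := 2 * B * Kb + 4 * (1 + B * Q * (2 * sg ^+ 2 * T + 2)) + 4 * B.
have KD0 : 0 <= KD by rewrite /KD; pos.
have b8 : c100 * e1 ^+ 2 * SD <= c100 * e1 * KD.
  apply: (@le_trans _ _ (c100 * e1 ^+ 2 * KD)).
    by apply: ler_wpM2l => //; rewrite /c100; pos.
  by apply: ler_wpM2r => //; apply: ler_wpM2l => //; rewrite /c100; pos.
set I := Cw * 2 * e1 * T + _ + _ + _ + _ + _ in main.
have b9 : B * I <= B * (Cw * 2 * e1 * T + Cw * e1 + cb * (e1 * Kb) + cr * e1
    + a ^+ 2 * e1 + a ^+ 2 * (e1 * (Al * Al'))).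
  by apply: ler_wpM2l => //; rewrite /I !lerD.

have CpE : Cp * e1 = 40 * a * th * e1 + a ^+ 2 / 16 * e1 +
  B * (Cw * 2 * e1 * T + Cw * e1 + cb * (e1 * Kb) + cr * e1
    + a ^+ 2 * e1 + a ^+ 2 * (e1 * (Al * Al'))) + c100 * e1 * KD.
  by rewrite /Cp /pathwise_const -/Cw -/cb -/cr -/Al -/Al' -/Kb -/KD -/c100; field.
rewrite CpE; move: main b1 b2 b8 b9; rewrite -/c100; lra.
Qed.

End fixed_partition.
End pathwise.

(** * Approximation by step processes *)

Section stages.
Context {R : realType} {dO : measure_display} {Omega : measurableType dO}.
Variable P : probability Omega R.
Variables (n : nat) (W : R -> Omega -> 'cV[R]_n).
Hypotheses (P_complete : measure_is_complete P) (W_bm : brownian_motion P W).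
Local Notation mu := (@lebesgue_measure R).

Lemma sqrB_le (a b : R) : (a - b) ^+ 2 <= 2 * a ^+ 2 + 2 * b ^+ 2.
Proof. have := sqr_ge0 (a + b); lra. Qed.

Definition residual k (J : R -> Omega -> 'cV[R]_k) (tt : nat -> R)
    (s : nat -> Omega -> 'M[R]_(k, n)) (i : nat) (w : Omega) : 'cV[R]_k :=
  J (tt i.+1) w - J (tt i) w - s i w *m (W (tt i.+1) w - W (tt i) w).

Definition approx_error k (H : R -> Omega -> 'M[R]_(k, n)) (T : R)
    (S : simple_process P W k) (w : Omega) : \bar R :=
  (\int[mu]_(s in `[0%R, T]) (enorm (simple_eval S s w - H s w) ^+ 2)%:E)%E.

(** On a partition containing the jump times of S, the residuals are, up to sign, the increments of
    the martingale formed by the integral of S minus J. The mean of their squares sums to that of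
    the total increment, so a single S serves all such partitions. *)
Lemma residual_small k (H : R -> Omega -> 'M[R]_(k, n)) J (T e : R) :
  ito_integral P W H J -> 0 <= T -> 0 < e ->
  exists S : simple_process P W k,
   (\int[P]_w approx_error H T S w <= e%:E)%E /\
   forall pts h K tt, partition_of T pts h K tt -> {subset sp_times S <= pts} ->
   L1 P (fun w => \sum_(i < K) enorm (residual J tt (simple_step tt S) i w) ^+ 2) /\
   Ex P (fun w => \sum_(i < K) enorm (residual J tt (simple_step tt S) i w) ^+ 2) <= e.
Proof.
move=> itoJ T0 e0; have [S SJ] := ito_approximation P_complete W_bm itoJ.
(* The total increment satisfies (D_T - D_0)^2 <= 2 D_T^2 + 2 D_0^2, whence the 4; the value at time
   0 is approximated like the value at T. *)
have e4 : 0 < e / 4 by exact: divr_gt0.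
have [N1 hN1] := SJ T _ T0 e4; have [N2 hN2] := SJ 0 _ (lexx 0) e4.
pose N := maxn N1 N2.
have [i1 l1 x1] := hN1 N (leq_maxl _ _); have [i2 l2 x2] := hN2 N (leq_maxr _ _).
exists (S N); split.
  by apply: le_trans (ltW i1) _; rewrite lee_fin ler_pdivrMr// ler_peMr ?(ltW e0)// ler1n.
move=> pts h K tt ptt Spts.
pose D j t w := simple_integral (S N) t w j 0 - J t w j 0.
have mD j : L2mart P W (D j).
  by apply: L2martB; [exact: L2mart_simple|exact: (L2mart_ito P_complete W_bm _ itoJ)].
have D2 j t : 0 <= t -> L2 P (D j t) by move=> t0; have [_ + _] := mD j; exact.
have tt0 := part_ge0 ptt.
have resE i w : enorm (residual J tt (simple_step tt (S N)) i w) ^+ 2 =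
    \sum_j (D j (tt i.+1) w - D j (tt i) w) ^+ 2.
  rewrite enorm_sqr; apply: eq_bigr => j _; rewrite big_ord1 !mxE.
  rewrite -sqrrN; congr (_ ^+ 2); rewrite /D.
  have := simple_step_integral ptt Spts i w j.
  rewrite (_ : \sum_(l < n) simple_step tt (S N) i w j l * (W _ w - W _ w) l 0 =
    \sum_(l < n) simple_step tt (S N) i w j l * dW W (tt i) (tt i.+1) l w); last first.
    by apply: eq_bigr.
  by move=> <-; ring.
under eq_fun do under eq_bigr do rewrite resE.
have Li (i : 'I_K) j : L1 P (fun w => (D j (tt i.+1) w - D j (tt i) w) ^+ 2).
  by apply: L2_sqr; apply: L2B; exact: D2.
split; first by apply: L1_sum => i; apply: L1_sum.
rewrite Ex_sum; last by move=> i; exact: L1_sum.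
under eq_bigr do rewrite Ex_sum//.
rewrite exchange_big/=.
under eq_bigr do rewrite (mart_sqr_increments (part_ge0 ptt) (part_mono ptt) K (mD _)).
rewrite (part_start ptt) (part_end ptt).
have LD j t : 0 <= t -> L1 P (fun w => D j t w ^+ 2) by move=> ?; exact/L2_sqr/D2.
apply: (@le_trans _ _ (\sum_j (2 * Ex P (fun w => D j T w ^+ 2) +
                               2 * Ex P (fun w => D j 0 w ^+ 2)))).
  apply: ler_sum => j _; have [lT l0] := (LD j T T0, LD j 0 (lexx 0)).
  rewrite -!ExZ// -ExD; [|exact: L1Z..]; apply: Ex_le.
  - by apply: L2_sqr; apply: L2B; exact: D2.
  - by apply: L1D; exact: L1Z.
  - by move=> w; exact: sqrB_le.
rewrite big_split/= -!mulr_sumr -!Ex_sum; [|by move=> j; exact: LD..].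
have DE t : Ex P (fun w => enorm (simple_integral (S N) t w - J t w) ^+ 2) =
    Ex P (fun w => \sum_j D j t w ^+ 2).
  apply: eq_Ex => w; rewrite enorm_sqr; apply: eq_bigr => j _.
  by rewrite big_ord1 !mxE.
by rewrite !DE in x1 x2; lra.
Qed.

Section stage.
Variables (T th Bg : R) (g : R -> Omega -> R) (V : R -> Omega -> 'cV[R]_n).
Hypotheses (T0 : 0 <= T) (th0 : 0 <= th).
Hypothesis g0 : forall t w, 0 <= g t w.
Hypothesis gB : forall t w, g t w * (1 + enorm (V t w) ^+ 2) ^+ 4 <= Bg.
Hypothesis ag : forall t, 0 <= t -> adapted P W t (g t).
Hypothesis aV : forall t i, 0 <= t -> adapted P W t (fun w => V t w i 0).
Variables (H1 : R -> Omega -> 'M[R]_n) (J1 : R -> Omega -> 'cV[R]_n).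
Variables (H2 H3 : R -> Omega -> 'rV[R]_n) (J2 J3 : R -> Omega -> 'cV[R]_1).
Hypotheses (ito1 : ito_integral P W H1 J1) (ito2 : ito_integral P W H2 J2)
  (ito3 : ito_integral P W H3 J3).

(* A partition (refining, in [stage_exists], the jump times of the simple processes) with
   simple processes approximating the integrands [H1], [H2], [H3]; [st_error] measures at
   once the distances to the integrands, the residuals of the stochastic integrals and the
   two quadratic variation defects needed by [pathwise_fixed]. *)
Record stage := Stage { st_size : nat; st_time : nat -> R;
  st_S1 : simple_process P W n; st_S2 : simple_process P W 1;
  st_S3 : simple_process P W 1 }.

Section stage_data.
Variable D : stage.
Let tt := st_time D.

Definition st_dW i w := W (tt i.+1) w - W (tt i) w.
Definition st_sigma i w : 'M[R]_n := simple_step tt (st_S1 D) i w.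
Definition st_zeta i w : 'rV[R]_n :=
  simple_step tt (st_S2 D) i w - simple_step tt (st_S3 D) i w.
Definition st_u i w : 'rV[R]_n := st_zeta i w +
  (- (4 * th * enorm (V (tt i) w) ^+ 2)) *: (V (tt i) w)^T *m st_sigma i w.
Definition st_qv1 w : R := \sum_(i < st_size D)
  (g (tt i) w * (st_u i w *m st_dW i w) 0 0 ^+ 2
   - g (tt i) w * enorm (st_u i w) ^+ 2 * (tt i.+1 - tt i)).
Definition st_qv2 w : R := \sum_(i < st_size D)
  (g (tt i) w * (1 + enorm (V (tt i) w) ^+ 2) * enorm (st_sigma i w *m st_dW i w) ^+ 2
   - g (tt i) w * (1 + enorm (V (tt i) w) ^+ 2) * enorm (st_sigma i w) ^+ 2
     * (tt i.+1 - tt i)).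
Definition st_res w : R :=
  \sum_(i < st_size D) enorm (residual J1 tt st_sigma i w) ^+ 2 +
  (\sum_(i < st_size D) enorm (residual J2 tt (simple_step tt (st_S2 D)) i w) ^+ 2 +
  \sum_(i < st_size D) enorm (residual J3 tt (simple_step tt (st_S3 D)) i w) ^+ 2) +
  (`|st_qv1 w| + `|st_qv2 w|).
Definition st_error w : \bar R :=
  (approx_error H1 T (st_S1 D) w + (approx_error H2 T (st_S2 D) w +
   approx_error H3 T (st_S3 D) w) + (st_res w)%:E)%E.

End stage_data.

Lemma approx_error_measurable k (H : R -> Omega -> 'M[R]_(k, n)) J S :
  ito_integral P W H J -> measurable_fun setT (approx_error H T S).
Proof.
move=> [[pH _] _ _ _]; apply: measurable_time_integral => [s w|]; first exact: sqr_ge0.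
under eq_fun do rewrite enorm_sqr.
apply: measurable_sum => i.
apply: measurable_sum => j; apply: measurable_funX.
under eq_fun do rewrite !mxE.
apply: measurable_funB; first exact: measurable_simple_eval.
exact: (progressive_joint P_complete W_bm (pH i j) T0).
Qed.

Lemma stage_exists (e h0 : R) : 0 < e -> 0 < h0 -> exists D : stage,
  [/\ exists pts, partition_of T pts h0 (st_size D) (st_time D) /\
        [/\ {subset sp_times (st_S1 D) <= pts}, {subset sp_times (st_S2 D) <= pts} &
         {subset sp_times (st_S3 D) <= pts}],
   measurable_fun setT (st_error D) & (\int[P]_w st_error D w <= e%:E)%E].
Proof.
move=> e0 h00.
(* The error has 7 + n pieces: three distances to the integrands, three residuals, the defect
   [st_qv1], and the n rows of [st_qv2]. *)
pose r : R := e / (7 + n%:R).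
have n7 : (0 : R) < 7 + n%:R by rewrite ltr_wpDr.
have r0 : 0 < r by exact: divr_gt0.
have [S1 [a1 rs1]] := residual_small ito1 T0 r0.
have [S2 [a2 rs2]] := residual_small ito2 T0 r0.
have [S3 [a3 rs3]] := residual_small ito3 T0 r0.
have [c1 b1] := simple_eval_bounded S1.
have [c2 b2] := simple_eval_bounded S2.
have [c3 b3] := simple_eval_bounded S3.
pose cc : R := `|c1| + `|c2| + `|c3|.
have cc1 : c1 <= cc by rewrite /cc; have := ler_norm c1; have := normr_ge0 c2; have := normr_ge0 c3; lra.
have cc23 : c2 + c3 <= cc by rewrite /cc; have := ler_norm c2; have := ler_norm c3; have := normr_ge0 c1; lra.
have cc0 : 0 <= cc by rewrite /cc; have := normr_ge0 c2; have := normr_ge0 c3; have := normr_ge0 c1; lra.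
(* The simple processes are chosen first, then this bound on the rescaled integrands, then the mesh.
   The entries of u grow like (1 + q)^2, which is compensated by sqrt g (1 + q)^2 <= sqrt Bg. *)
pose U := Num.sqrt Bg * (cc + 4 * th * (n%:R * cc)).
have [h1 h10 qv] := qvsum_small P_complete W_bm U T0 r0.
have h01 : 0 < Num.min h0 h1 by rewrite lt_min h00.
pose pts := sp_times S1 ++ sp_times S2 ++ sp_times S3.
have [K [tt ptt]] := partition_exists pts T0 h01.
have i1 : {subset sp_times S1 <= pts} by move=> p; rewrite !mem_cat => ->.
have i2 : {subset sp_times S2 <= pts} by move=> p; rewrite !mem_cat => ->; rewrite orbT.
have i3 : {subset sp_times S3 <= pts} by move=> p; rewrite !mem_cat => ->; rewrite !orbT.
have ptt1 : partition_of T pts h1 K tt.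
  case: ptt => *; split => // i; apply: le_trans (_ : _ <= Num.min h0 h1) _ => //.
  by rewrite ge_min lexx orbT.
have ptt0 : partition_of T pts h0 K tt.
  case: ptt => *; split => // i; apply: le_trans (_ : _ <= Num.min h0 h1) _ => //.
  by rewrite ge_min lexx.
pose D := Stage K tt S1 S2 S3; exists D; have tt0 := part_ge0 ptt.
pose q i w := enorm (V (tt i) w) ^+ 2.
have q0 i w : 0 <= q i w by exact: sqr_ge0.
have sE i j w l : `|st_sigma D i w j l| <= cc by exact: le_trans (b1 _ _ _ _) cc1.
have zE i w l : `|st_zeta D i w 0 l| <= cc.
  rewrite !mxE; apply: le_trans (ler_normB _ _) _; apply: le_trans cc23.
  by apply: lerD; [exact: b2|exact: b3].
have sqg i w : Num.sqrt (g (tt i) w) * (1 + q i w) ^+ 2 <= Num.sqrt Bg.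
  have -> : (1 + q i w) ^+ 2 = Num.sqrt ((1 + q i w) ^+ 4).
    by rewrite (_ : _ ^+ 4 = ((1 + q i w) ^+ 2) ^+ 2) ?sqrtr_sqr ?ger0_norm ?sqr_ge0//; ring.
  by rewrite -sqrtrM// ler_wsqrtr.
(* The weights g and g (1 + q) enter the integrands through their square roots, so that both defects
   become instances of [qvsum], the second one row by row. *)
pose u1 i w : 'rV[R]_n := Num.sqrt (g (tt i) w) *: st_u D i w.
pose u2 j i w : 'rV[R]_n :=
  Num.sqrt (g (tt i) w * (1 + q i w)) *: row j (st_sigma D i w).
have asqrt t X : adapted P W t X -> adapted P W t (fun w => Num.sqrt (X w)).
  move=> aX; apply: (@measurableT_comp _ _ _ _ _ _ (@Num.sqrt R)) => //.
  by apply: continuous_measurable_fun; exact: sqrt_continuous.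
have aq i : adapted P W (tt i) (q i).
  rewrite /q; under eq_fun do rewrite enorm_sqr.
  apply: adapted_sum => a; apply: adapted_sum => b; rewrite (ord1 b).
  by apply: measurable_funX; exact: aV.
have as1 i j l : adapted P W (tt i) (fun w => st_sigma D i w j l).
  exact: (simple_step_adapted ptt i1).
have az i l : adapted P W (tt i) (fun w => st_zeta D i w 0 l).
  under eq_fun do rewrite !mxE.
  by apply: adaptedB; [exact: (simple_step_adapted ptt i2)|exact: (simple_step_adapted ptt i3)].
have au1 i l : adapted P W (tt i) (fun w => u1 i w 0 l).
  under eq_fun do rewrite mxE.
  apply: adaptedM; first by apply: asqrt; exact: ag.
  under eq_fun do rewrite mxE.
  apply: adaptedD; first exact: az.
  under eq_fun do rewrite mxE.
  apply: adapted_sum => k; under eq_fun do rewrite !mxE.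
  apply: adaptedM; last exact: as1.
  apply: adaptedM; last exact: aV.
  under eq_fun do rewrite -mulNr.
  by apply: adaptedM; [exact: adapted_cst|exact: aq].
have au2 j i l : adapted P W (tt i) (fun w => u2 j i w 0 l).
  under eq_fun do rewrite !mxE.
  apply: adaptedM; last exact: as1.
  apply: asqrt; apply: adaptedM; first exact: ag.
  by apply: adaptedD; [exact: adapted_cst|exact: aq].
have bu1 i w l : `|u1 i w 0 l| <= U.
  rewrite /u1 mxE normrM (ger0_norm (sqrtr_ge0 _)).
  have -> : U = Num.sqrt Bg * (cc + 4 * th * (n%:R * cc)) by [].
  apply: (@le_trans _ _ (Num.sqrt (g (tt i) w) * ((1 + q i w) ^+ 2 *
    (cc + 4 * th * (n%:R * cc))))); last first.
    rewrite [leLHS]mulrA; apply: ler_wpM2r; last exact: sqg.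
    apply: addr_ge0 => //.
    by do !apply: mulr_ge0 => //.
  apply: ler_wpM2l; first exact: sqrtr_ge0.
  rewrite mxE; apply: le_trans (ler_normD _ _) _; rewrite mulrDr; apply: lerD.
    by apply: le_trans (zE i w l) _; rewrite ler_peMl// exprn_ege1// lerDl//.
  rewrite mxE; apply: le_trans (ler_norm_sum _ _ _) _.
  have -> : (1 + q i w) ^+ 2 * (4 * th * (n%:R * cc)) =
     \sum_(k < n) (4 * th * (1 + q i w) ^+ 2 * cc).
    by rewrite sumr_const card_ord -mulr_natl; ring.
  apply: ler_sum => k _; rewrite !mxE !normrM.
  apply: ler_pM => //; rewrite -[enorm (V _ w) ^+ 2]/(q i w).
  have th4 : 0 <= 4 * th by exact: mulr_ge0.
  rewrite normrN (ger0_norm (mulr_ge0 th4 (q0 i w))).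
  rewrite -[leLHS]mulrA; apply: ler_wpM2l => //.
  rewrite [leRHS]expr2.
  apply: ler_pM => //; first by rewrite lerDr.
  have := normr_entry_le_enorm (V (tt i) w) k 0; rewrite /q.
  have := sqr_ge0 (enorm (V (tt i) w) - 1 / 2); nra.

have bu2 j i w l : `|u2 j i w 0 l| <= U.
  rewrite /u2 !mxE normrM (ger0_norm (sqrtr_ge0 _)) sqrtrM//.
  apply: (@le_trans _ _ (Num.sqrt Bg * cc)).
    apply: ler_pM => //.
    apply: le_trans (sqg i w); apply: ler_wpM2l; first exact: sqrtr_ge0.
    have q1 : 1 <= 1 + q i w by rewrite lerDl.
    rewrite -[leRHS]ger0_norm ?sqr_ge0// -sqrtr_sqr ler_wsqrtr//.
    by rewrite -exprM; apply: ler_eXnr.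
  rewrite ler_wpM2l ?sqrtr_ge0// lerDl.
  by do !apply: mulr_ge0 => //.
have [l1 x1] := qv _ _ _ ptt1 _ au1 bu1.
have l2x2 j := qv _ _ _ ptt1 _ (au2 j) (bu2 j).
have qE1 w : st_qv1 D w = qvsum W K tt u1 w.
  apply: eq_bigr => i _.
  have -> : \sum_l u1 i w 0 l * dW W (tt i) (tt i.+1) l w =
      Num.sqrt (g (tt i) w) * (st_u D i w *m st_dW D i w) 0 0.
    rewrite [in RHS]mxE mulr_sumr; apply: eq_bigr => l _.
    by rewrite [u1 i w 0 l]mxE -mulrA.
  have -> : \sum_l u1 i w 0 l ^+ 2 = g (tt i) w * enorm (st_u D i w) ^+ 2.
    rewrite enorm_sqr big_ord1 mulr_sumr; apply: eq_bigr => l _.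
    by rewrite [u1 i w 0 l]mxE exprMn (sqr_sqrtr (g0 _ _)).
  by rewrite [X in _ = X - _]exprMn (sqr_sqrtr (g0 _ _)).
have qE2 w : st_qv2 D w = \sum_j qvsum W K tt (u2 j) w.
  rewrite /qvsum exchange_big/=; apply: eq_bigr => i _.
  have gq : 0 <= g (st_time D i) w * (1 + q i w) by apply: mulr_ge0 => //; exact: addr_ge0.
  rewrite -[enorm (V _ w) ^+ 2]/(q i w).
  rewrite !enorm_sqr mulr_sumr mulr_sumr mulr_suml -sumrB; apply: eq_bigr => j _.
  rewrite big_ord1; congr (_ - _ * _).
    rewrite -[X in X * _ = _](sqr_sqrtr gq) -exprMn; congr (_ ^+ 2).
    rewrite mxE mulr_sumr; apply: eq_bigr => l _.
    by rewrite [u2 j i w 0 l]mxE [row _ _ 0 l]mxE -mulrA.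
  rewrite -[X in X * _ = _](sqr_sqrtr gq) mulr_sumr; apply: eq_bigr => l _.
  by rewrite [u2 j i w 0 l]mxE [row _ _ 0 l]mxE exprMn.
have lq2 : L1 P (fun w => `|st_qv2 D w|).
  apply: L1_norm; rewrite (funext qE2).
  apply: L1_sum => j; have [lj _] := l2x2 j; apply: L1_le lj => //.
  rewrite (_ : qvsum W K tt (u2 j) = fun w => \sum_(i < K)
     ((\sum_l u2 j i w 0 l * dW W (tt i) (tt i.+1) l w) ^+ 2 -
    (\sum_l u2 j i w 0 l ^+ 2) * (tt i.+1 - tt i))); last by apply/funext.
  apply: measurable_sum => i.
  have mu2 l : measurable_fun setT (fun w => u2 j i w 0 l) by exact: (adapted_measurable P_complete W_bm (au2 j i l)).
  have ii : 0 <= tt i <= tt i.+1 by rewrite tt0 (part_mono ptt).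
  apply: measurable_funB.
    apply: measurable_funX; apply: measurable_sum => l; apply: measurable_funM => //.
    by apply: L2_measurable; exact: (L2_dW P_complete W_bm).
  apply: measurable_funM => //; apply: measurable_sum => l; exact: measurable_funX.
have xq2 : Ex P (fun w => `|st_qv2 D w|) <= n%:R * r.
  apply: (@le_trans _ _ (Ex P (fun w => \sum_j `|qvsum W K tt (u2 j) w|))).
    apply: Ex_le => //; first by apply: L1_sum => j; have [] := l2x2 j.
    by move=> w; rewrite qE2; exact: ler_norm_sum.
  rewrite Ex_sum; last by move=> j; have [] := l2x2 j.
  apply: le_trans; first by apply: ler_sum => j _; have [_] := l2x2 j; exact.
  by rewrite sumr_const card_ord mulr_natl.
have [lr1 xr1] := rs1 _ _ _ _ ptt0 i1.
have [lr2 xr2] := rs2 _ _ _ _ ptt0 i2.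
have [lr3 xr3] := rs3 _ _ _ _ ptt0 i3.
have lq1 : L1 P (fun w => `|st_qv1 D w|) by under eq_fun do rewrite qE1.
have xq1 : Ex P (fun w => `|st_qv1 D w|) <= r.
  by rewrite (@eq_Ex _ _ _ _ _ (fun w => `|qvsum W K tt u1 w|))// => w; rewrite qE1.
have lres : L1 P (st_res D) by apply: L1D; [apply: L1D => //; exact: L1D|exact: L1D].
have xres : Ex P (st_res D) <= (4 + n%:R) * r.
  have yr1 : Ex P (fun w => \sum_(i < st_size D)
    enorm (residual J1 (st_time D) (st_sigma D) i w) ^+ 2) <= r by exact: xr1.
  have yr2 : Ex P (fun w => \sum_(i < st_size D) enorm (residual J2 (st_time D)
    (simple_step (st_time D) (st_S2 D)) i w) ^+ 2) <= r by exact: xr2.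
  have yr3 : Ex P (fun w => \sum_(i < st_size D) enorm (residual J3 (st_time D)
    (simple_step (st_time D) (st_S3 D)) i w) ^+ 2) <= r by exact: xr3.
  rewrite /st_res ExD; [|apply: L1D => //; exact: L1D|exact: L1D].
  rewrite ExD//; last exact: L1D.
  rewrite ExD// ExD//.
  move: yr1 yr2 yr3 xq1 xq2; do 5! move: (Ex _ _) => ?.
  move=> y1 y2 y3 y4 y5.
  have -> : (4 + n%:R) * r = (r + (r + r)) + (r + n%:R * r) by ring.
  by rewrite !lerD.
have ma1 := approx_error_measurable S1 ito1.
have ma2 := approx_error_measurable S2 ito2.
have ma3 := approx_error_measurable S3 ito3.
have ge0 k (H : R -> Omega -> 'M[R]_(k, n)) S w : (0 <= approx_error H T S w)%E.
  by apply: integral_ge0 => s _; rewrite lee_fin sqr_ge0.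
have res0 w : 0 <= st_res D w.
  rewrite /st_res; do !apply: addr_ge0 => //; apply: sumr_ge0 => i _; exact: sqr_ge0.
have mres : measurable_fun setT (fun w => (st_res D w)%:E).
  by apply/measurable_EFinP; exact: L1_measurable lres.
have m23 : measurable_fun setT (fun w => approx_error H2 T S2 w + approx_error H3 T S3 w)%E.
  exact: emeasurable_funD.
have m123 : measurable_fun setT (fun w => approx_error H1 T S1 w +
   (approx_error H2 T S2 w + approx_error H3 T S3 w))%E by exact: emeasurable_funD.
split; [by exists pts|exact: emeasurable_funD|].
rewrite ge0_integralD//; [|by move=> w _; do !apply: adde_ge0 => //|by move=> w _; rewrite lee_fin].
rewrite ge0_integralD//; [|by move=> w _; do !apply: adde_ge0 => //].
rewrite ge0_integralD;
  [|exact: measurableT|by move=> w _; exact: ge0|exact: ma2|by move=> w _; exact: ge0|exact: ma3].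
have -> : (e%:E = (r%:E + (r%:E + r%:E)) + ((4 + n%:R) * r)%:E)%E.
  by rewrite -!EFinD; congr (_%:E); rewrite /r; field; rewrite gt_eqF.
have d1 : (\int[P]_w approx_error H1 T (st_S1 D) w <= r%:E)%E by exact: a1.
have d2 : (\int[P]_w approx_error H2 T (st_S2 D) w <= r%:E)%E by exact: a2.
have d3 : (\int[P]_w approx_error H3 T (st_S3 D) w <= r%:E)%E by exact: a3.
have d4 : (\int[P]_w (st_res D w)%:E <= ((4 + n%:R) * r)%:E)%E.
  by rewrite ExE// lee_fin.
move: d1 d2 d3 d4; do 4! move: (integral _ _ _) => ?; move=> y1 y2 y3 y4;
  exact: (leeD (leeD y1 (leeD y2 y3)) y4).
Qed.

End stage.
End stages.

(** * The pathwise inequality for stages of small error *)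

Section pathwise_limit.
Context {R : realType} {dO : measure_display} {Omega : measurableType dO}.
Variable P : probability Omega R.
Variables (n : nat) (W : R -> Omega -> 'cV[R]_n).
Hypotheses (P_complete : measure_is_complete P) (W_bm : brownian_motion P W).

Lemma error_split (r1 r2 r3 x y d e : R) : 0 <= r1 -> 0 <= r2 -> 0 <= r3 ->
  0 <= x -> 0 <= y -> r1 + (r2 + r3) + (x + y) <= d -> 8 * d <= e ->
  [/\ r1 <= e, 2 * r2 + 2 * r3 <= e, x <= e & y <= e].
Proof. by move=> *; split; lra. Qed.

Lemma adde4_le (x1 x2 x3 x4 d : \bar R) : (0 <= x1 -> 0 <= x2 -> 0 <= x3 -> 0 <= x4 ->
  x1 + (x2 + x3) + x4 <= d -> [/\ x1 <= d, x2 <= d, x3 <= d & x4 <= d])%E.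
Proof.
move=> g1 g2 g3 g4; have g23 := adde_ge0 g2 g3; have g123 := adde_ge0 g1 g23.
move=> h; have h123 := le_trans (leeDl _ g4) h; have h23 := le_trans (leeDr _ g1) h123.
split; first exact: le_trans (leeDl _ g23) h123.
- exact: le_trans (leeDl _ g3) h23.
- exact: le_trans (leeDr _ g2) h23.
- exact: le_trans (leeDr _ g123) h.
Qed.

Lemma error_join (i1 i2 i3 d e : R) : 0 < d -> i1 <= d -> i2 <= d -> i3 <= d ->
  8 * d <= e -> i1 + (2 * i2 + 2 * i3) <= e.
Proof. by move=> *; lra. Qed.

Variables (T th : R) (g : R -> Omega -> R) (V : R -> Omega -> 'cV[R]_n).
Hypotheses (T0 : 0 <= T) (th0 : 0 <= th).
Variables (H1 : R -> Omega -> 'M[R]_n) (J1 : R -> Omega -> 'cV[R]_n).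
Variables (H2 H3 : R -> Omega -> 'rV[R]_n) (J2 J3 : R -> Omega -> 'cV[R]_1).
Hypotheses (ito1 : ito_integral P W H1 J1) (ito2 : ito_integral P W H2 J2)
  (ito3 : ito_integral P W H3 J3).

Lemma approx_error_Itg k (H : R -> Omega -> 'M[R]_(k, n)) J (S : simple_process P W k) w
    (e : R) :
  ito_integral P W H J -> (approx_error H T S w <= e%:E)%E ->
  integrable_upto T (fun s => enorm (simple_eval S s w - H s w) ^+ 2) /\
  Itg (fun s => enorm (simple_eval S s w - H s w) ^+ 2) 0 T <= e.
Proof.
move=> [[pH _] _ _ _] Se.
have mf : measurable_fun `[0, T] (fun s => enorm (simple_eval S s w - H s w) ^+ 2).
  apply: (@measurable_time_section _ _ _ (fun s w => enorm (simple_eval S s w - H s w) ^+ 2)).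
  under eq_fun do rewrite enorm_sqr.
  apply: measurable_sum => i; apply: measurable_sum => j; apply: measurable_funX.
  under eq_fun do rewrite !mxE.
  apply: measurable_funB; first exact: measurable_simple_eval.
  exact: (progressive_joint P_complete W_bm (pH i j) T0).
have int : integrable_upto T (fun s => enorm (simple_eval S s w - H s w) ^+ 2).
  apply/integrableP; split; first exact/measurable_EFinP.
  under eq_integral do rewrite /= ger0_norm ?sqr_ge0//.
  by apply: le_lt_trans Se _; rewrite ltry.
split=> //; rewrite -lee_fin /Itg /Rintegral fineK//.
exact: integrable_fin_num.
Qed.

Variables (w : Omega) (a kap lt M sg eta K1 C0 Q B Kf AZ : R).
Variables (fs : R -> 'cV[R]_n) (y gs : R -> R).
Let v s := V s w.
Let jz s := J2 s w 0 0 - J3 s w 0 0.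
Let zeta s := H2 s w - H3 s w.
Hypotheses (a0 : 0 < a) (M0 : 0 <= M) (sg0 : 0 <= sg).
Hypothesis quartic : forall p : R, 0 <= p ->
  - C0 <= 4 * eta * p ^+ 4 - (4 * K1 + 4 * M * sg) * p ^+ 3 - 80 * sg ^+ 2 * (1 + p ^+ 2).
Hypothesis kapE : kap <= a * lt - a * th * C0 - 4 * M ^+ 2.
Hypothesis fs_int : forall j, integrable_upto T (fun s => fs s j 0).
Hypothesis gs_int : integrable_upto T gs.
Hypothesis zeta_int : integrable_upto T (fun s => enorm (zeta s) ^+ 2).
Hypothesis zetaAZ : Itg (fun s => enorm (zeta s) ^+ 2) 0 T <= AZ.
Hypothesis v_eq : forall s t : R, 0 <= s -> s <= t -> t <= T ->
  v t = v s + \col_j Itg (fun x => fs x j 0) s t + (J1 t w - J1 s w).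
Hypothesis y_eq : forall s t : R, 0 <= s -> s <= t -> t <= T ->
  y t = y s + Itg (fun x => lt - gs x) s t + (jz t - jz s).
Hypothesis gsM : forall s : R, 0 <= s <= T -> `|gs s| <= M * enorm (zeta s).
Hypothesis sigma_le : forall s : R, 0 <= s <= T -> enorm (H1 s w) <= sg.
Hypothesis f_dissip : forall s : R, 0 <= s <= T ->
  inner (v s) (fs s) <= - eta * enorm (v s) ^+ 2 + K1 * enorm (v s).
Hypothesis vQ : forall s : R, 0 <= s <= T -> 1 + enorm (v s) ^+ 2 <= Q.
Hypothesis fK : forall (s : R) j, 0 <= s <= T -> `|fs s j 0| <= Kf.
Let U s := a * (y s - th * (enorm (v s) ^+ 2) ^+ 2).
Hypothesis gE : forall s : R, 0 <= s <= T -> g s w = expR (U s).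
Hypothesis gB : forall s : R, 0 <= s <= T -> g s w <= B.
Hypothesis uc : forall e : R, 0 < e -> exists2 d : R, 0 < d &
  forall s t : R, 0 <= s <= T -> 0 <= t <= T -> `|t - s| <= d ->
  [/\ enorm (v t - v s) <= e, enorm (fs t - fs s) <= e & `|U t - U s| <= e].

(** The threshold d depends on the outcome but not on the stage, so one sequence of stages, fixed
    for all outcomes, can satisfy the premises eventually for each of them. *)
Lemma pathwise_limit (e : R) : 0 < e -> exists2 d : R, 0 < d &
  forall (D : stage P W) pts h, h <= d ->
  partition_of T pts h (st_size D) (st_time D) ->
  {subset sp_times (st_S1 D) <= pts} -> {subset sp_times (st_S2 D) <= pts} ->
  {subset sp_times (st_S3 D) <= pts} ->
  (st_error T th g V H1 J1 H2 H3 J2 J3 D w <= d%:E)%E ->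
  \sum_(i < st_size D) a * (g (st_time D i) w *
     (jz (st_time D i.+1) - jz (st_time D i) - 4 * th * enorm (v (st_time D i)) ^+ 2 *
      inner (v (st_time D i)) (J1 (st_time D i.+1) w - J1 (st_time D i) w)))
  <= g T w - g 0 w - kap * (\sum_(i < st_size D) g (st_time D i) w * (st_time D i.+1 - st_time D i)) + e.
Proof.
move=> e0; pose Cp := pathwise_const n T a th lt M sg Q B Kf AZ.
pose e1 : R := Num.min 1 (e / (`|Cp| + 1)).
have Cp1 : 0 < `|Cp| + 1 by rewrite ltr_wpDl.
have e1_itv : 0 < e1 <= 1 by rewrite lt_min ltr01 divr_gt0//= ge_min lexx.
have e10 : 0 < e1 by case/andP: e1_itv.
have Ce : Cp * e1 <= e.
  apply: (@le_trans _ _ ((`|Cp| + 1) * e1)).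
    apply: ler_wpM2r; first exact: ltW.
    by apply: le_trans (ler_norm _) _; rewrite lerDl.
  by rewrite mulrC -ler_pdivlMr// ge_min lexx orbT.
have [d d0 hd] := uc e10.
(* The factor 8 covers the combination i1 + 2 i2 + 2 i3 of the approximation errors and 2 r2 + 2 r3
   of the residuals. *)
pose d1 := Num.min d (e1 ^+ 2 / 8).
have d1d : d1 <= d by rewrite ge_min lexx.
have d1e : 8 * d1 <= e1 ^+ 2 by rewrite mulrC -ler_pdivlMr// ge_min lexx orbT.
have d10 : 0 < d1 by rewrite lt_min d0 divr_gt0// exprn_gt0.
exists d1; first exact: d10.
move=> D pts h hd1 ptt i1 i2 i3 Derr; set tt := st_time D in ptt *.
have tt0 := part_ge0 ptt; have ttT := part_le ptt; have ttm := part_mono ptt.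
have ttI i : 0 <= tt i <= T by rewrite tt0 ttT.
have in_T i s : tt i < s <= tt i.+1 -> 0 <= s <= T.
  by move=> /andP[h1 h2]; rewrite (le_trans (tt0 i) (ltW h1)) (le_trans h2 (ttT i.+1)).
have close i s : tt i < s <= tt i.+1 -> `|s - tt i| <= d.
  move=> /andP[h1 h2]; rewrite ger0_norm ?subr_ge0 ?(ltW h1)//.
  apply: le_trans d1d; apply: le_trans hd1.
  by apply: le_trans (part_mesh ptt i); rewrite lerD2r.
have close' i : `|tt i.+1 - tt i| <= d.
  rewrite ger0_norm ?subr_ge0 ?ttm//.
  by apply: le_trans (le_trans (part_mesh ptt i) hd1) d1d.
have ge0 k (H : R -> Omega -> 'M[R]_(k, n)) (S : simple_process P W k) : (0 <= approx_error H T S w)%E.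
  by apply: integral_ge0 => s _; rewrite lee_fin sqr_ge0.
pose r1 := \sum_(i < st_size D) enorm (residual W J1 tt (st_sigma D) i w) ^+ 2.
pose r2 := \sum_(i < st_size D) enorm (residual W J2 tt (simple_step tt (st_S2 D)) i w) ^+ 2.
pose r3 := \sum_(i < st_size D) enorm (residual W J3 tt (simple_step tt (st_S3 D)) i w) ^+ 2.
have r10 : 0 <= r1 by apply: sumr_ge0 => i _; exact: sqr_ge0.
have r20 : 0 <= r2 by apply: sumr_ge0 => i _; exact: sqr_ge0.
have r30 : 0 <= r3 by apply: sumr_ge0 => i _; exact: sqr_ge0.
have [err1 err2 err3 errR] :
  [/\ (approx_error H1 T (st_S1 D) w <= d1%:E)%E,
      (approx_error H2 T (st_S2 D) w <= d1%:E)%E,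
      (approx_error H3 T (st_S3 D) w <= d1%:E)%E &
      r1 + (r2 + r3) + (`|st_qv1 th g V D w| + `|st_qv2 g V D w|) <= d1].
  have res0 : (0 <= (st_res th g V J1 J2 J3 D w)%:E)%E.
    rewrite lee_fin /st_res; apply: addr_ge0; last exact: addr_ge0.
    by apply: addr_ge0 => //; exact: addr_ge0.
  exact: (adde4_le (ge0 _ H1 _) (ge0 _ H2 _) (ge0 _ H3 _) res0 Derr).
have [ii1 I1] := approx_error_Itg ito1 err1.
have [ii2 I2] := approx_error_Itg ito2 err2.
have [ii3 I3] := approx_error_Itg ito3 err3.
pose Ef s := enorm (simple_eval (st_S1 D) s w - H1 s w) ^+ 2 +
  (2 * enorm (simple_eval (st_S2 D) s w - H2 s w) ^+ 2 +
   2 * enorm (simple_eval (st_S3 D) s w - H3 s w) ^+ 2).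
have jz2 := integrable_uptoZ 2 ii2; have jz3 := integrable_uptoZ 2 ii3.
have Ef_int : integrable_upto T Ef.
  by apply: integrable_uptoD => //; exact: integrable_uptoD.
have Ef0 s : 0 <= Ef s.
  by apply: addr_ge0; [|apply: addr_ge0; apply: mulr_ge0 => //]; exact: sqr_ge0.
have Ef_le : Itg Ef 0 T <= e1 ^+ 2.
  have z := lexx (0 : R).
  rewrite (ItgD z (lexx T) ii1 (integrable_uptoD jz2 jz3)) (ItgD z (lexx T) jz2 jz3).
  rewrite (ItgZ z (lexx T) _ ii2) (ItgZ z (lexx T) _ ii3).
  exact: error_join d10 I1 I2 I3 d1e.
have [rle r23le q1le q2le] := error_split r10 r20 r30 (normr_ge0 _) (normr_ge0 _) errR d1e.
have EfE i s : (i < st_size D)%N -> tt i < s <= tt i.+1 ->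
    enorm (st_sigma D i w - H1 s w) ^+ 2 + enorm (st_zeta D i w - zeta s) ^+ 2 <= Ef s.
  move=> _ si; rewrite /Ef !(simple_eval_step ptt _ _ si)//; apply: lerD => //.
  have := @enorm_add_sqr _ _ _ (simple_step tt (st_S2 D) i w - H2 s w)
     (- (simple_step tt (st_S3 D) i w - H3 s w)).
  rewrite enormN; apply: le_trans; rewrite le_eqVlt; apply/orP; left.
  apply/eqP; congr (enorm _ ^+ 2); rewrite /st_zeta /zeta; apply/matrixP => k l; rewrite !mxE; ring.
have rho_le : \sum_(i < st_size D) enorm (J1 (tt i.+1) w - J1 (tt i) w -
    st_sigma D i w *m st_dW D i w) ^+ 2 <= e1 ^+ 2.
  exact: rle.
have rhoz_le : \sum_(i < st_size D) (jz (tt i.+1) - jz (tt i) -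
    (st_zeta D i w *m st_dW D i w) 0 0) ^+ 2 <= e1 ^+ 2.
  apply: (@le_trans _ _ (2 * r2 + 2 * r3)).
    rewrite /r2 /r3 !mulr_sumr -big_split/=; apply: ler_sum => i _.
    rewrite !enorm_sqr !big_ord1.
    have := sqrB_le (residual W J2 tt (simple_step tt (st_S2 D)) i w 0 0)
      (residual W J3 tt (simple_step tt (st_S3 D)) i w 0 0).
    apply: le_trans; rewrite le_eqVlt; apply/orP; left; apply/eqP; congr (_ ^+ 2).
    rewrite /residual /st_zeta mulmxBl /jz /st_dW !mxE; ring.
  exact: r23le.
have gEi i : g (tt i) w = expR (U (tt i)) by exact: gE.
have gET : g T w = expR (U T) by apply: gE; rewrite T0 lexx.
have gE0 : g 0 w = expR (U 0) by apply: gE; rewrite T0 lexx.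
have gB' s : 0 <= s <= T -> expR (U s) <= B by move=> sT; rewrite -gE//; exact: gB.
have he1 : h <= e1 ^+ 2.
  by apply: le_trans hd1 _; apply: le_trans d1e; rewrite ler_peMl ?ler1n// ltW.
have qv1 : `|\sum_(i < st_size D) (expR (U (tt i)) * (st_u th V D i w *m st_dW D i w) 0 0 ^+ 2
     - expR (U (tt i)) * enorm (st_u th V D i w) ^+ 2 * (tt i.+1 - tt i))| <= e1 ^+ 2.
  move: q1le; rewrite /st_qv1 -/tt; by under eq_bigr do rewrite gEi.
have qv2 : `|\sum_(i < st_size D) (expR (U (tt i)) * (1 + enorm (V (tt i) w) ^+ 2)
      * enorm (st_sigma D i w *m st_dW D i w) ^+ 2
   - expR (U (tt i)) * (1 + enorm (V (tt i) w) ^+ 2) * enorm (st_sigma D i w) ^+ 2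
     * (tt i.+1 - tt i))| <= e1 ^+ 2.
  move: q2le; rewrite /st_qv2 -/tt; by under eq_bigr do rewrite gEi.
rewrite gET gE0.
under eq_bigr do rewrite gEi.
under [X in _ <= _ - _ * X + _]eq_bigr do rewrite gEi.
set X := _ - _ - kap * _; apply: (@le_trans _ _ (X + Cp * e1)); last by rewrite lerD2l.
rewrite /X.
apply: (@pathwise_fixed _ _ T a th kap lt M sg eta K1 C0 Q B Kf AZ v fs (fun s => J1 s w)
  y gs jz (fun s => H1 s w) zeta T0 a0 th0 M0 sg0 quartic kapE fs_int gs_int zeta_int zetaAZ
  v_eq y_eq gsM sigma_le f_dissip vQ fK gB' e1 h pts (st_size D) tt (fun i => st_sigma D i w)
  (fun i => st_zeta D i w) (fun i => st_dW D i w) Ef e1_itv ptt he1 _ _ _ Ef_int Ef0 Ef_le EfE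
  rho_le rhoz_le qv1 qv2).
- by move=> i; have [] := hd _ _ (ttI i) (ttI i.+1) (close' i).
- by move=> i s si; have [] := hd _ _ (ttI i) (in_T _ _ si) (close _ _ si).
- move=> i; have [_ _] := hd _ _ (ttI i) (ttI i.+1) (close' i).
  rewrite ler_norml => /andP[+ _].
  have -> : a * (y (tt i.+1) - th * (enorm (v (tt i.+1)) ^+ 2) ^+ 2 -
    (y (tt i) - th * (enorm (v (tt i)) ^+ 2) ^+ 2)) = U (tt i.+1) - U (tt i).
    by rewrite /U mulrBr.
  have [_ e11] := andP e1_itv; apply: le_trans; rewrite lerN2.
  by apply: le_trans e11 _; rewrite ler1n.
Qed.

End pathwise_limit.

(** * Regularity of the paths *)

Section paths.
Context {R : realType}.
Variable T : R.

Lemma enorm_small_entries k l (e : R) : 0 < e -> exists2 c, 0 < c &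
  forall A : 'M[R]_(k, l), (forall i j, `|A i j| <= c) -> enorm A <= e.
Proof.
move=> e0; pose c := e / ((k * l)%:R + 1).
have kl : (0 : R) < (k * l)%:R + 1 by rewrite ltr_wpDl.
have c0 : 0 < c by exact: divr_gt0.
exists c => // A /enorm_le_entries h2.
rewrite -(@ler_pXn2r _ 2)// ?nnegrE ?(ltW e0) ?enorm_ge0//.
apply: le_trans h2 _; rewrite /c expr_div_n mulrCA ler_piMr ?sqr_ge0//.
rewrite ler_pdivrMr ?exprn_gt0// mul1r; set N : R := (k * l)%:R.
have N0 : 0 <= N by []; nra.
Qed.

Definition rcont (f : R -> R) : Prop := {within `[0, T], continuous f}.

Lemma rcont_cst c : rcont (fun=> c).
Proof. by move=> x; exact: cvg_cst. Qed.

Lemma rcontD f g : rcont f -> rcont g -> rcont (fun x => f x + g x).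
Proof. by move=> cf cg x; apply: cvgD; [exact: cf|exact: cg]. Qed.

Lemma rcontM f g : rcont f -> rcont g -> rcont (fun x => f x * g x).
Proof. by move=> cf cg x; apply: cvgM; [exact: cf|exact: cg]. Qed.

Lemma rcontB f g : rcont f -> rcont g -> rcont (fun x => f x - g x).
Proof. by move=> cf cg x; apply: cvgB; [exact: cf|exact: cg]. Qed.

Lemma rcont_sum I (s : seq I) (f : I -> R -> R) :
  (forall i, rcont (f i)) -> rcont (fun x => \sum_(i <- s) f i x).
Proof.
move=> cf; elim: s => [|i s IH].
  by under eq_fun do rewrite big_nil; exact: rcont_cst.
by under eq_fun do rewrite big_cons; exact: rcontD.
Qed.

Lemma rcont_measurable f : rcont f -> measurable_fun `[0, T] f.
Proof. by move=> cf; apply: subspace_continuous_measurable_fun. Qed.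

Lemma rcont_integrable f : rcont f -> integrable_upto T f.
Proof. by move=> cf; apply: continuous_compact_integrable => //; exact: segment_compact. Qed.

Lemma rcontP f : rcont f <-> forall s, 0 <= s <= T -> forall e, 0 < e ->
  exists2 d, 0 < d & forall t, 0 <= t <= T -> `|t - s| < d -> `|f t - f s| < e.
Proof.
rewrite /rcont subspace_continuousP; split=> [cf s sT e e0|cf s].
  have sT' : `[0, T]%classic s by rewrite /= in_itv.
  have := cf s sT' => /cvgrPdist_lt/(_ e e0); rewrite near_withinE => -[d /= d0 hd].
  exists d => // t tT ts; rewrite distrC; apply: hd; rewrite /= ?in_itv//=.
  by rewrite distrC.
rewrite /= in_itv/= => sT; apply/cvgrPdist_lt => e e0; rewrite near_withinE.
have [d d0 hd] := cf s sT e e0; exists d => //= t; rewrite /= distrC in_itv/= => ts tT.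
by rewrite distrC; exact: hd.
Qed.

Section matrix_paths.
Variables k l : nat.

(** Stated with [enorm], since the moduli of continuity in [pathwise_fixed] are Euclidean while the
    topology of matrices comes from the sup norm. *)
Definition pcont (F : R -> 'M[R]_(k, l)) : Prop :=
  forall s, 0 <= s <= T -> forall e, 0 < e -> exists2 d, 0 < d &
  forall t, 0 <= t <= T -> `|t - s| < d -> enorm (F t - F s) <= e.

Lemma pcont_entries F : pcont F <-> forall i j, rcont (fun s => F s i j).
Proof.
split=> [cF i j|cF s sT e e0].
  apply/rcontP => s sT e e0; have [d d0 hd] := cF s sT (e / 2) (divr_gt0 e0 (ltr0Sn _ 1)).
  exists d => // t tT ts; apply: (@le_lt_trans _ _ (e / 2)); last first.
    by rewrite ltr_pdivrMr// ltr_pMr// ltr1n.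
  apply: le_trans (hd t tT ts); have := normr_entry_le_enorm (F t - F s) i j.
  by rewrite !mxE.
have [c c0 hc] := enorm_small_entries k l e0.
have /choice[d hd] : forall ij : 'I_k * 'I_l, exists d, 0 < d /\
    forall t, 0 <= t <= T -> `|t - s| < d -> `|F t ij.1 ij.2 - F s ij.1 ij.2| < c.
  move=> [i j]; have /rcontP/(_ s sT c c0)[d d0 hd] := cF i j.
  by exists d.
exists (\big[Num.min/1]_ij d ij).
  by apply: lt_bigmin => // ij _; have [] := hd ij.
move=> t tT ts; apply: hc => i j.
rewrite !mxE ltW//; have [_] := hd (i, j); apply => //.
apply: lt_le_trans ts _; exact: bigmin_le.
Qed.

(** Compactness in covering form, the common radius being the parameter that tends to 0 from the
    right. *)
Lemma heine F : pcont F -> forall e, 0 < e -> exists2 d, 0 < d &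
  forall s t, 0 <= s <= T -> 0 <= t <= T -> `|t - s| <= d -> enorm (F t - F s) <= e.
Proof.
move=> cF e e0; have := @segment_compact R 0 T; rewrite compact_near_coveringP.
move=> /(_ R (0 : R)^'+ (fun d s => forall t, 0 <= s <= T -> 0 <= t <= T ->
    `|t - s| <= d -> enorm (F t - F s) <= e) _)[].
  move=> x; rewrite /= in_itv/= => xT.
  have [d d0 hd] := cF x xT (e / 2) (divr_gt0 e0 (ltr0Sn _ 1)).
  have d2 : 0 < d / 2 by exact: divr_gt0.
  exists ([set s | `|x - s| < d / 2], [set r | r < d / 2]) => /=.
    split; first by exists (d / 2).
    exists (d / 2) => // r; rewrite /ball_ /= sub0r normrN => h _; exact: le_lt_trans (ler_norm _) h.
  move=> [s r]/= [xs rd] t sT tT tsr.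
  have h1 : enorm (F s - F x) <= e / 2 by apply: hd => //; rewrite distrC; lra.
  have h2 : enorm (F t - F x) <= e / 2.
    apply: hd => //; have := ler_distD s t x; rewrite (distrC s x); lra.
  have := enorm_triangle (F t - F x) (F x - F s).
  rewrite addrA subrK (enorm_subC (F x)) => h3; apply: le_trans h3 _.
  by rewrite (splitr e) lerD.
move=> d d0 hd; have r0 : 0 < d / 2 by exact: divr_gt0.
exists (d / 2) => // s t sT tT; apply: (hd (d / 2)) => //=.
  by rewrite /ball_/= sub0r normrN gtr0_norm// ltr_pdivrMr// ltr_pMr// ltr1n.
Qed.

(** The covering argument again, the parameter being now the bound, which tends to infinity. *)
Lemma pcont_bounded F : pcont F -> exists K, forall s, 0 <= s <= T -> enorm (F s) <= K.
Proof.
move=> cF; have := @segment_compact R 0 T; rewrite compact_near_coveringP.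
move=> /(_ R (pinfty_nbhs R) (fun K s => 0 <= s <= T -> enorm (F s) <= K) _)[].
  move=> x; rewrite /= in_itv/= => xT; have [d d0 hd] := cF x xT 1 ltr01.
  exists ([set s | `|x - s| < d], [set K | enorm (F x) + 1 < K]) => /=.
    split; first by exists d.
    by exists (enorm (F x) + 1); split => //; exact: num_real.
  move=> [s K]/= [xs /ltW FK] sT; apply: le_trans FK.
  have := enorm_triangle (F s - F x) (F x); rewrite subrK => h.
  have : enorm (F s - F x) <= 1 by apply: hd => //; rewrite distrC.
  lra.
move=> K [_ hK]; exists (K + 1) => s sT; apply: (hK (K + 1)) => //=; by rewrite ltrDl.
Qed.

End matrix_paths.

Lemma pcont_within k l (F : R -> 'M[R]_(k, l)) :
  {within `[0, +oo[, continuous F} -> pcont F.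
Proof.
move=> cF; apply/pcont_entries => i j x.
have cF' : {within `[0, T], continuous F}.
  apply: continuous_subspaceW cF => z /=; rewrite !in_itv/= => /andP[-> _]//.
exact: (continuous_comp (cF' x) (@coord_continuous _ _ _ i j _)).
Qed.

Lemma pcont_comp k l k' l' (F : R -> 'M[R]_(k, l)) (f : 'M[R]_(k, l) -> 'M[R]_(k', l')) :
  pcont F -> locally_lipschitz_map f -> pcont (fun s => f (F s)).
Proof.
move=> cF lf s sT e e0; have [r [K [r0 fK]]] := lf (F s).
have K1 : 0 < `|K| + 1 by rewrite ltr_wpDl.
pose c := Num.min (r / 2) (e / (`|K| + 1)).
have c0 : 0 < c by rewrite lt_min !divr_gt0.
have [d d0 hd] := cF s sT c c0; exists d => // t tT ts.
have Fc := hd t tT ts.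
have Fr : enorm (F t - F s) < r.
  apply: le_lt_trans Fc _; apply: (@le_lt_trans _ _ (r / 2)).
    by rewrite ge_min lexx.
  by rewrite ltr_pdivrMr// ltr_pMr// ltr1n.
have Fr0 : enorm (F s - F s) < r.
  by rewrite subrr -[0](scale0r (0 : 'M[R]_(k, l))) enormZ normr0 mul0r.
apply: le_trans (fK _ _ Fr Fr0) _.
apply: le_trans (ler_wpM2r (enorm_ge0 _) (ler_norm K)) _.
apply: le_trans (ler_wpM2l (normr_ge0 K) Fc) _.
have -> : e = (`|K| + 1) * (e / (`|K| + 1)) by rewrite mulrC divfK ?gt_eqF.
apply: ler_pM => //; rewrite ?lerDl//; first exact: ltW.
by rewrite ge_min lexx orbT.
Qed.

Definition rational_row n (i : nat) : 'rV[R]_n :=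
  map_mx ratr (odflt 0 (unpickle i : option 'rV[rat]_n)).

Lemma rational_row_dense n (z : 'rV[R]_n) (e : R) : 0 < e ->
  exists i, enorm (z - rational_row n i) <= e.
Proof.
move=> e0; have [c c0 hc] := enorm_small_entries 1 n e0.
have /choice[r hr] : forall j, exists r : rat, `|z 0 j - ratr r| <= c.
  move=> j; have [|r] := @rat_in_itvoo R (z 0 j - c) (z 0 j + c).
    by rewrite ltrD2l gtrN.
  rewrite in_itv/= => /andP[r1 r2]; exists r.
  by rewrite ler_norml; apply/andP; split; lra.
exists (pickle (\row_j r j)); apply: hc => i j; rewrite (ord1 i).
by rewrite /rational_row pickleK/= !mxE.
Qed.

(* [psi] is the infimum of the maps [psi (., q) + M |. - q|] for [q] rational, each of
   which is measurable along the path. *)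
Lemma measurable_driver n (psi : 'cV[R]_n -> 'rV[R]_n -> R) (M : R)
    (V : R -> 'cV[R]_n) (Z : R -> 'rV[R]_n) : 0 <= M ->
  (forall z, continuous (psi ^~ z)) ->
  (forall x z z', `|psi x z - psi x z'| <= M * enorm (z - z')) ->
  {within `[0, T], continuous V} ->
  (forall j, measurable_fun `[0, T] (fun s => Z s 0 j)) ->
  measurable_fun `[0, T] (fun s => psi (V s) (Z s)).
Proof.
move=> M0 cpsi lpsi cV mZ.
pose h i s := psi (V s) (rational_row n i) + M * enorm (Z s - rational_row n i).
have hge i s : psi (V s) (Z s) <= h i s.
  have := lpsi (V s) (Z s) (rational_row n i); rewrite ler_norml => /andP[_].
  by rewrite lerBlDl.
have lb s : has_lbound (range (h ^~ s)).
  by exists (psi (V s) (Z s)) => _ [i _ <-]; exact: hge.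
rewrite (_ : (fun s => _) = (fun s => infs (h ^~ s) 0)); last first.
  apply/funext => s; apply/eqP; rewrite eq_le; apply/andP; split.
    apply: lb_le_inf; first by exists (h 0%N s); exists 0%N.
    by move=> _ [i _ <-]; exact: hge.
  apply/ler_addgt0Pr => e e0.
  (* [h i] exceeds psi by at most 2 M |Z - q|, once for the Lipschitz bound on psi and once for the
     added penalty. *)
  have d0 : 0 < e / (2 * M + 1) by rewrite divr_gt0// ltr_wpDl// mulr_ge0.
  have [i hi] := rational_row_dense (Z s) d0.
  apply: (@le_trans _ _ (h i s)).
    apply: ge_inf; last by exists i.
    by exists (psi (V s) (Z s)) => _ [j _ <-]; exact: hge.
  have := lpsi (V s) (rational_row n i) (Z s); rewrite enorm_subC ler_norml => /andP[_].
  rewrite lerBlDl => h1; apply: le_trans (lerD h1 (lexx _)) _; rewrite -addrA lerD2l.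
  rewrite -mulr2n -mulr_natl mulrA.
  apply: le_trans (ler_wpM2l (_ : 0 <= 2 * M) hi) _; first by rewrite mulr_ge0.
  rewrite mulrCA ler_piMr ?(ltW e0)// ler_pdivrMr ?ltr_wpDl ?mulr_ge0//.
  by rewrite mul1r lerDl.
apply: measurable_fun_infs => [s _|i]; first exact: lb.
apply: measurable_funD.
  apply: rcont_measurable => s.
  exact: (@continuous_comp (subspace `[0, T]) _ _ V (psi ^~ (rational_row n i)) s (cV s) (cpsi _ _)).
apply: measurable_funM; first exact: measurable_cst.
rewrite (_ : (fun s => _) = (fun s => Num.sqrt (\sum_k \sum_j
    (Z s - rational_row n i) k j ^+ 2))); last first.
  by apply/funext => s; rewrite -enorm_sqr sqrtr_sqr ger0_norm ?enorm_ge0.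
apply: (@measurableT_comp _ _ _ _ _ _ (@Num.sqrt R)) => //.
  by apply: continuous_measurable_fun; exact: sqrt_continuous.
apply: measurable_sum => k; apply: measurable_sum => j; apply: measurable_funX.
rewrite (_ : (fun s => _) = (fun s => Z s 0 j - rational_row n i 0 j)); last first.
  by apply/funext => s; rewrite (ord1 k) 2!mxE.
by apply: measurable_funB => //; exact: mZ.
Qed.

End paths.

(** * Passing to the limit *)

Section limit_tools.
Context {R : realType}.

(** (1 + q)^4 <= exp (4 q) moves the weight into the exponent, which is then at most a C1 + c q - d
    q^2 with c = a C1 + 4 and d = a th; complete the square. Here the penalty, quadratic in q, beats
    the growth of Y - Y', linear in q. *)
Lemma truncated_exp_bound (a th C1 q y : R) : 0 < a -> 0 < th -> 0 <= C1 -> 0 <= q ->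
  expR (a * (Num.min y (C1 * (1 + q)) - th * q ^+ 2)) * (1 + q) ^+ 4
  <= expR ((a * C1 + 4) + (a * C1 + 4) ^+ 2 / (4 * (a * th))).
Proof.
move=> a0 th0 C10 q0; have q1 : 0 <= 1 + q by rewrite addr_ge0.
have h1 : (1 + q) ^+ 4 <= expR (q * 4%:R).
  by rewrite expRM_natr lerXn2r ?nnegrE ?expR_ge0// expR_ge1Dx.
apply: le_trans (ler_wpM2l (expR_ge0 _) h1) _; rewrite -expRD ler_expR.
have h2 : a * Num.min y (C1 * (1 + q)) <= a * (C1 * (1 + q)).
  by rewrite ler_pM2l// ge_min lexx orbT.
set c := a * C1 + 4; set d := a * th.
have d0 : 0 < d by exact: mulr_gt0.
have h3 : c * q - d * q ^+ 2 <= c ^+ 2 / (4 * d).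
  have -> : c ^+ 2 / (4 * d) = c * q - d * q ^+ 2 + d * (q - c / (2 * d)) ^+ 2.
    by field; rewrite gt_eqF.
  by rewrite lerDl mulr_ge0 ?sqr_ge0// ltW.
have -> : a * (Num.min y (C1 * (1 + q)) - th * q ^+ 2) =
  a * Num.min y (C1 * (1 + q)) - d * q ^+ 2 by rewrite /d; ring.
by move: h2 h3; rewrite /c; set X := _ / (4 * d); lra.
Qed.

Context {dO : measure_display} {Omega : measurableType dO}.
Variable P : probability Omega R.

(* With [f := min 1 (max 0 (S - D))], which tends to [0] boundedly, one has
   [S - D <= f + d S^2 + (1 / (4 d) + K) f] because [1 <= f] wherever [S - D > 1]. *)
Lemma expectation_limit (S D : nat -> Omega -> R) (A K : R) : 0 <= A -> 0 <= K ->
  (forall m, L2 P (S m)) -> (forall m, Ex P (S m) = 0) ->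
  (forall m, Ex P (fun w => S m w ^+ 2) <= A) ->
  (forall m, measurable_fun setT (D m)) -> (forall m w, `|D m w| <= K) ->
  {ae P, forall w, forall e, 0 < e -> exists N, forall m, (N <= m)%N ->
     S m w <= D m w + e} ->
  forall e, 0 < e -> exists N, forall m, (N <= m)%N -> - e <= Ex P (D m).
Proof.
move=> A0 K0 lS S0 SA mD DK SD e e0.
pose f m w := Num.min 1 (Num.max 0 (S m w - D m w)).
have f01 m w : 0 <= f m w <= 1.
  by rewrite /f le_min ler01 ge_min lexx /= le_max lexx.
have mS m : measurable_fun setT (S m) by exact: L2_measurable (lS m).
have mf m : measurable_fun setT (f m).
  apply: measurable_minr; first exact: measurable_cst.
  apply: measurable_maxr; first exact: measurable_cst.
  exact: measurable_funB.
have lf m : L1 P (f m).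
  apply: (@L1_bounded _ _ _ _ _ 1) => // w; have /andP[h1 h2] := f01 m w.
  by rewrite ger0_norm.
have lD m : L1 P (D m) by exact: (@L1_bounded _ _ _ _ _ K).
have fc : (fun m => (Ex P (f m))%:E) @ \oo --> 0%E.
  have [|||||_ _] := @dominated_convergence _ _ _ P setT measurableT
     (fun m w => (f m w)%:E) (cst 0%E) (cst 1%E).
  - by move=> m; apply/measurable_EFinP.
  - exact: measurable_cst.
  - apply: filterS SD => w hw _; apply/fine_cvgP; split; first by near=> m.
    apply/cvgrPdist_lt => r r0; have [N hN] := hw (r / 2) (divr_gt0 r0 (ltr0Sn _ 1)).
    exists N => // m /hN h; rewrite /= sub0r normrN.
    have /andP[h1 h2] := f01 m w; rewrite ger0_norm//.
    apply: (@le_lt_trans _ _ (r / 2)); last by rewrite ltr_pdivrMr// ltr_pMr// ltr1n.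
    rewrite /f ge_min ge_max; apply/orP; right; apply/andP; split.
      by rewrite divr_ge0// ltW.
    by rewrite lerBlDl.
  - exact: (L1_cst P 1).
  - by apply: aeW => w m _; rewrite lee_fin ger0_norm; have /andP[] := f01 m w.
  rewrite integral0 => h; apply: cvg_trans h; apply: near_eq_cvg.
  by near=> m; rewrite /= ExE.
(* This d makes the second moment term at most e / 2; then c, which depends on d, is fixed and the
   mean of f is brought below e / (2 c). *)
pose d := e / (2 * (A + 1)).
have A1 : 0 < 2 * (A + 1) by rewrite mulr_gt0// ltr_wpDl.
have d0 : 0 < d by exact: divr_gt0.
have dA : d * A <= e / 2.
  rewrite /d mulrAC ler_pdivrMr// -mulrA ler_pM2l//.
  have -> : 2^-1 * (2 * (A + 1)) = A + 1 by field.
  by rewrite lerDl.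
pose c := 1 + ((4 * d)^-1 + K).
have d4 : 0 <= (4 * d)^-1 by rewrite invr_ge0 mulr_ge0// ltW.
have c0 : 0 < c by rewrite /c ltr_pwDl// addr_ge0.
have [N hN] := cvge0_lt fc (divr_gt0 e0 (mulr_gt0 (ltr0Sn R 1) c0)).
exists N => m /hN; rewrite lte_fin => /ltW Ef.
have key w : S m w - D m w <= c * f m w + d * S m w ^+ 2.
  have /andP[f0 f1] := f01 m w; have dS : 0 <= d * S m w ^+ 2.
    by rewrite mulr_ge0 ?sqr_ge0// ltW.
  have cf : f m w <= c * f m w by rewrite ler_peMl// /c lerDl addr_ge0.
  have [X1|X1] := leP (S m w - D m w) 1.
    have : S m w - D m w <= f m w by rewrite /f le_min X1 le_max lexx orbT.
    move=> h; apply: le_trans h _; apply: le_trans cf _; by rewrite lerDl.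
  have -> : f m w = 1.
    by rewrite /f max_r ?min_l// ltW// (lt_trans ltr01).
  have := DK m w; rewrite ler_norml => /andP[DK1 _].
  have : S m w <= (4 * d)^-1 + d * S m w ^+ 2.
    have -> : (4 * d)^-1 + d * S m w ^+ 2 = S m w + d * (S m w - (2 * d)^-1) ^+ 2.
      by field; rewrite gt_eqF.
    by rewrite lerDl mulr_ge0 ?sqr_ge0// ltW.
  by rewrite mulr1 /c; move: DK1; lra.
have := Ex_le (L1B (L2_L1 (lS m)) (lD m)) (L1D (L1Z c (lf m)) (L1Z d (L2_sqr (lS m)))) key.
rewrite (ExB (L2_L1 (lS m)) (lD m)) S0 sub0r.
rewrite (ExD (L1Z c (lf m)) (L1Z d (L2_sqr (lS m)))) (ExZ _ (lf m)) (ExZ _ (L2_sqr (lS m))).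
have cE : c * Ex P (f m) <= e / 2.
  apply: le_trans (ler_wpM2l (ltW c0) Ef) _; rewrite le_eqVlt; apply/orP; left; apply/eqP.
  by field; rewrite gt_eqF.
have dE : d * Ex P (fun w => S m w ^+ 2) <= e / 2.
  by apply: le_trans dA; rewrite ler_pM2l.
move=> h; rewrite -lerN2 opprK; apply: le_trans h _.
by rewrite (splitr e) lerD.
Unshelve. all: by end_near. Qed.

End limit_tools.

(** * Martingale sums bounded in L2 *)

Section martingale_sums.
Context {R : realType} {dO : measure_display} {Omega : measurableType dO}.
Variable P : probability Omega R.
Variables (n : nat) (W : R -> Omega -> 'cV[R]_n).
Hypotheses (P_complete : measure_is_complete P) (W_bm : brownian_motion P W).

(** The coefficients enter A through B only, and the partition not at all, because the squared
    increments add up to the total one. [expectation_limit] needs this uniformity. *)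
Lemma mart_sum_bound (T B : R) (M : R -> Omega -> R) k (N : 'I_k -> R -> Omega -> R) :
  0 <= T -> 0 <= B -> L2mart P W M -> (forall j, L2mart P W (N j)) ->
  exists2 A, 0 <= A & forall pts h K tt, partition_of T pts h K tt ->
  forall (b : nat -> Omega -> R) (c : 'I_k -> nat -> Omega -> R),
  (forall i, adapted P W (tt i) (b i)) -> (forall j i, adapted P W (tt i) (c j i)) ->
  (forall i w, `|b i w| <= B) -> (forall j i w, `|c j i w| <= B) ->
  let S w := \sum_(i < K) (b i w * (M (tt i.+1) w - M (tt i) w) +
     \sum_j c j i w * (N j (tt i.+1) w - N j (tt i) w)) in
  [/\ L2 P S, Ex P S = 0 & Ex P (fun w => S w ^+ 2) <= A].
Proof.
move=> T0 B0 mM mN.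
pose dM w := M T w - M 0 w; pose dN j w := N j T w - N j 0 w.
exists (2 * B ^+ 2 * Ex P (fun w => dM w ^+ 2) +
  2 * k%:R * B ^+ 2 * \sum_j Ex P (fun w => dN j w ^+ 2)).
  apply: addr_ge0; apply: mulr_ge0.
  - by rewrite mulr_ge0 ?sqr_ge0.
  - by apply: Ex_ge0 => w; exact: sqr_ge0.
  - by rewrite !mulr_ge0 ?sqr_ge0.
  - by apply: sumr_ge0 => j _; apply: Ex_ge0 => w; exact: sqr_ge0.
move=> pts h K tt ptt b c ab ac bB cB S.
have tt0 := part_ge0 ptt; have ttm := part_mono ptt.
pose incM i w := M (tt i.+1) w - M (tt i) w.
pose incN j i w := N j (tt i.+1) w - N j (tt i) w.
have mdM : mdiff P W tt incM by exact: mdiff_mart.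
have mdN j : mdiff P W tt (incN j) by exact: mdiff_mart.
pose E i w := b i w * incM i w + \sum_j c j i w * incN j i w.
have mdE : mdiff P W tt E.
  apply: mdiffD.
    by apply: (mdiffM P_complete W_bm) => // i; exists B => w; exact: bB.
  apply: mdiff_sum => j.
  by apply: (mdiffM P_complete W_bm) => // i; exists B => w; exact: cB.
have lE i : L2 P (E i) by exact: mdiff_L2 mdE.
have lM i : L1 P (fun w => incM i w ^+ 2) by apply: L2_sqr; exact: mdiff_L2 mdM.
have lN j i : L1 P (fun w => incN j i w ^+ 2) by apply: L2_sqr; exact: mdiff_L2 (mdN j).
split; first by apply: L2_sum => i; exact: lE.
  exact: (mdiff_mean K mdE).
have -> : Ex P (fun w => S w ^+ 2) = \sum_(i < K) Ex P (fun w => E i w ^+ 2).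
  exact: (mdiff_sqr_sum ttm K mdE).
have sqB (x : R) : `|x| <= B -> x ^+ 2 <= B ^+ 2.
  by move=> xB; rewrite -(real_normK (num_real x)) lerXn2r ?nnegrE.
have step (i : 'I_K) : Ex P (fun w => E i w ^+ 2) <=
    2 * B ^+ 2 * Ex P (fun w => incM i w ^+ 2) +
    2 * k%:R * B ^+ 2 * \sum_j Ex P (fun w => incN j i w ^+ 2).
  have lsum : L1 P (fun w => \sum_j incN j i w ^+ 2) by exact: L1_sum.
  rewrite -(Ex_sum _ (fun j => lN j i)) -(ExZ _ (lM i)) -(ExZ _ lsum) -ExD; [|exact: L1Z..].
  apply: Ex_le; [exact: L2_sqr|by apply: L1D; exact: L1Z|move=> w].
  set u := b i w * incM i w; set v := \sum_j c j i w * incN j i w.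
  have uv : (u + v) ^+ 2 <= 2 * u ^+ 2 + 2 * v ^+ 2.
    have := sqrB_le u (- v); by rewrite opprK sqrrN.
  apply: le_trans uv _; apply: lerD.
    rewrite -mulrA ler_pM2l// /u exprMn ler_wpM2r ?sqr_ge0//; exact/sqB/bB.
  rewrite -2!mulrA ler_pM2l//; apply: le_trans (sum_sqr_le _) _.
  apply: ler_wpM2l => //; rewrite [leRHS]mulr_sumr. apply: ler_sum => j _.
  by rewrite exprMn ler_wpM2r ?sqr_ge0//; exact/sqB/cB.
apply: (le_trans (ler_sum _ (fun i _ => step i))).
rewrite big_split/= -!mulr_sumr (mart_sqr_increments tt0 ttm K mM) exchange_big/=.
under eq_bigr do rewrite (mart_sqr_increments tt0 ttm K (mN _)).
by rewrite (part_start ptt) (part_end ptt).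
Qed.

End martingale_sums.

(** * Growth of the mean of the Lyapunov function *)

Section good_paths.
Context {R : realType} {dO : measure_display} {Omega : measurableType dO}.
Variable P : probability Omega R.
Variables (n : nat) (W : R -> Omega -> 'cV[R]_n).
Hypotheses (P_complete : measure_is_complete P) (W_bm : brownian_motion P W).
Local Notation mu := (@lebesgue_measure R).

Lemma locally_lipschitzD (f g : 'cV[R]_n -> 'cV[R]_n) :
  locally_lipschitz_map f -> lipschitz_map g -> locally_lipschitz_map (f \+ g).
Proof.
move=> lf [L gL] x0; have [r [K [r0 fK]]] := lf x0; exists r, (K + L); split=> // x x' h h'.
rewrite /= opprD addrACA mulrDl; apply: le_trans (enorm_triangle _ _) _.
by apply: lerD; [exact: fK|exact: gL].
Qed.

Lemma M2_ae_integrable k (Z : R -> Omega -> 'M[R]_(k, n)) (T : R) : 0 < T ->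
  M2 P W Z -> {ae P, forall w, integrable_upto T (fun s => enorm (Z s w) ^+ 2)}.
Proof.
move=> T0 [pZ Zfin].
have mj : measurable_fun (time_strip T) (fun p : R * Omega => enorm (Z p.1 p.2) ^+ 2).
  under eq_fun do rewrite enorm_sqr.
  apply: measurable_sum => i; apply: measurable_sum => j; apply: measurable_funX.
  exact: (progressive_joint P_complete W_bm (pZ i j) (ltW T0)).
have ZE0 s w : 0 <= enorm (Z s w) ^+ 2 by exact: sqr_ge0.
have mI := measurable_time_integral ZE0 mj.
have I0 w : (0 <= \int[mu]_(s in `[0%R, T]) (enorm (Z s w) ^+ 2)%:E)%E.
  by apply: integral_ge0 => s _; rewrite lee_fin.
have int : P.-integrable setT (fun w => \int[mu]_(s in `[0%R, T]) (enorm (Z s w) ^+ 2)%:E)%E.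
  apply/integrableP; split => //.
  by under eq_integral do rewrite gee0_abs//; exact: Zfin.
apply: filterS (integrable_ae measurableT int) => w /(_ I) fin.
apply/integrableP; split.
  by apply/measurable_EFinP; exact: (@measurable_time_section _ _ _ (fun s w => enorm (Z s w) ^+ 2) T w mj).
under eq_integral do rewrite /= ger0_norm//.
by rewrite ltey_eq fin.
Qed.

Variables (dis b : 'cV[R]_n -> 'cV[R]_n) (sigma : 'cV[R]_n -> 'M[R]_n)
  (psi : 'cV[R]_n -> 'rV[R]_n -> R) (x : 'cV[R]_n) (V : R -> Omega -> 'cV[R]_n)
  (Y Y' : R -> Omega -> R) (Z Z' : R -> Omega -> 'rV[R]_n) (lambda lambda' C1 : R)
  (J1 : R -> Omega -> 'cV[R]_n) (J2 J3 : R -> Omega -> 'cV[R]_1)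
  (eta Bb sg M : R).
Hypotheses (dis_diss : dissipative eta dis) (dis_ll : locally_lipschitz_map dis)
  (b_lip : lipschitz_map b) (b_bd : forall x, enorm (b x) <= Bb)
  (sg_bd : forall x, enorm (sigma x) <= sg)
  (psi_c : forall z, continuous (psi ^~ z))
  (psi_b : forall x z z', `|psi x 0| <= M /\ `|psi x z - psi x z'| <= M * enorm (z - z')).
Hypotheses (ito1 : ito_integral P W (fun s w => sigma (V s w)) J1)
  (ito2 : ito_integral P W Z J2) (ito3 : ito_integral P W Z' J3).
Variables (a th kap C0 T : R).
Let lt := lambda - lambda'.
Let K1 := enorm (dis 0) + Bb.
Hypotheses (a0 : 0 < a) (th0 : 0 < th) (T0 : 0 <= T) (C10 : 0 <= C1).
Hypothesis quartic : forall p : R, 0 <= p ->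
  - C0 <= 4 * eta * p ^+ 4 - (4 * K1 + 4 * M * sg) * p ^+ 3 - 80 * sg ^+ 2 * (1 + p ^+ 2).
Hypothesis kapE : kap <= a * lt - a * th * C0 - 4 * M ^+ 2.

(* Almost surely the minimum is [Y - Y'], by the growth hypothesis; the truncation makes
   the function bounded for every outcome. *)
Definition lyapunov (t : R) (w : Omega) : R := expR (a * (Num.min (Y t w - Y' t w)
  (C1 * (1 + enorm (V t w) ^+ 2)) - th * (enorm (V t w) ^+ 2) ^+ 2)).

(** First order martingale part of the increment of Y - Y' - th |V|^4, the [dN] of
    [pathwise_fixed]. *)
Definition mart_increment (tt : nat -> R) (i : nat) (w : Omega) : R :=
  J2 (tt i.+1) w 0 0 - J3 (tt i.+1) w 0 0 - (J2 (tt i) w 0 0 - J3 (tt i) w 0 0) -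
  4 * th * enorm (V (tt i) w) ^+ 2 *
    inner (V (tt i) w) (J1 (tt i.+1) w - J1 (tt i) w).

Record good_path (w : Omega) : Prop := {
  gp_V : {within `[0, +oo[, continuous (V ^~ w)};
  gp_Y : {within `[0, +oo[, continuous (Y ^~ w)};
  gp_Y' : {within `[0, +oo[, continuous (Y' ^~ w)};
  gp_Veq : forall t : R, 0 <= t -> V t w =
    x + \col_i (\int[mu]_(s in `[0, t]) (dis \+ b) (V s w) i 0) + J1 t w;
  gp_Yeq : forall t T : R, 0 <= t <= T -> Y t w = Y T w
    + \int[mu]_(s in `[t, T]) (psi (V s w) (Z s w) - lambda) - (J2 T w 0 0 - J2 t w 0 0);
  gp_Yeq' : forall t T : R, 0 <= t <= T -> Y' t w = Y' T w
    + \int[mu]_(s in `[t, T]) (psi (V s w) (Z' s w) - lambda') - (J3 T w 0 0 - J3 t w 0 0);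
  gp_growth : forall t : R, 0 <= t -> `|Y t w - Y' t w| <= C1 * (1 + enorm (V t w) ^+ 2);
  gp_Z : integrable_upto T (fun s => enorm (Z s w) ^+ 2);
  gp_Z' : integrable_upto T (fun s => enorm (Z' s w) ^+ 2) }.

Let M0 : 0 <= M.
Proof. by have [h _] := psi_b 0 0 0; exact: le_trans h. Qed.

Let measurable_section (Zv : R -> Omega -> 'rV[R]_n) J w j :
  ito_integral P W Zv J -> measurable_fun `[0, T] (fun s => Zv s w 0 j).
Proof.
move=> [[pZ _] _ _ _].
exact: (@measurable_time_section _ _ _ (fun s w => Zv s w 0 j) T w
  (progressive_joint P_complete W_bm (pZ 0 j) T0)).
Qed.

Let integrable_driver (Zv : R -> Omega -> 'rV[R]_n) J w : ito_integral P W Zv J ->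
  {within `[0, +oo[, continuous (V ^~ w)} ->
  integrable_upto T (fun s => enorm (Zv s w) ^+ 2) ->
  integrable_upto T (fun s => psi (V s w) (Zv s w)).
Proof.
move=> itoZ cV iZ.
apply: (@integrable_upto_le _ _ _ (fun s => 2 * M + M * enorm (Zv s w) ^+ 2)).
- apply: (measurable_driver M0 psi_c).
  + by move=> x1 z z'; have [_] := psi_b x1 z z'.
  + by apply: continuous_subspaceW cV => z /=; rewrite !in_itv/= => /andP[-> _].
  + by move=> j; exact: measurable_section itoZ.
- move=> s _; have [h1 h2] := psi_b (V s w) (Zv s w) 0; rewrite subr0 in h2.
  have := ler_normD (psi (V s w) (Zv s w) - psi (V s w) 0) (psi (V s w) 0).
  rewrite subrK => h3; apply: le_trans h3 _; apply: le_trans (lerD h2 h1) _.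
  set z := enorm (Zv s w); have -> : 2 * M + M * z ^+ 2 = M * (1 + z ^+ 2) + M by ring.
  rewrite lerD2r; apply: ler_wpM2l => //.
  have := sqr_ge0 (z - 1 / 2); nra.
- by apply: integrable_uptoD; [exact: integrable_upto_cst|exact: integrable_uptoZ].
Qed.

Lemma good_path_limit w : good_path w ->
  forall e, 0 < e -> exists2 d : R, 0 < d &
  forall (D : stage P W) pts h, h <= d ->
  partition_of T pts h (st_size D) (st_time D) ->
  {subset sp_times (st_S1 D) <= pts} -> {subset sp_times (st_S2 D) <= pts} ->
  {subset sp_times (st_S3 D) <= pts} ->
  (st_error T th lyapunov V (fun s w => sigma (V s w)) J1 Z Z' J2 J3 D w <= d%:E)%E ->
  \sum_(i < st_size D) a * (lyapunov (st_time D i) w * mart_increment (st_time D) i w)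
  <= lyapunov T w - lyapunov 0 w - kap * (\sum_(i < st_size D)
       lyapunov (st_time D i) w * (st_time D i.+1 - st_time D i)) + e.
Proof.
move=> [cV cY cY' Veq Yeq Yeq' growth iZ iZ'].
pose f := dis \+ b; pose fs s := f (V s w).
have pv : pcont T (V ^~ w) by exact: pcont_within.
have pf : pcont T fs by apply: (pcont_comp pv); exact: locally_lipschitzD.
have /pcont_entries rv := pv; have /pcont_entries rf := pf.
have fs_int j : integrable_upto T (fun s => fs s j 0) by exact: rcont_integrable.
have ipsi := integrable_driver ito2 cV iZ.
have ipsi' := integrable_driver ito3 cV iZ'.
pose gs s := psi (V s w) (Z s w) - psi (V s w) (Z' s w).
have gs_int : integrable_upto T gs by exact: integrable_uptoB.
pose zeta s := Z s w - Z' s w.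
have zeta_int : integrable_upto T (fun s => enorm (zeta s) ^+ 2).
  apply: (@integrable_upto_le _ _ _ (fun s => 2 * enorm (Z s w) ^+ 2 +
     2 * enorm (Z' s w) ^+ 2)).
  - rewrite (_ : (fun s => _) = (fun s => \sum_j (Z s w 0 j - Z' s w 0 j) ^+ 2)).
      apply: measurable_sum => j; apply: measurable_funX.
      by apply: measurable_funB; [exact: measurable_section ito2|exact: measurable_section ito3].
    apply/funext => s; rewrite enorm_sqr big_ord1; apply: eq_bigr => j _.
    by rewrite !mxE.
  - move=> s _; rewrite ger0_norm ?sqr_ge0//.
    by have := enorm_add_sqr (Z s w) (- Z' s w); rewrite enormN.
  - by apply: integrable_uptoD; exact: integrable_uptoZ.
have v_eq s t : 0 <= s -> s <= t -> t <= T ->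
    V t w = V s w + \col_j Itg (fun x => fs x j 0) s t + (J1 t w - J1 s w).
  move=> s0 st tT; have t0 := le_trans s0 st; rewrite (Veq t t0) (Veq s s0).
  apply/matrixP => i j; rewrite !mxE (Itg_sub (fs_int i) s0 st tT) /Itg /fs /f /=; ring.
(* Read forward in time, the difference of the two backward equations has drift lt - gs. *)
have y_eq s t : 0 <= s -> s <= t -> t <= T -> Y t w - Y' t w = (Y s w - Y' s w) +
    Itg (fun x => lt - gs x) s t +
    (J2 t w 0 0 - J3 t w 0 0 - (J2 s w 0 0 - J3 s w 0 0)).
  move=> s0 st tT; have sst : 0 <= s <= t by rewrite s0.
  have -> : (fun x => lt - gs x) = (fun x => (psi (V x w) (Z' x w) - lambda') -
      (psi (V x w) (Z x w) - lambda)).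
    by apply/funext => r; rewrite /lt /gs; ring.
  rewrite (ItgB s0 tT); [|by apply: integrable_uptoB => //; exact: integrable_upto_cst..].
  rewrite (Yeq _ _ sst) (Yeq' _ _ sst) /Itg; ring.
have gsM s : 0 <= s <= T -> `|gs s| <= M * enorm (zeta s).
  by move=> _; have [_] := psi_b (V s w) (Z s w) (Z' s w).
have f_dissip s : 0 <= s <= T ->
    inner (V s w) (fs s) <= - eta * enorm (V s w) ^+ 2 + K1 * enorm (V s w).
  move=> _; set v := V s w; have := dis_diss v 0; rewrite !subr0 => d1.
  (* Dissipativity is used between V and 0; what remains is at most (|dis 0| + Bb) |V|, whence
     K1. *)
  have -> : inner v (fs s) = inner (dis v - dis 0) v + (inner v (dis 0) + inner v (b v)).
    rewrite (innerC _ v) -innerDr -innerDr; congr (inner _ _).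
    by rewrite /fs /f /= addrA subrK.
  apply: lerD => //; rewrite /K1 mulrDl; apply: lerD.
    by apply: le_trans (ler_norm _) _; rewrite mulrC; exact: cauchy_schwarz.
  apply: le_trans (ler_norm _) _; apply: le_trans (cauchy_schwarz _ _) _.
  by rewrite mulrC ler_wpM2r ?enorm_ge0.
have [Kv vK] := pcont_bounded pv; have [Kf fK] := pcont_bounded pf.
pose y s := Y s w - Y' s w.
pose U s := a * (y s - th * (enorm (V s w) ^+ 2) ^+ 2).
have rq : rcont T (fun s => enorm (V s w) ^+ 2).
  under eq_fun do rewrite enorm_sqr.
  apply: rcont_sum => i; apply: rcont_sum => j; under eq_fun do rewrite expr2.
  by apply: rcontM; exact: rv.
have rU : rcont T U.
  apply: rcontM; first exact: rcont_cst.
  apply: rcontB; last first.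
    apply: rcontM; first exact: rcont_cst.
    by under eq_fun do rewrite expr2; exact: rcontM.
  by apply: rcontB; [apply: continuous_subspaceW cY|apply: continuous_subspaceW cY'];
    move=> z /=; rewrite !in_itv/= => /andP[->].
(* Viewed as a 1 by 1 matrix, the exponent falls under [heine]. *)
have pU : pcont T (fun s => const_mx (U s) : 'M[R]_1).
  by apply/pcont_entries => i j; under eq_fun do rewrite mxE.
have gE s : 0 <= s <= T -> lyapunov s w = expR (U s).
  move=> /andP[s0 _]; rewrite /lyapunov min_l//.
  by apply: le_trans (growth s s0); exact: ler_norm.
have B_le s : lyapunov s w <= expR ((a * C1 + 4) + (a * C1 + 4) ^+ 2 / (4 * (a * th))).
  have := @truncated_exp_bound R a th C1 (enorm (V s w) ^+ 2) (Y s w - Y' s w)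
     a0 th0 C10 (sqr_ge0 _).
  apply: le_trans; rewrite ler_peMr ?expR_ge0// exprn_ege1// lerDl; exact: sqr_ge0.
have sg0 : 0 <= sg by apply: le_trans (sg_bd 0); exact: enorm_ge0.
apply: (@pathwise_limit _ _ _ P n W P_complete W_bm T th lyapunov V T0 (ltW th0)
  (fun s w => sigma (V s w)) J1 Z Z' J2 J3 ito1 ito2 ito3 w a kap lt M sg eta K1 C0
  (1 + Kv ^+ 2) _ Kf (Itg (fun s => enorm (zeta s) ^+ 2) 0 T) fs y gs
  a0 M0 sg0 quartic kapE fs_int gs_int zeta_int (lexx _) v_eq y_eq gsM _ f_dissip _ _ gE
  (fun s _ => B_le s) _).
- by move=> s _; exact: sg_bd.
- move=> s sT; rewrite lerD2l lerXn2r ?nnegrE ?enorm_ge0//; last exact: vK.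
  exact: le_trans (enorm_ge0 _) (vK s sT).
- by move=> s j sT; apply: le_trans (fK s sT); exact: normr_entry_le_enorm.
move=> e e0; have [d1 d10 h1] := heine pv e0; have [d2 d20 h2] := heine pf e0.
have [d3 d30 h3] := heine pU e0.
exists (Num.min d1 (Num.min d2 d3)); first by rewrite !lt_min d10 d20.
move=> s t sT tT; rewrite !le_min => /and3P[m1 m2 m3].
split; [exact: h1|exact: h2|].
apply: le_trans (h3 s t sT tT m3).
by have := normr_entry_le_enorm (const_mx (U t) - const_mx (U s) : 'M[R]_1) 0 0; rewrite !mxE.
Qed.

Let Bg : R := expR ((a * C1 + 4) + (a * C1 + 4) ^+ 2 / (4 * (a * th))).

Lemma lyapunov_ge0 t w : 0 <= lyapunov t w.
Proof. exact: expR_ge0. Qed.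

Lemma lyapunov_bound t w : lyapunov t w * (1 + enorm (V t w) ^+ 2) ^+ 4 <= Bg.
Proof. by apply: truncated_exp_bound => //; exact: sqr_ge0. Qed.

Lemma lyapunov_le t w : lyapunov t w <= Bg.
Proof.
apply: le_trans (lyapunov_bound t w); rewrite ler_peMr ?lyapunov_ge0//.
by rewrite exprn_ege1// lerDl; exact: sqr_ge0.
Qed.

Hypotheses (pV : progressive_mx P W V) (pY : progressive P W Y) (pY' : progressive P W Y').

Lemma lyapunov_adapted t : 0 <= t -> adapted P W t (lyapunov t).
Proof.
move=> t0; have aq : adapted P W t (fun w => enorm (V t w) ^+ 2).
  under eq_fun do rewrite enorm_sqr.
  apply: adapted_sum => i; apply: adapted_sum => j; apply: measurable_funX.
  exact: progressive_adapted (pV i j) t0.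
apply: measurableT_comp => //; apply: adaptedM; first exact: adapted_cst.
apply: adaptedB; last by apply: adaptedM; [exact: adapted_cst|exact: measurable_funX].
apply: measurable_minr.
  by apply: adaptedB; [exact: progressive_adapted pY t0|exact: progressive_adapted pY' t0].
by apply: adaptedM; [exact: adapted_cst|apply: adaptedD => //; exact: adapted_cst].
Qed.

Lemma lyapunov_L1 t : 0 <= t -> L1 P (lyapunov t).
Proof.
move=> t0; apply: (@L1_bounded _ _ _ _ _ Bg).
  exact: (adapted_measurable P_complete W_bm (lyapunov_adapted t0)).
by move=> w; rewrite ger0_norm ?lyapunov_ge0//; exact: lyapunov_le.
Qed.

Hypothesis good_ae : {ae P, forall w, good_path w}.

(** Stages of mean error at most 2^-(m + 1) and mesh at most 1 / (m + 1) are fixed for all outcomes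
    at once; summability sends their errors to 0 almost surely. The index from which the pathwise
    inequality holds depends on the outcome, so means are taken through [expectation_limit], the
    martingale sums being centred and bounded in L2. *)
Lemma lyapunov_growth (e : R) : 0 < e -> exists pts h K tt, partition_of T pts h K tt /\
  Ex P (lyapunov 0) + kap * (\sum_(i < K) Ex P (lyapunov (tt i)) * (tt i.+1 - tt i))
  <= Ex P (lyapunov T) + e.
Proof.
move=> e0; have Bg0 : 0 <= Bg by exact: expR_ge0.
have aV t i : 0 <= t -> adapted P W t (fun w => V t w i 0).
  by move=> t0; exact: progressive_adapted (pV i 0) t0.
pose err (D : stage P W) := st_error T th lyapunov V (fun s w => sigma (V s w)) J1 Z Z' J2 J3 D.
have /choice[D hD] : forall m : nat, exists D : stage P W,
  [/\ exists pts, partition_of T pts (m.+1%:R^-1) (st_size D) (st_time D) /\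
        [/\ {subset sp_times (st_S1 D) <= pts}, {subset sp_times (st_S2 D) <= pts} &
         {subset sp_times (st_S3 D) <= pts}],
   measurable_fun setT (err D) & (\int[P]_w err D w <= (1 / (2 ^ m.+1)%:R)%:E)%E].
  move=> m; apply: (stage_exists P_complete W_bm T0 (ltW th0) lyapunov_ge0 lyapunov_bound
    lyapunov_adapted aV ito1 ito2 ito3).
    by rewrite divr_gt0// ltr0n expn_gt0.
  by rewrite invr_gt0.
pose tt m := st_time (D m); pose K m := st_size (D m).
have ptt m : exists pts, partition_of T pts (m.+1%:R^-1) (K m) (tt m).
  by have [[pts [h _]] _ _] := hD m; exists pts.
have tt0 m i : 0 <= tt m i by have [pts h] := ptt m; exact: (part_ge0 h).
have err_ge0 m w : (0 <= err (D m) w)%E.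
  have i0 k (H : R -> Omega -> 'M[R]_(k, n)) (S : simple_process P W k) :
    (0 <= approx_error H T S w)%E by apply: integral_ge0 => s _; rewrite lee_fin sqr_ge0.
  apply: adde_ge0; first by apply: adde_ge0 => //; exact: adde_ge0.
  rewrite lee_fin; apply: addr_ge0; last exact: addr_ge0.
  by apply: addr_ge0; [|apply: addr_ge0]; apply: sumr_ge0 => i _; exact: sqr_ge0.
have err0 : {ae P, forall w, (fun m => err (D m) w) @ \oo --> 0%E}.
  apply: ae_cvg0_geometric => //.
  - by move=> m; have [] := hD m.
  - by move=> m; have [] := hD m.
(* Common bound for the coefficients a G and 4 a th G |V|^2 V_j of the martingale increments; the
   second one uses |V|^3 <= (1 + |V|^2)^4. *)
pose B := a * Bg + 4 * a * th * Bg.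
have th4 : 0 <= 4 * a * th by rewrite !mulr_ge0// ltW.
have B0 : 0 <= B by apply: addr_ge0; apply: mulr_ge0 => //; exact: ltW.
have mz : L2mart P W (fun t w => J2 t w 0 0 - J3 t w 0 0).
  by apply: L2martB; [exact: (L2mart_ito P_complete W_bm 0 ito2)|
    exact: (L2mart_ito P_complete W_bm 0 ito3)].
have mJ j : L2mart P W (fun t w => J1 t w j 0) by exact: (L2mart_ito P_complete W_bm j ito1).
have [A A0 hA] := mart_sum_bound P_complete W_bm T0 B0 mz mJ.
pose S m w := \sum_(i < K m) a * (lyapunov (tt m i) w * mart_increment (tt m) i w).
pose inc m w := lyapunov T w - lyapunov 0 w - kap * (\sum_(i < K m)
       lyapunov (tt m i) w * (tt m i.+1 - tt m i)).
have SE m : [/\ L2 P (S m), Ex P (S m) = 0 & Ex P (fun w => S m w ^+ 2) <= A].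
  have [pts pm] := ptt m.
  pose b0 i w := a * lyapunov (tt m i) w.
  pose c (j : 'I_n) i w := - (4 * a * th) * (lyapunov (tt m i) w *
    (enorm (V (tt m i) w) ^+ 2 * V (tt m i) w j 0)).
  have := hA _ _ _ _ pm b0 c; rewrite (_ : (fun w => _) = S m); last first.
    apply/funext => w; apply: eq_bigr => i _.
    have -> : a * (lyapunov (tt m i) w * mart_increment (tt m) i w) =
      b0 i w * (J2 (tt m i.+1) w 0 0 - J3 (tt m i.+1) w 0 0 -
       (J2 (tt m i) w 0 0 - J3 (tt m i) w 0 0)) +
      - (4 * a * th) * (lyapunov (tt m i) w * enorm (V (tt m i) w) ^+ 2) *
      inner (V (tt m i) w) (J1 (tt m i.+1) w - J1 (tt m i) w).
      by rewrite /mart_increment /b0; ring.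
    congr (_ + _); rewrite mulr_sumr; apply: eq_bigr => j _; rewrite big_ord1 !mxE /c; ring.
  apply.
  - by move=> i; apply: adaptedM; [exact: adapted_cst|exact: lyapunov_adapted].
  - move=> j i; apply: adaptedM; first exact: adapted_cst.
    apply: adaptedM; first exact: lyapunov_adapted.
    apply: adaptedM; last exact: aV.
    under eq_fun do rewrite enorm_sqr.
    apply: adapted_sum => k; apply: adapted_sum => l; apply: measurable_funX.
    exact: progressive_adapted (pV k l) (tt0 m i).
  - move=> i w; rewrite /b0 ger0_norm ?mulr_ge0 ?lyapunov_ge0 ?(ltW a0)//.
    rewrite /B; apply: (@le_trans _ _ (a * Bg)); last by rewrite lerDl mulr_ge0.
    by rewrite ler_pM2l// lyapunov_le.
  - move=> j i w; rewrite /c normrM normrN (ger0_norm th4).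
    rewrite /B; apply: (@le_trans _ _ (4 * a * th * Bg)); last by rewrite lerDr mulr_ge0// ltW.
    apply: ler_wpM2l => //; rewrite normrM (ger0_norm (lyapunov_ge0 _ _)).
    apply: le_trans (lyapunov_bound (tt m i) w); apply: ler_wpM2l; first exact: lyapunov_ge0.
    rewrite normrM (ger0_norm (sqr_ge0 _)).
    have := normr_entry_le_enorm (V (tt m i) w) j 0; set v := enorm (V (tt m i) w) => vj.
    have v0 : 0 <= v := enorm_ge0 _.
    apply: (@le_trans _ _ (v ^+ 2 * v)); first by rewrite ler_wpM2l ?sqr_ge0.
    apply: (@le_trans _ _ ((1 + v ^+ 2) ^+ 2)).
      rewrite [leRHS]expr2; apply: ler_pM => //; rewrite ?sqr_ge0// ?lerDr//.
      have := sqr_ge0 (v - 1 / 2); nra.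
    by apply: ler_weXn2l => //; rewrite lerDl sqr_ge0.
have lg t : 0 <= t -> L1 P (lyapunov t) by exact: lyapunov_L1.
have lsum m : L1 P (fun w => \sum_(i < K m) lyapunov (tt m i) w * (tt m i.+1 - tt m i)).
  apply: L1_sum => i; under eq_fun do rewrite mulrC; apply: L1Z; exact: lg.
have linc m : L1 P (inc m).
  by apply: L1B; [apply: L1B; exact: lg|exact: L1Z].
have incE m : Ex P (inc m) = Ex P (lyapunov T) - Ex P (lyapunov 0) -
    kap * (\sum_(i < K m) Ex P (lyapunov (tt m i)) * (tt m i.+1 - tt m i)).
  have lT0 : L1 P (fun w => lyapunov T w - lyapunov 0 w) by apply: L1B; exact: lg.
  rewrite /inc (ExB lT0 (L1Z kap (lsum m))) (ExB (lg _ T0) (lg _ (lexx 0))) (ExZ _ (lsum m)).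
  congr (_ - _ * _); rewrite Ex_sum.
    apply: eq_bigr => i _; rewrite [RHS]mulrC -(ExZ _ (lg _ (tt0 m i))).
    by apply: eq_Ex => w; rewrite mulrC.
  by move=> i; under eq_fun do rewrite mulrC; apply: L1Z; exact: lg.
pose C := 2 * Bg + `|kap| * (Bg * T).
have C_ge0 : 0 <= C by rewrite /C addr_ge0// !mulr_ge0.
have inc_le m w : `|inc m w| <= C.
  have [pts pm] := ptt m.
  have gn t : `|lyapunov t w| <= Bg by rewrite ger0_norm ?lyapunov_ge0// lyapunov_le.
  apply: le_trans (ler_normB _ _) _; apply: lerD.
    apply: le_trans (ler_normB _ _) _.
    have -> : 2 * Bg = Bg + Bg by ring.
    exact: lerD.
  rewrite normrM ler_wpM2l// ger0_norm; last first.
    by apply: sumr_ge0 => i _; rewrite mulr_ge0 ?lyapunov_ge0// subr_ge0 (part_mono pm).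
  apply: (@le_trans _ _ (\sum_(i < K m) Bg * (tt m i.+1 - tt m i))).
    apply: ler_sum => i _; rewrite ler_wpM2r ?lyapunov_le// subr_ge0; exact: (part_mono pm).
  rewrite -mulr_sumr -(big_mkord xpredT (fun i => tt m i.+1 - tt m i)) telescope_sumr//.
  by rewrite (part_start pm) (part_end pm) subr0.
have [N /(_ N (leqnn N))] : exists N, forall m, (N <= m)%N -> - e <= Ex P (inc m).
  apply: (@expectation_limit _ _ _ P S inc A C) => //.
  - by move=> m; have [] := SE m.
  - by move=> m; have [] := SE m.
  - by move=> m; have [] := SE m.
  - by move=> m; exact: L1_measurable (linc m).
  apply: filterS2 good_ae err0 => w gw ew r r0.
  have [d d0 hd] := good_path_limit gw r0.
  have [N1 hN1] := cvge0_lt ew d0.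
  have [N2 hN2] : exists N, (N.+1%:R^-1 : R) <= d.
    exists (Num.truncn d^-1); rewrite invf_ple ?posrE// ltW//.
    by have := truncnS_gt d^-1.
  exists (maxn N1 N2) => m; rewrite geq_max => /andP[m1 m2].
  have [[pts [pm [i1 i2 i3]]] _ _] := hD m.
  have h1 : m.+1%:R^-1 <= d.
    by apply: le_trans hN2; rewrite lef_pV2 ?posrE// ler_nat ltnS.
  exact: hd (D m) pts _ h1 pm i1 i2 i3 (ltW (hN1 m m1)).
rewrite incE => h; have [pts pN] := ptt N.
exists pts, (N.+1%:R^-1), (K N), (tt N); split => //.
by move: h; rewrite -addrA -opprD lerBrDl lerBlDr.
Qed.

End good_paths.

(** * Comparison of the two ergodic constants *)

Lemma ergodic_constant_le (R : realType) (n : nat)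
  (dO : measure_display) (Omega : measurableType dO) (P : probability Omega R)
  (P_complete : measure_is_complete P)
  (W : R -> Omega -> 'cV[R]_n) (W_bm : brownian_motion P W)
  (dis b : 'cV[R]_n -> 'cV[R]_n) (sigma : 'cV[R]_n -> 'M[R]_n)
  (hA : hypothesis_A dis b sigma)
  (psi : 'cV[R]_n -> 'rV[R]_n -> R) (hP : hypothesis_P psi)
  (x : 'cV[R]_n) (V : R -> Omega -> 'cV[R]_n)
  (V_sde : sde_solution P W (dis \+ b) sigma x V)
  (Y Y' : R -> Omega -> R) (Z Z' : R -> Omega -> 'rV[R]_n)
  (lambda lambda' : R)
  (sol : ebsde_solution P W psi V Y Z lambda)
  (sol' : ebsde_solution P W psi V Y' Z' lambda')
  (C C' : R)
  (Y_growth : {ae P, forall w, forall t : R, 0 <= t ->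
    `|Y t w| <= C * (1 + enorm (V t w) ^+ 2)})
  (Y'_growth : {ae P, forall w, forall t : R, 0 <= t ->
    `|Y' t w| <= C' * (1 + enorm (V t w) ^+ 2)}) :
  lambda <= lambda'.
Proof.
have contra (u s X B : R) : u + s <= X + u -> X <= B -> B < s -> False by lra.
rewrite leNgt; apply/negP => lam; pose lt := lambda - lambda'.
have lt0 : 0 < lt by rewrite subr_gt0.
case: hA => [[eta eta0 diss] dll _ blip [Bb bB] _ _ [sg sgB'] _].
have sgB y : enorm (sigma y) <= sg by have [] := sgB' y.
case: hP => _ psic [M psiM].
have [pV cV [J1 ito1 Veq]] := V_sde.
have [pY cY mZ [J2 ito2 Yeq]] := sol; have [pY' cY' mZ' [J3 ito3 Yeq']] := sol'.
have M0 : 0 <= M by have [h _] := psiM 0 0 0; exact: le_trans h.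
have sg0 : 0 <= sg := le_trans (enorm_ge0 _) (sgB 0).
have Bb0 : 0 <= Bb := le_trans (enorm_ge0 _) (bB 0).
pose K1 := enorm (dis 0) + Bb.
have K10 : 0 <= K1 by apply: addr_ge0 => //; exact: enorm_ge0.
have [C0 C00 quartic] : exists2 C0 : R, 0 <= C0 & forall p : R, 0 <= p ->
  - C0 <= 4 * eta * p ^+ 4 - (4 * K1 + 4 * M * sg) * p ^+ 3 - 80 * sg ^+ 2 * (1 + p ^+ 2).
  apply: quartic_lower_bound; first exact: mulr_gt0.
  - by apply: addr_ge0; rewrite !mulr_ge0.
  - by rewrite mulr_ge0 ?sqr_ge0.
have C1p : 0 < C0 + 1 by rewrite ltr_wpDl.
(* [th] makes the quartic penalty cost at most [a lt / 4], and [a] makes the Lipschitz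
   error [4 M^2] of the driver at most [a lt / 4]. *)
pose th := lt / (4 * (C0 + 1)); pose a := 16 * M ^+ 2 / lt + 1.
have th0 : 0 < th by rewrite divr_gt0// mulr_gt0.
have a0 : 0 < a by rewrite /a ltr_wpDl// divr_ge0 ?(ltW lt0)// mulr_ge0// sqr_ge0.
pose kap := a * lt / 2; have kap0 : 0 < kap by rewrite divr_gt0// mulr_gt0.
have kapE : kap <= a * lt - a * th * C0 - 4 * M ^+ 2.
  have aE : a * lt = 16 * M ^+ 2 + lt by rewrite /a; field; rewrite gt_eqF.
  have tC : th * C0 <= lt / 4.
    have -> : th * C0 = lt / 4 * (C0 / (C0 + 1)) by rewrite /th; field; rewrite gt_eqF.
    by rewrite ler_piMr ?divr_ge0 ?(ltW lt0)// ler_pdivrMr// mul1r lerDl.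
  have := ler_wpM2l (ltW a0) tC; rewrite /kap mulrA => h.
  have e4 : a * (lt / 4) = (16 * M ^+ 2 + lt) / 4 by rewrite mulrA aE.
  rewrite e4 in h; rewrite aE; lra.
pose C1 := `|C| + `|C'|; have C10 : 0 <= C1 by rewrite addr_ge0.
have good T : 0 < T -> {ae P, forall w,
    good_path dis b psi x V Y Y' Z Z' lambda lambda' C1 J1 J2 J3 T w}.
  move=> T0; near=> w; split; near: w; [exact: cV|exact: cY|exact: cY'|exact: Veq|
    exact: Yeq|exact: Yeq'| |exact: (M2_ae_integrable P_complete W_bm T0 mZ)|
    exact: (M2_ae_integrable P_complete W_bm T0 mZ')].
  apply: filterS2 Y_growth Y'_growth => w g1 g2 t t0.
  apply: le_trans (ler_normB _ _) _; rewrite /C1 mulrDl.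
  have q0 : 0 <= 1 + enorm (V t w) ^+ 2 by rewrite addr_ge0 ?sqr_ge0.
  apply: lerD; [apply: le_trans (g1 t t0) _|apply: le_trans (g2 t t0) _];
    by rewrite ler_wpM2r// ler_norm.
pose L := lyapunov V Y Y' C1 a th.
have L_ge0 t : 0 <= Ex P (L t) by apply: Ex_ge0 => w; exact: expR_ge0.
have growth T e : 0 < T -> 0 < e -> exists pts h K tt, partition_of T pts h K tt /\
    Ex P (L 0) + kap * (\sum_(i < K) Ex P (L (tt i)) * (tt i.+1 - tt i)) <= Ex P (L T) + e.
  move=> T0 e0; exact: (lyapunov_growth P_complete W_bm diss dll blip bB sgB psic psiM
    ito1 ito2 ito3 a0 th0 (ltW T0) C10 quartic kapE pV pY pY' (good T T0) e0).
have lL t : 0 <= t -> L1 P (L t) by exact: (lyapunov_L1 P_complete W_bm).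
have u0 : 0 < Ex P (L 0) by apply: Ex_gt0 => [|w]; [exact: lL|exact: expR_gt0].
have L_ge t : 0 <= t -> Ex P (L 0) <= Ex P (L t).
  rewrite le_eqVlt => /predU1P[<-//|t0]; apply/ler_addgt0Pr => e e0.
  have [pts [h [K [tt [pK]]]]] := growth t e t0 e0; apply: le_trans; rewrite lerDl.
  apply: mulr_ge0; first exact: ltW.
  apply: sumr_ge0 => i _; apply: mulr_ge0; first exact: L_ge0.
  by rewrite subr_ge0; exact: (part_mono pK i).
pose Bg := expR ((a * C1 + 4) + (a * C1 + 4) ^+ 2 / (4 * (a * th))).
have LB t : 0 <= t -> Ex P (L t) <= Bg.
  move=> t0; rewrite -[Bg](Ex_cst P); apply: Ex_le => [||w]; [exact: lL|exact: L1_cst|].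
  exact: lyapunov_le.
(* At this time the linear lower bound kap E(L 0) T equals Bg + 1, above the uniform bound Bg. *)
pose T := (Bg + 1) / (kap * Ex P (L 0)).
have ku0 : 0 < kap * Ex P (L 0) by exact: mulr_gt0.
have T0 : 0 < T by rewrite divr_gt0// ltr_wpDl// expR_ge0.
(* The slack is taken equal to E(L 0), so that it cancels the initial term. *)
have [pts [d [K [tt [pK]]]]] := growth T (Ex P (L 0)) T0 u0.
move=> h; apply: (contra _ _ _ _ h (LB T (ltW T0))).
apply: (@lt_le_trans _ _ (kap * (Ex P (L 0) * T))).
  by rewrite mulrA mulrC /T divfK ?gt_eqF// ltrDl.
rewrite ler_pM2l//; apply: (@le_trans _ _ (\sum_(i < K) Ex P (L 0) * (tt i.+1 - tt i))).
  rewrite -mulr_sumr -(big_mkord xpredT (fun i => tt i.+1 - tt i)) telescope_sumr//.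
  by rewrite (part_start pK) (part_end pK) subr0.
apply: ler_sum => i _; apply: ler_wpM2r; first by rewrite subr_ge0; exact: (part_mono pK i).
exact: L_ge (part_ge0 pK i).
Unshelve. all: by end_near. Qed.

Theorem theorem3p6 (R : realType) (n : nat) (n_ge1 : (1 <= n)%N)
  (dO : measure_display) (Omega : measurableType dO) (P : probability Omega R)
  (P_complete : measure_is_complete P)
  (W : R -> Omega -> 'cV[R]_n) (W_bm : brownian_motion P W)
  (dis b : 'cV[R]_n -> 'cV[R]_n) (sigma : 'cV[R]_n -> 'M[R]_n)
  (hA : hypothesis_A dis b sigma)
  (psi : 'cV[R]_n -> 'rV[R]_n -> R) (hP : hypothesis_P psi)
  (x : 'cV[R]_n) (V : R -> Omega -> 'cV[R]_n)
  (V_sde : sde_solution P W (dis \+ b) sigma x V)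
  (Y Y' : R -> Omega -> R) (Z Z' : R -> Omega -> 'rV[R]_n)
  (lambda lambda' : R)
  (sol : ebsde_solution P W psi V Y Z lambda)
  (sol' : ebsde_solution P W psi V Y' Z' lambda')
  (C C' : R)
  (Y_growth : {ae P, forall w, forall t : R, 0 <= t ->
    `|Y t w| <= C * (1 + enorm (V t w) ^+ 2)})
  (Y'_growth : {ae P, forall w, forall t : R, 0 <= t ->
    `|Y' t w| <= C' * (1 + enorm (V t w) ^+ 2)}) :
  lambda = lambda'.
Proof.
apply/eqP; rewrite eq_le; apply/andP; split.
  exact: (ergodic_constant_le P_complete W_bm hA hP V_sde sol sol' Y_growth Y'_growth).
exact: (ergodic_constant_le P_complete W_bm hA hP V_sde sol' sol Y'_growth Y_growth).
Qed.
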